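(* Let $F\in\mathbb{D}^{1,2}$, let $\mathcal{A}\subset\mathbb{R}_+$ be a Borel set of finite Lebesgue measure, and let $\mathcal{F}_{\mathcal{A}}$ be the associated von Neumann subalgebra of $W^*(\{S_t,t\ge0\})$. Then $\tau(F|\mathcal{F}_{\mathcal{A}})\in\mathbb{D}^{1,2}$, and for almost all $t\ge 0$ $$\nabla_t\big(\tau(F|\mathcal{F}_{\mathcal{A}})\big)=\tau\otimes\tau\big(\nabla_t(F)\,|\,\mathcal{F}_{\mathcal{A}}\big)\,\mathbf{1}_{\mathcal{A}}(t).$$
   Context: Setting. Inner products are linear in the first variable. On the full Fock space $\mathbb{C}\Omega\oplus\bigoplus_{n\ge1}L^2(\mathbb{R}_+)^{\otimes n}$ (complex $L^2$, $\|\Omega\|=1$), let $l(h)$ be the left creation operator, $l(h)\Omega=h$, $l(h)(g_1\otimes\cdots\otimes g_n)=h\otimes g_1\otimes\cdots\otimes g_n$, and for real-valued $h\in L^2_{\mathbb{R}}(\mathbb{R}_+)$ let $S(h)=l(h)+l(h)^*$. $S_t=S(\mathbf{1}_{[0,t]})$ is the free Brownian motion and $\mathcal{SC}=W^*(\{S_t,t\ge0\})$ the von Neumann algebra generated by it, equivalently by $\{S(h):h\in L^2_{\mathbb{R}}(\mathbb{R}_+)\}$; $\tau(X)=\langle X\Omega,\Omega\rangle$ is its faithful normal tracial state; $L^2(\mathcal{SC})$ has inner product $\langle X,Y\rangle=\tau(Y^*X)$. $\mathcal{SC}_{alg}$ is the unital $*$-algebra generated by the $S(h)$, $h\in L^2_{\mathbb{R}}(\mathbb{R}_+)$.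 Malliavin derivative. $\mathcal{B}_2=L^2(\mathbb{R}_+;L^2(\mathcal{SC}\otimes\mathcal{SC}^{op},\tau\otimes\tau^{op}))$. $\nabla:\mathcal{SC}_{alg}\to\mathcal{B}_2$, $A\mapsto(\nabla_tA)_{t\ge0}$, is the linear map with $\nabla_tS(h)=h(t)\,1\otimes1$ and $\nabla_t(AB)=A\cdot\nabla_tB+\nabla_tA\cdot B$, where $A\cdot(x\otimes y)\cdot B=Ax\otimes yB$. It is closable from $L^2(\mathcal{SC})$ to $\mathcal{B}_2$; its closure is still denoted $\nabla$, with domain $\mathbb{D}^{1,2}$, the completion of $\mathcal{SC}_{alg}$ for $\|F\|_{1,2}^2=\|F\|_2^2+\|\nabla F\|_{\mathcal{B}_2}^2$. Conditional expectations. For a Borel set $\mathcal{A}$ of finite Lebesgue measure, $\mathcal{F}_{\mathcal{A}}$ is the von Neumann subalgebra generated by $\{S(\mathbf{1}_B):B\subset\mathcal{A}\text{ Borel}\}$. $\tau(\cdot|\mathcal{F}_{\mathcal{A}})$ is the unique trace-preserving conditional expectation of $\mathcal{SC}$ onto $\mathcal{F}_{\mathcal{A}}$, extended to $L^2(\mathcal{SC})$ (as the orthogonal projection onto $L^2(\mathcal{F}_{\mathcal{A}})$), and $\tau\otimes\tau(\cdot|\mathcal{F}_{\mathcal{A}})$ denotes $\tau(\cdot|\mathcal{F}_{\mathcal{A}})\otimes\tau(\cdot|\mathcal{F}_{\mathcal{A}})$ acting on $L^2(\mathcal{SC})\otimes L^2(\mathcal{SC})$. *)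

(* Defs.v *)
From HB Require Import structures.
From mathcomp Require Import all_boot all_order all_algebra.
From mathcomp Require Import sesquilinear.
From mathcomp.real_closed Require Import complex.
From mathcomp Require Import all_classical all_reals all_analysis.

Set Implicit Arguments.
Unset Strict Implicit.
Unset Printing Implicit Defensive.

Import Order.TTheory GRing.Theory Num.Theory.
Import numFieldNormedType.Exports.

Local Open Scope classical_set_scope.
Local Open Scope ring_scope.
Local Open Scope complex_scope.

(* Complex scalars are R[i] over an abstract
   R : realType. "The" object with a defining property is written
   [get [set x | _]], which is that object as soon as it exists and is
   unique. *)

HB.mixin Record CompleteNormedModule_isHilbert (R : realType) H
    of CompleteNormedModule R[i] H := {
  (* linear in the first variable, conjugate-linear in the second *)
  hdot : {dot H for @Num.conj R[i]} ;
  hdot_norm : forall x : H, hdot x x = `|x| ^+ 2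
}.

#[short(type="hilbertType")]
HB.structure Definition Hilbert (R : realType) :=
  { H of CompleteNormedModule R[i] H & CompleteNormedModule_isHilbert R H }.

Section HilbertSpaces.
Context {R : realType}.
Implicit Types U V W : hilbertType R.

Definition sqnorm V (x : V) : R := complex.Re (hdot x x).

Definition span V (A : set V) : set V :=
  [set x | exists (n : nat) (c : 'I_n -> R[i]) (v : 'I_n -> V),
    (forall i, A (v i)) /\ x = \sum_(i < n) c i *: v i].

Definition bounded_op U V (T : U -> V) : Prop := linear T /\ continuous T.

Definition adjoint U (T : U -> U) : U -> U :=
  get [set T' : U -> U | forall x y, hdot (T x) y = hdot x (T' y)].

Definition orth_proj V (A : set V) (x : V) : V :=
  get [set y | A y /\ forall z, A z -> hdot (x - y) z = 0].

Definition commutant V (M : set (V -> V)) : set (V -> V) :=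
  [set T | bounded_op T /\ forall X, M X -> T \o X = X \o T].

(* The second condition makes M a unital subalgebra of B(V). *)
Definition von_neumann_algebra V (M : set (V -> V)) : Prop :=
  (forall X, M X -> M (adjoint X)) /\ commutant (commutant M) = M.

Definition vN_generated V (M : set (V -> V)) : set (V -> V) :=
  smallest (@von_neumann_algebra V) M.

(* The Hilbert space tensor product, characterized up to a unitary. *)
Record tensor_product U V := TensorProduct {
  tp_space :> hilbertType R ;
  tp : U -> V -> tp_space ;
  tp_dot : forall x y x' y',
    hdot (tp x y) (tp x' y') = hdot x x' * hdot y y' ;
  tp_dense : closure (span [set tp z.1 z.2 | z in [set: U * V]]) = setT
}.

Definition tensor_op U V (W : tensor_product U V) (T : U -> U) (T' : V -> V) :
    W -> W :=
  get [set Q : W -> W |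
    bounded_op Q /\ forall x y, Q (tp W x y) = tp W (T x) (T' y)].

End HilbertSpaces.

Section HalfLine.
Context {R : realType}.

(* Functions on the half-line are functions on R whose values outside of
   [half_line] are irrelevant. *)
Definition half_line : set R := `[0, +oo[.

Definition L2C (f : R -> R[i]) : Prop :=
  [/\ measurable_fun half_line (fun t => complex.Re (f t)),
      measurable_fun half_line (fun t => complex.Im (f t)) &
      (\int[lebesgue_measure]_(t in half_line)
         (complex.Re (f t) ^+ 2 + complex.Im (f t) ^+ 2)%:E < +oo)%E].

Definition L2C_dot (f g : R -> R[i]) : R[i] :=
  (\int[lebesgue_measure]_(t in half_line) complex.Re (f t * (g t)^*))%R
  +i* (\int[lebesgue_measure]_(t in half_line) complex.Im (f t * (g t)^*))%R.

(* a real-valued function as a complex-valued one *)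
Definition cpx (h : R -> R) : R -> R[i] := fun t => (h t)%:C.

Definition step_fun (V : hilbertType R) (s : R -> V) : Prop :=
  exists (n : nat) (B : 'I_n -> set R) (v : 'I_n -> V),
    (forall i, measurable (B i)) /\
    s = (fun t => \sum_(i < n) (\1_(B i) t : R)%:C *: v i).

Definition strongly_measurable (V : hilbertType R) (u : R -> V) : Prop :=
  exists s : nat -> R -> V, (forall n, step_fun (s n)) /\
    forall t, half_line t -> s n t @[n --> \oo] --> u t.

(* square of the norm of L^2(R_+; V) *)
Definition bochner_sqnorm (V : hilbertType R) (u : R -> V) : \bar R :=
  (\int[lebesgue_measure]_(t in half_line) (sqnorm (u t))%:E)%E.

Definition bochner_L2 (V : hilbertType R) (u : R -> V) : Prop :=
  strongly_measurable u /\ (bochner_sqnorm u < +oo)%E.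

End HalfLine.

Section FockSpace.
Context {R : realType}.

Definition L2C_seq (gs : seq (R -> R[i])) : Prop := {in gs, forall g, L2C g}.

(* <g_1 (x) .. (x) g_n, h_1 (x) .. (x) h_m> *)
Definition fock_gram (gs hs : seq (R -> R[i])) : R[i] :=
  if size gs == size hs then \prod_(p <- zip gs hs) L2C_dot p.1 p.2 else 0.

(* The Hilbert direct sum of the Hilbert tensor powers of L^2(R_+), characterized
   up to a unitary: [fock_tens [:: g_1; ..; g_n]] is the elementary tensor
   g_1 (x) .. (x) g_n (the vacuum when n = 0); elementary tensors of different
   degrees are orthogonal. *)
Record fock_space := FockSpace {
  fock_carrier :> hilbertType R ;
  fock_tens : seq (R -> R[i]) -> fock_carrier ;
  fock_dot : forall gs hs, L2C_seq gs -> L2C_seq hs ->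
    hdot (fock_tens gs) (fock_tens hs) = fock_gram gs hs ;
  fock_dense : closure (span (fock_tens @` L2C_seq)) = setT
}.

Variable H : fock_space.

Definition vacuum : H := fock_tens H [::].

Definition creation (h : R -> R[i]) : H -> H :=
  get [set T : H -> H | bounded_op T /\
    forall gs, L2C_seq gs -> T (fock_tens H gs) = fock_tens H (h :: gs)].

Definition semicircular (h : R -> R) : H -> H :=
  fun x => creation (cpx h) x + adjoint (creation (cpx h)) x.

Definition free_bm (t : R) : H -> H := semicircular \1_(`[0, t]).

Definition SC : set (H -> H) := vN_generated (free_bm @` half_line).

Definition tau (X : H -> H) : R[i] := hdot (X vacuum) vacuum.

(* F_A *)
Definition SC_of (A : set R) : set (H -> H) :=
  vN_generated
    [set semicircular \1_B | B in [set B | measurable B /\ B `<=` A]].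

(* L^2(SC): the completion of SC for <X, Y> = tau (Y^* X) *)
Record L2SC := MkL2SC {
  L2_space :> hilbertType R ;
  L2_emb : (H -> H) -> L2_space ;
  L2_dot : forall X Y, SC X -> SC Y ->
    hdot (L2_emb X) (L2_emb Y) = tau (adjoint Y \o X) ;
  L2_dense : closure (L2_emb @` SC) = setT
}.

Variable K : L2SC.

(* tau ( . | F_A) on L^2(SC), the orthogonal projection onto L^2(F_A) *)
Definition cond_exp (A : set R) : K -> K :=
  orth_proj (closure (L2_emb K @` SC_of A)).

Definition left_mult (A : H -> H) : K -> K :=
  get [set T : K -> K | bounded_op T /\
    forall X, SC X -> T (L2_emb K X) = L2_emb K (A \o X)].

Definition right_mult (B : H -> H) : K -> K :=
  get [set T : K -> K | bounded_op T /\
    forall X, SC X -> T (L2_emb K X) = L2_emb K (X \o B)].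

(* L^2(SC (x) SC^op), as the Hilbert tensor product of L^2(SC) with
   L^2(SC^op); the latter is L^2(SC) because tau is a trace. *)
Variable K2 : tensor_product K K.

(* A . (x (x) y) . B = Ax (x) yB *)
Definition bimod (A B : H -> H) : K2 -> K2 :=
  tensor_op (left_mult A) (right_mult B).

(* The graph of the gradient on SC_alg: [malliavin_alg A u] means that A
   belongs to SC_alg and that u is a representative of its gradient. Since
   each semicircular h is self-adjoint, the domain is the unital *-algebra
   generated by the semicircular h. *)
Inductive malliavin_alg : (H -> H) -> (R -> K2) -> Prop :=
| malliavin_one : malliavin_alg idfun (fun=> 0)
| malliavin_S (h : R -> R) : L2C (cpx h) ->
    malliavin_alg (semicircular h)
      (fun t => (h t)%:C *: tp K2 (L2_emb K idfun) (L2_emb K idfun))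
| malliavin_lin (a : R[i]) A B u v :
    malliavin_alg A u -> malliavin_alg B v ->
    malliavin_alg (fun x => a *: A x + B x) (fun t => a *: u t + v t)
| malliavin_mul A B u v :
    malliavin_alg A u -> malliavin_alg B v ->
    malliavin_alg (A \o B) (fun t => bimod A idfun (v t) + bimod idfun B (u t)).

(* The graph of the closure, from L^2(SC) to B_2 = L^2(R_+; L^2(SC (x) SC^op));
   by closability, u is determined by F up to equality almost everywhere. *)
Definition malliavin_graph (F : K) (u : R -> K2) : Prop :=
  bochner_L2 u /\
  exists (A : nat -> H -> H) (v : nat -> R -> K2),
    [/\ forall n, malliavin_alg (A n) (v n),
        L2_emb K (A n) @[n --> \oo] --> F &
        bochner_sqnorm (fun t => v n t - u t) @[n --> \oo] --> 0%E].

(* D^{1,2} *)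
Definition D12 (F : K) : Prop := exists u, malliavin_graph F u.

(* (nabla_t F)_t, as a representative of a class in B_2 *)
Definition nabla (F : K) : R -> K2 := get [set u | malliavin_graph F u].

(* tau (x) tau ( . | F_A) *)
Definition cond_exp2 (A : set R) : K2 -> K2 :=
  tensor_op (cond_exp A) (cond_exp A).

End FockSpace.

Arguments fock_space : clear implicits.

(* Main.v *)
(* The map X |-> X Om identifies L^2(SC) with the full Fock space, and real elementary
   tensors with Wick products. Through this identification

   - the conditional expectation onto F_A is the projection onto the closed span of the
     tensors of functions supported in A. Indeed this projection commutes with the
     generators of F_A, hence with F_A, so it fixes X Om for X in F_A; it maps
     g_1 (x) .. (x) g_n to 1_A g_1 (x) .. (x) 1_A g_n;
   - right multiplication by S(h) is the right semicircular operator, which commutes with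
     the left ones, so that the bimodule operations in the product rule are bounded;
   - the gradient of the Wick product of g_1, .., g_n at t is the sum over k of
     g_k(t) W(g_1 .. g_(k-1)) (x) W(g_(k+1) .. g_n).

   Hence the claimed formula holds on Wick products, which span the algebra, and it passes
   to the closure of the gradient since conditional expectations are bounded. Closability,
   which makes the gradient well defined almost everywhere, is integration by parts
   against the total family of the g W(a) (x) W(b). *)

Require Import Defs.
From HB Require Import structures.
From mathcomp Require Import all_boot all_order all_algebra.
From mathcomp Require Import sesquilinear.
From mathcomp.real_closed Require Import complex.
From mathcomp Require Import all_classical all_reals all_analysis.
From mathcomp Require Import measurable_realfun ring lra.

Set Implicit Arguments.
Unset Strict Implicit.
Unset Printing Implicit Defensive.

Import Order.TTheory GRing.Theory Num.Theory.
Import numFieldNormedType.Exports.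

Local Open Scope classical_set_scope.
Local Open Scope ring_scope.
Local Open Scope complex_scope.

(* Otherwise read as [Num.conj], which is convertible to [conjc] but opaque to rewriting. *)
Local Notation "x ^*" := (conjc x) : ring_scope.

Import HBNNSimple.

(** * Hilbert spaces *)

Section HilbertBasics.
Context {R : realType}.
Implicit Types U V W : hilbertType R.

(** Fock space, [L2SC] and the tensor product are known only through inner products and density, and
    most operators only through [get]. So existence comes first: [extension] builds a bounded
    operator from its values on a total family, given a bound on finite combinations; identities are
    then checked on total families or by inner products. Estimates use the real number [sqnorm], as
    the norm takes values in [R[i]].

    The gradient on the algebra is a relation: [malliavin_alg A u] allows many derivations for one
    operator. Each derivation is therefore reduced to a Wick expansion giving both A Om and u, and
    conditional expectation acts on that expansion letter by letter.

    SC is generated by the S(1_[0,t]) alone. That it contains every S(h) needs a Dynkin argument for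
    indicators, then simple functions and dominated convergence.

    In the uniqueness of the gradient, the exceptional null sets depend on the test vector; strong
    measurability leaves only countably many vectors to test. *)

Lemma dotDl V (x y z : V) : hdot (x + y) z = hdot x z + hdot y z.
Proof. exact: linearDl. Qed.

Lemma dotZl V a (x z : V) : hdot (a *: x) z = a * hdot x z.
Proof. exact: linearZl_LR. Qed.

Lemma dotDr V (x y z : V) : hdot z (x + y) = hdot z x + hdot z y.
Proof. exact: linearDr. Qed.

Lemma dotZr V a (x z : V) : hdot z (a *: x) = a^* * hdot z x.
Proof. exact: linearZr_LR. Qed.

Lemma dotNl V (x z : V) : hdot (- x) z = - hdot x z.
Proof. exact: linearNl. Qed.

Lemma dotNr V (x z : V) : hdot z (- x) = - hdot z x.
Proof. exact: linearNr. Qed.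

Lemma dotBl V (x y z : V) : hdot (x - y) z = hdot x z - hdot y z.
Proof. exact: linearBl. Qed.

Lemma dotBr V (x y z : V) : hdot z (x - y) = hdot z x - hdot z y.
Proof. exact: linearBr. Qed.

Lemma dot0l V (z : V) : hdot 0 z = 0.
Proof. exact: linear0l. Qed.

Lemma dot0r V (z : V) : hdot z 0 = 0.
Proof. exact: linear0r. Qed.

Lemma dotC V (x y : V) : hdot x y = (hdot y x)^*.
Proof. by rewrite (hermC hdot) expr0 mul1r. Qed.

Lemma dot_suml V I (r : seq I) (F : I -> V) z :
  hdot (\sum_(i <- r) F i) z = \sum_(i <- r) hdot (F i) z.
Proof. exact: linear_sumlz. Qed.

Lemma dot_sumr V I (r : seq I) (F : I -> V) z :
  hdot z (\sum_(i <- r) F i) = \sum_(i <- r) hdot z (F i).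
Proof. exact: linear_sumr. Qed.

Lemma sqnormE V (x : V) : hdot x x = (sqnorm x)%:C.
Proof.
rewrite /sqnorm; have := dnorm_ge0 hdot x; case: (hdot x x) => a b.
by rewrite lecE /= => /andP[/eqP-> _].
Qed.

Lemma norm_sqnorm V (x : V) : `|x| ^+ 2 = (sqnorm x)%:C.
Proof. by rewrite -hdot_norm sqnormE. Qed.

Lemma normE V (x : V) : `|x| = (Num.sqrt (sqnorm x))%:C.
Proof.
have : (0 : R[i]) <= `|x| by [].
have := norm_sqnorm x; case: (`|x|) => a b h; rewrite lecE /= => /andP[/eqP b0 a0].
rewrite b0 in h *; have {h} <- : a ^+ 2 = sqnorm x.
  by move: h => /(congr1 (@complex.Re R)) /= <-; rewrite mul0r subr0.
by rewrite sqrtr_sqr ger0_norm.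
Qed.

Lemma sqnorm_ge0 V (x : V) : 0 <= sqnorm x.
Proof. by have := dnorm_ge0 hdot x; rewrite sqnormE ler0c. Qed.

Lemma sqnorm_eq0 V (x : V) : sqnorm x = 0 -> x = 0.
Proof.
move=> x0; apply/normr0_eq0.
by rewrite normE x0 sqrtr0.
Qed.

Lemma sqnorm0 V : sqnorm (0 : V) = 0.
Proof. by rewrite /sqnorm dot0l. Qed.

Lemma sqnormZ V a (x : V) : sqnorm (a *: x) = complex.Re (a * a^*) * sqnorm x.
Proof.
rewrite {1}/sqnorm dotZl dotZr mulrA sqnormE.
by case: a => a b /=; rewrite mulr0 subr0.
Qed.

Lemma sqnormN V (x : V) : sqnorm (- x) = sqnorm x.
Proof. by rewrite /sqnorm dotNl dotNr opprK. Qed.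

Lemma sqnormBC V (x y : V) : sqnorm (x - y) = sqnorm (y - x).
Proof. by rewrite -sqnormN opprB. Qed.

Lemma cReD (a b : R[i]) : complex.Re (a + b) = complex.Re a + complex.Re b.
Proof. by case: a b => ? ? []. Qed.

Lemma cImD (a b : R[i]) : complex.Im (a + b) = complex.Im a + complex.Im b.
Proof. by case: a b => ? ? []. Qed.

Lemma cReN (a : R[i]) : complex.Re (- a) = - complex.Re a.
Proof. by case: a. Qed.

Lemma cImN (a : R[i]) : complex.Im (- a) = - complex.Im a.
Proof. by case: a. Qed.

Lemma cReJ (a : R[i]) : complex.Re a^* = complex.Re a.
Proof. by case: a. Qed.

Lemma cImJ (a : R[i]) : complex.Im a^* = - complex.Im a.
Proof. by case: a. Qed.

Lemma cReM (a b : R[i]) :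
  complex.Re (a * b) = complex.Re a * complex.Re b - complex.Im a * complex.Im b.
Proof. by case: a b => ? ? []. Qed.

Lemma cImM (a b : R[i]) :
  complex.Im (a * b) = complex.Re a * complex.Im b + complex.Im a * complex.Re b.
Proof. by case: a b => ? ? []. Qed.

Lemma conjM (a b : R[i]) : (a * b)^* = a^* * b^*.
Proof. exact: rmorphM. Qed.

Lemma conjD (a b : R[i]) : (a + b)^* = a^* + b^*.
Proof. exact: rmorphD. Qed.

Lemma cReZ r (a : R[i]) : complex.Re (r%:C * a) = r * complex.Re a.
Proof. by rewrite cReM mul0r subr0. Qed.

Lemma cImZ r (a : R[i]) : complex.Im (r%:C * a) = r * complex.Im a.
Proof. by rewrite cImM mul0r addr0. Qed.

Lemma sqnormD V (x y : V) :
  sqnorm (x + y) = sqnorm x + sqnorm y + 2 * complex.Re (hdot x y).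
Proof.
rewrite /sqnorm dotDl !dotDr !cReD (dotC y x) cReJ mulr2n mulrDl mul1r; ring.
Qed.

Lemma sqnormB V (x y : V) :
  sqnorm (x - y) = sqnorm x + sqnorm y - 2 * complex.Re (hdot x y).
Proof. by rewrite sqnormD sqnormN dotNr cReN mulrN. Qed.

Lemma sqnormDle V (x y : V) : sqnorm (x + y) <= 2 * (sqnorm x + sqnorm y).
Proof.
have := sqnorm_ge0 (x - y); rewrite sqnormB sqnormD; lra.
Qed.

Lemma sqnormBle V (x y : V) : sqnorm (x - y) <= 2 * (sqnorm x + sqnorm y).
Proof. by rewrite -(sqnormN y) sqnormDle. Qed.

Lemma parallelogram V (x y : V) :
  sqnorm (x + y) + sqnorm (x - y) = 2 * (sqnorm x + sqnorm y).
Proof. rewrite sqnormB sqnormD; ring. Qed.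

(** The squared modulus, kept in [R] so that real arithmetic applies to it. *)
Definition nsq (a : R[i]) : R := complex.Re a ^+ 2 + complex.Im a ^+ 2.

Lemma nsqE a : (nsq a)%:C = a * a^*.
Proof. by rewrite /nsq add_Re2_Im2 sqr_normc. Qed.

Lemma nsq_ge0 a : 0 <= nsq a.
Proof. by rewrite addr_ge0 ?sqr_ge0. Qed.

Lemma nsq_eq0 a : nsq a = 0 -> a = 0.
Proof.
case: a => a b; rewrite /nsq /= => h.
have := sqr_ge0 a; have := sqr_ge0 b => b0 a0.
have /eqP : a ^+ 2 = 0 by lra.
have /eqP : b ^+ 2 = 0 by lra.
by rewrite !sqrf_eq0 => /eqP -> /eqP ->.
Qed.

Lemma nsqB_le a b : nsq (a - b) <= 2 * (nsq a + nsq b).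
Proof.
rewrite /nsq !cReD !cImD !cReN !cImN.
have := sqr_ge0 (complex.Re a + complex.Re b).
have := sqr_ge0 (complex.Im a + complex.Im b); nra.
Qed.

Lemma nsq_sqnormZ V a (x : V) : sqnorm (a *: x) = nsq a * sqnorm x.
Proof. by rewrite sqnormZ -nsqE. Qed.

Lemma CauchySchwarz_sqnorm V (x y : V) :
  nsq (hdot x y) <= sqnorm x * sqnorm y.
Proof.
have [y0|y0] := eqVneq (sqnorm y) 0.
  by rewrite (sqnorm_eq0 y0) dot0r /nsq /= expr0n /= addr0 sqnorm0 mulr0.
have ygt0 : 0 < sqnorm y by rewrite lt_def y0 sqnorm_ge0.
(* This square norm equals |y|^2 (|x|^2 |y|^2 - |<x, y>|^2); scaling by |y|^2 avoids a division in
   [R[i]]. *)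
have := sqnorm_ge0 ((sqnorm y)%:C *: x - hdot x y *: y).
rewrite sqnormB !nsq_sqnormZ dotZl dotZr mulrA -mulrA (mulrC _ (hdot x y)) -nsqE.
rewrite -rmorphM /= {1}/nsq /= => h.
have {}h : 0 <= sqnorm y * (sqnorm x * sqnorm y - nsq (hdot x y)) by nra.
by rewrite -subr_ge0; rewrite pmulr_rge0 in h.
Qed.

Lemma dot_eqP V (x : V) : (forall y, hdot x y = 0) -> x = 0.
Proof. by move=> /(_ x) h; apply: sqnorm_eq0; rewrite /sqnorm h. Qed.

End HilbertBasics.

(** * Topology and bounded operators in terms of real square norms *)

Section HilbertTopology.
Context {R : realType}.
Implicit Types U V W : hilbertType R.

Lemma Cpos_real (e : R[i]) : 0 < e -> exists2 r : R, 0 < r & e = r%:C.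
Proof. by case: e => a b; rewrite ltcE /= => /andP[/eqP-> a0]; exists a. Qed.

Lemma norm_ltE V (x : V) (r : R) : 0 < r ->
  (`|x| < r%:C) = (sqnorm x < r ^+ 2).
Proof.
move=> r0; rewrite normE ltcR.
by rewrite -{1}(ger0_norm (ltW r0)) -sqrtr_sqr ltr_sqrt ?exprn_gt0.
Qed.

(** Radii of balls live in [R[i]], but a positive element of [R[i]] is real; squaring the radius
    removes the roots from all later estimates. *)
Lemma nbhs_sqnormP V (x : V) (B : set V) :
  nbhs x B <-> exists2 e : R, 0 < e & forall y, sqnorm (x - y) < e -> B y.
Proof.
split.
  move=> /nbhs_normP[e /= e0 eB]; have [r r0 er] := Cpos_real e0.
  exists (r ^+ 2); rewrite ?exprn_gt0// => y xy; apply: eB => /=.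
  by rewrite /ball_ /= er norm_ltE.
move=> [e e0 eB]; apply/nbhs_normP; exists (Num.sqrt e)%:C => /=.
  by rewrite ltcR sqrtr_gt0.
move=> y /=; rewrite norm_ltE ?sqrtr_gt0// sqr_sqrtr ?(ltW e0)// => xy.
exact: eB.
Qed.

Lemma closure_sqnormP V (A : set V) (x : V) :
  closure A x <-> forall e : R, 0 < e -> exists2 a, A a & sqnorm (x - a) < e.
Proof.
split=> [cA e e0|h B /nbhs_sqnormP[e e0 eB]].
  have [|a [Aa xa]] := cA [set y | sqnorm (x - y) < e].
    by apply/nbhs_sqnormP; exists e.
  by exists a.
by have [a Aa xa] := h _ e0; exists a; split=> //; exact: eB.
Qed.

Lemma cvg_sqnormP V (u : nat -> V) (l : V) :
  (u n @[n --> \oo] --> l) <->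
  forall e : R, 0 < e -> exists N, forall n, (N <= n)%N -> sqnorm (l - u n) < e.
Proof.
split=> [ul e e0|h B /nbhs_sqnormP[e e0 eB]].
  have : nbhs l [set y | sqnorm (l - y) < e] by apply/nbhs_sqnormP; exists e.
  by move/ul => [N _ hN]; exists N => n Nn; exact: hN.
by have [N hN] := h _ e0; exists N => // n /= Nn; exact/eB/hN.
Qed.

Lemma cauchy_sqnorm_cvg V (u : nat -> V) :
  (forall e : R, 0 < e -> exists N, forall m n, (N <= m)%N -> (N <= n)%N ->
     sqnorm (u m - u n) < e) ->
  exists l : V, u n @[n --> \oo] --> l.
Proof.
move=> h; suff : cvg (u n @[n --> \oo]) by move=> /cvg_ex.
apply/cauchy_cvgP/cauchyP => e e0; have [r r0 ->] := Cpos_real e0.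
have [N hN] := h _ (exprn_gt0 2 r0).
exists (u N); exists N => // n /= Nn.
by rewrite -ball_normE /ball_ /= norm_ltE//; exact: hN.
Qed.

(** The working form of [bounded_op]: [C] bounds the square of the operator norm. *)
Definition bop U V (T : U -> V) : Prop :=
  linear T /\ exists2 C : R, 0 <= C & forall x, sqnorm (T x) <= C * sqnorm x.

Section LinearFacts.
Variables (U V : hilbertType R) (T : U -> V).
Hypothesis lT : linear T.

Lemma lin0 : T 0 = 0.
Proof. by have := lT (-1) 0 0; rewrite !scaleN1r oppr0 addr0 addNr. Qed.

Lemma linD x y : T (x + y) = T x + T y.
Proof. by have := lT 1 x y; rewrite !scale1r. Qed.

Lemma linZ a x : T (a *: x) = a *: T x.
Proof. by have := lT a x 0; rewrite !addr0 lin0 addr0. Qed.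

Lemma linN x : T (- x) = - T x.
Proof. by rewrite -scaleN1r linZ scaleN1r. Qed.

Lemma linB x y : T (x - y) = T x - T y.
Proof. by rewrite linD linN. Qed.

Lemma lin_sum I (r : seq I) (F : I -> U) :
  T (\sum_(i <- r) F i) = \sum_(i <- r) T (F i).
Proof.
elim: r => [|i r ih]; first by rewrite !big_nil lin0.
by rewrite !big_cons linD ih.
Qed.

End LinearFacts.

Lemma bopP U V (T : U -> V) : bounded_op T <-> bop T.
Proof.
split=> [[lT cT]|[lT [C C0 hC]]]; split=> //.
  have : nbhs (T 0) [set y | sqnorm (T 0 - y) < 1] by apply/nbhs_sqnormP; exists 1.
  move=> /(cT 0)/nbhs_sqnormP[e e0 eB].
  have h x : sqnorm x < e -> sqnorm (T x) < 1.
    by move=> xe; have := eB x; rewrite /= (lin0 lT) !sub0r !sqnormN; exact.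
  exists (2 / e) => [|x]; first by rewrite divr_ge0// ltW.
  have [x0|x0] := eqVneq (sqnorm x) 0.
    by rewrite (sqnorm_eq0 x0) (lin0 lT) !sqnorm0 mulr0.
  have xgt0 : 0 < sqnorm x by rewrite lt_def x0 sqnorm_ge0.
  (* Rescales [x] to square norm [e / 2], inside the ball where [h] applies. *)
  pose c := Num.sqrt (e / (2 * sqnorm x)).
  have c2 : nsq c%:C = e / (2 * sqnorm x).
    by rewrite /nsq /= expr0n /= addr0 sqr_sqrtr// divr_ge0 ?mulr_ge0// ltW.
  have := h (c%:C *: x); rewrite (linZ lT) !nsq_sqnormZ c2.
  have -> : e / (2 * sqnorm x) * sqnorm x = e / 2 by field.
  move=> /(_ _)/ltW; rewrite ltr_pdivrMr// mulr_natr mulr2n ltrDl => /(_ e0) h1.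
  have -> : sqnorm (T x) = (2 / e * sqnorm x) * (e / (2 * sqnorm x) * sqnorm (T x)).
    by field; rewrite x0 gt_eqF.
  by apply: ler_piMr => //; rewrite mulr_ge0 ?divr_ge0 ?(ltW e0)// ltW.
move=> x B /nbhs_sqnormP[e e0 eB]; apply/nbhs_sqnormP.
exists (e / (C + 1)); first by rewrite divr_gt0// ltr_wpDl.
move=> y xy; apply: eB; rewrite -(linB lT).
apply: le_lt_trans (hC _) _.
rewrite ltr_pdivlMr ?ltr_wpDl// in xy.
apply: le_lt_trans xy; rewrite mulrC ler_wpM2l ?sqnorm_ge0//; lra.
Qed.

Lemma bop_cvg U V (T : U -> V) (u : nat -> U) l : bop T ->
  u n @[n --> \oo] --> l -> T (u n) @[n --> \oo] --> T l.
Proof.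
by move=> /bopP[_ cT] ul; exact: (continuous_cvg _ (cT l) ul).
Qed.

Lemma bop_id U : bop (@idfun U).
Proof. by split=> //; exists 1 => // x; rewrite mul1r. Qed.

Lemma bop_comp U V W (S : V -> W) (T : U -> V) : bop S -> bop T -> bop (S \o T).
Proof.
move=> [lS [C C0 hC]] [lT [D D0 hD]]; split.
  by move=> a x y /=; rewrite lT lS.
exists (C * D); rewrite ?mulr_ge0// => x /=.
apply: le_trans (hC _) _; rewrite -mulrA ler_wpM2l//.
Qed.

Lemma bop_lin U V a (S T : U -> V) : bop S -> bop T ->
  bop (fun x => a *: S x + T x).
Proof.
move=> [lS [C C0 hC]] [lT [D D0 hD]]; split.
  move=> b x y /=; rewrite lT lS !scalerDr !scalerA (mulrC a b).
  by rewrite -!addrA; congr (_ + _); rewrite addrCA.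
exists (2 * (nsq a * C + D)).
  by rewrite mulr_ge0// addr_ge0// mulr_ge0// nsq_ge0.
move=> x; apply: le_trans (sqnormDle _ _) _; rewrite -mulrA ler_pM2l// mulrDl lerD//.
by rewrite nsq_sqnormZ -mulrA ler_wpM2l ?nsq_ge0.
Qed.

Lemma bop_add U V (S T : U -> V) : bop S -> bop T -> bop (fun x => S x + T x).
Proof.
move=> bS bT; have := bop_lin 1 bS bT.
by congr bop; apply/funext => x; rewrite scale1r.
Qed.

Lemma bop_zero U V : bop (fun _ : U => 0 : V).
Proof.
split; first by move=> a x y; rewrite scaler0 addr0.
by exists 0 => // x; rewrite sqnorm0 mul0r.
Qed.

Lemma bop_eq_total U V (S T : U -> V) (A : set U) :
  bop S -> bop T -> closure (Defs.span A) = setT ->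
  (forall x, A x -> S x = T x) -> S = T.
Proof.
move=> bS bT dA ST; apply/funext => x.
have [lD [C C0 hC]] := bop_lin (-1) bT bS.
apply/eqP; rewrite -subr_eq0; apply/eqP/sqnorm_eq0/eqP.
rewrite eq_le sqnorm_ge0 andbT; apply/ler_addgt0Pl => e e0; rewrite addr0.
have C1 : 0 < C + 1 by rewrite ltr_wpDl.
have : closure (Defs.span A) x by rewrite dA.
move=> /closure_sqnormP /(_ (e / (C + 1))); rewrite divr_gt0// => /(_ isT).
move=> [_ [n [c [v [Av ->]]]]]; set y := \sum_(_ < _) _ => xy.
have Ty : S y = T y.
  rewrite /y (lin_sum (proj1 bS)) (lin_sum (proj1 bT)); apply: eq_bigr => i _.
  by rewrite (linZ (proj1 bS)) (linZ (proj1 bT)) ST.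
have := hC (x - y); rewrite scaleN1r (linB (proj1 bT)) (linB (proj1 bS)) Ty.
have -> : - (T x - T y) + (S x - T y) = S x - T x.
  by rewrite opprB addrC addrA subrK.
move=> h; apply: le_trans h _.
rewrite ltr_pdivlMr// mulrC in xy; apply: le_trans (ltW xy).
rewrite ler_wpM2r ?sqnorm_ge0//; lra.
Qed.

Lemma span_memE V (A : set V) I (f : I -> V) : A = range f ->
  forall x, Defs.span A x <-> exists s : seq (R[i] * I), x = \sum_(p <- s) p.1 *: f p.2.
Proof.
move=> -> x; split.
  move=> [n [c [v [/(_ _)/cid2 - vA ->]]]].
  exists [seq (c i, sval (vA i)) | i <- index_enum 'I_n].
  rewrite big_map; apply: eq_bigr => i _ /=.
  by case: (vA i) => j /= _ ->.
move=> [s ->]; exists (size s), (fun i => (tnth (in_tuple s) i).1), 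
  (fun i => f (tnth (in_tuple s) i).2); split; first by move=> i; exists (tnth (in_tuple s) i).2.
by rewrite big_tnth.
Qed.

End HilbertTopology.

(** * Extension from total families, projections, Riesz representation, adjoints *)

Section Constructions.
Context {R : realType}.
Implicit Types U V W : hilbertType R.

(** The list stores indices, not vectors, so that one list can be evaluated along two families, as
    in [extension]. *)
Definition comb I V (f : I -> V) (s : seq (R[i] * I)) : V :=
  \sum_(p <- s) p.1 *: f p.2.

Definition cscale I (a : R[i]) (s : seq (R[i] * I)) := [seq (a * p.1, p.2) | p <- s].

Lemma comb_cat I V (f : I -> V) s t : comb f (s ++ t) = comb f s + comb f t.
Proof. by rewrite /comb big_cat. Qed.

Lemma comb_cscale I V (f : I -> V) a s : comb f (cscale a s) = a *: comb f s.
Proof.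
by rewrite /comb big_map scaler_sumr; apply: eq_bigr => p _; rewrite scalerA.
Qed.

Lemma total_comb I V (f : I -> V) : closure (Defs.span (range f)) = setT ->
  forall x (e : R), 0 < e -> exists s, sqnorm (x - comb f s) < e.
Proof.
move=> df x e e0; have : closure (Defs.span (range f)) x by rewrite df.
move=> /closure_sqnormP/(_ e e0)[_ /(span_memE (erefl _))[s ->] h].
by exists s.
Qed.

Lemma sqnorm_le_eps (r C x : R) : 0 <= C ->
  (forall e, 0 < e -> r <= x + C * e) -> r <= x.
Proof.
move=> C0 h; apply/ler_addgt0Pl => e e0.
have C1 : 0 < C + 1 by rewrite ltr_wpDl.
apply: le_trans (h (e / (C + 1)) _) _; first by rewrite divr_gt0.
rewrite addrC lerD2r mulrCA ger_pMr// ler_pdivrMr// mul1r; lra.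
Qed.

Lemma invSn_lt (e : R) : 0 < e ->
  exists N, forall n, (N <= n)%N -> (n.+1%:R^-1 : R) < e.
Proof.
move=> e0; exists (Num.truncn e^-1) => n Nn.
rewrite -(invrK e) ltf_pV2 ?posrE ?invr_gt0//.
by apply: lt_le_trans (truncnS_gt _) _; rewrite ler_nat.
Qed.

(** The graph of T is the closure of the pairs ([comb f s], [comb g s]), which is what [rel]
    expresses. The bound makes it single-valued even if the family [f] is linearly dependent, and
    completeness of [V] makes it defined everywhere. *)
Lemma extension I U V (f : I -> U) (g : I -> V) (C : R) : 0 <= C ->
  closure (Defs.span (range f)) = setT ->
  (forall s, sqnorm (comb g s) <= C * sqnorm (comb f s)) ->
  exists2 T : U -> V, bop T & forall i, T (f i) = g i.
Proof.
move=> C0 df hC.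
pose rel x y := forall e : R, 0 < e ->
  exists2 s, sqnorm (x - comb f s) < e & sqnorm (y - comb g s) < e.
have rel_lin a x y x' y' : rel x y -> rel x' y' -> rel (a *: x + x') (a *: y + y').
  move=> r r' e e0; pose M := 2 * (nsq a + 1).
  have M0 : 0 < M by rewrite mulr_gt0// ltr_wpDl// nsq_ge0.
  have eM : 0 < e / M by rewrite divr_gt0.
  have [s sx sy] := r _ eM; have [s' sx' sy'] := r' _ eM.
  have aux W (u v u' v' : W) : sqnorm (u - v) < e / M -> sqnorm (u' - v') < e / M ->
      sqnorm (a *: u + u' - (a *: v + v')) < e.
    rewrite !ltr_pdivlMr// => h h'.
    have -> : a *: u + u' - (a *: v + v') = a *: (u - v) + (u' - v').
      by rewrite scalerBr opprD addrACA.
    apply: le_lt_trans (sqnormDle _ _) _; rewrite nsq_sqnormZ.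
    have := nsq_ge0 a; have := sqnorm_ge0 (u - v); have := sqnorm_ge0 (u' - v').
    rewrite /M in h h' *; nra.
  by exists (cscale a s ++ s'); rewrite comb_cat comb_cscale; exact: aux.
(* The factor 4 comes from using |a + b|^2 <= 2 (|a|^2 + |b|^2) twice. *)
have rel_bd x y : rel x y -> sqnorm y <= (4 * C) * sqnorm x.
  move=> r; apply: (@sqnorm_le_eps _ (2 + 4 * C)).
    by rewrite addr_ge0// mulr_ge0.
  move=> e e0; have [s sx sy] := r _ e0.
  have h1 : sqnorm y <= 2 * (sqnorm (y - comb g s) + sqnorm (comb g s)).
    by rewrite -{1}(subrK (comb g s) y) sqnormDle.
  have h2 : sqnorm (comb f s) <= 2 * (sqnorm (x - comb f s) + sqnorm x).
    by rewrite sqnormBC -{1}(subrK x (comb f s)) sqnormDle.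
  have := hC s; nra.
have rel_ex x : exists y, rel x y.
  have /choice[s hs] : forall n : nat, exists s, sqnorm (x - comb f s) < n.+1%:R^-1.
    by move=> n; apply: total_comb; rewrite ?invr_gt0.
  have [|y /cvg_sqnormP ly] := @cauchy_sqnorm_cvg _ V (fun n => comb g (s n)).
    move=> e e0; have C1 : 0 < 4 * (C + 1) by rewrite mulr_gt0// ltr_wpDl.
    have [N hN] := invSn_lt (divr_gt0 e0 C1).
    exists N => m n Nm Nn.
    have -> : comb g (s m) - comb g (s n) = comb g (s m ++ cscale (-1) (s n)).
      by rewrite comb_cat comb_cscale scaleN1r.
    apply: le_lt_trans (hC _) _; rewrite comb_cat comb_cscale scaleN1r.
    have -> : comb f (s m) - comb f (s n) = (x - comb f (s n)) - (x - comb f (s m)).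
      by rewrite opprB [RHS]addrC subrKA.
    have h1 := lt_trans (hs m) (hN _ Nm); have h2 := lt_trans (hs n) (hN _ Nn).
    rewrite !ltr_pdivlMr// in h1 h2.
    have := sqnormBle (x - comb f (s n)) (x - comb f (s m)).
    have := sqnorm_ge0 (x - comb f (s n)); have := sqnorm_ge0 (x - comb f (s m)).
    nra.
  exists y => e e0; have [N hN] := invSn_lt e0; have [N' hN'] := ly _ e0.
  exists (s (maxn N N')); last by apply: hN'; exact: leq_maxr.
  by apply: lt_trans (hs _) _; apply: hN; exact: leq_maxl.
have rel_uniq x y y' : rel x y -> rel x y' -> y = y'.
  move=> r r'; apply/eqP; rewrite -subr_eq0; apply/eqP/sqnorm_eq0/eqP.
  rewrite eq_le sqnorm_ge0 andbT.
  have := rel_bd _ _ (rel_lin (-1) _ _ _ _ r' r).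
  by rewrite !scaleN1r addNr sqnorm0 mulr0 addrC.
have /choice[T hT] := rel_ex.
exists T.
  split; first by move=> a x y; apply: rel_uniq (hT _) _; exact: rel_lin.
  by exists (4 * C); [rewrite mulr_ge0|move=> x; exact/rel_bd/hT].
move=> i; apply: rel_uniq (hT _) _ => e e0.
by exists [:: (1, i)]; rewrite /comb big_seq1 scale1r subrr sqnorm0.
Qed.

Definition subspace V (A : set V) : Prop :=
  A 0 /\ forall a x y, A x -> A y -> A (a *: x + y).

Lemma projection_exists V (A : set V) : subspace A -> closure A = A ->
  forall x, exists2 y, A y & forall z, A z -> hdot (x - y) z = 0.
Proof.
move=> [A0 Alin] cA x.
have AB u v : A u -> A v -> A (u + v) by move=> *; rewrite -(scale1r u); exact: Alin.
have AZ c u : A u -> A (c *: u) by move=> *; rewrite -(addr0 (_ *: _)); exact: Alin.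
pose D := [set sqnorm (x - a) | a in A]; pose d := inf D.
have D0 : has_inf D.
  by split; [exists (sqnorm (x - 0)), 0|exists 0 => _ [a _ <-]; exact: sqnorm_ge0].
have dle a : A a -> d <= sqnorm (x - a).
  by move=> Aa; apply: ge_inf; [exact: (proj2 D0)|exists a].
have /choice[s hs] : forall n : nat, exists a, A a /\ sqnorm (x - a) < d + n.+1%:R^-1.
  move=> n; have n0 : 0 < (n.+1%:R^-1 : R) by rewrite invr_gt0.
  have [_ [a Aa <-] h] := inf_adherent n0 D0.
  by exists a.
have As n : A (s n) by have [] := hs n.
have [|y ly] := @cauchy_sqnorm_cvg _ V s.
  move=> e e0; have e4 : 0 < e / 4 by rewrite divr_gt0.
  have [N hN] := invSn_lt e4.
  exists N => m n Nm Nn.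
  have [_ h1] := hs m; have [_ h2] := hs n; have e1 := hN _ Nm; have e2 := hN _ Nn.
  (* The midpoint of [s m] and [s n] lies in [A], hence at square distance at least [d] from [x].
     The parallelogram law then bounds the square norm of [s m - s n] by twice the sum of the two
     excesses over [d], whence [e / 4]. *)
  have := parallelogram (x - s n) (x - s m).
  have -> : (x - s n) - (x - s m) = s m - s n by rewrite opprB addrC subrKA.
  have -> : x - s n + (x - s m) = (2%:R : R)%:C *: (x - (2%:R^-1 : R)%:C *: (s n + s m)).
    rewrite scalerBr scalerA -rmorphM mulfV// rmorph1 scale1r addrACA -opprD.
    by rewrite (rmorphMn _ 2) rmorph1 scaler_nat mulr2n.
  rewrite nsq_sqnormZ /nsq /= expr0n /= addr0.
  have := dle _ (AZ (2%:R^-1 : R)%:C _ (AB _ _ (As n) (As m))).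
  move: (m.+1%:R^-1) (n.+1%:R^-1) h1 h2 e1 e2 => a b h1 h2 e1 e2.
  move: (sqnorm (_ - _ *: _)) => q; lra.
have Ay : A y.
  rewrite -cA; apply/closure_sqnormP => e e0; have /cvg_sqnormP/(_ e e0)[N hN] := ly.
  by exists (s N) => //; exact: hN.
exists y => // z Az; apply: nsq_eq0; apply/eqP; rewrite eq_le nsq_ge0 andbT.
pose S := sqnorm z; have S0 : 0 <= S := sqnorm_ge0 z.
apply: (@sqnorm_le_eps _ (2 * (S + 1) + 2 * S)); first by nra.
move=> e e0; have [N1 h1] := invSn_lt e0; have /cvg_sqnormP/(_ e e0)[N2 h2] := ly.
(* Orthogonality is obtained from the near-minimality of [s n]: moving [s n] by [t * k] times [z]
   cannot bring the square distance below [d], which forces [t * nsq k] below 1/(n+1). Dividing by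
   [S + 1] instead of [S] covers [z = 0]. *)
pose n := maxn N1 N2; have {}h1 := h1 n (leq_maxl _ _); have {}h2 := h2 n (leq_maxr _ _).
pose k := hdot (x - s n) z; pose t := (S + 1)^-1.
have S1 : (S + 1) * t = 1 by rewrite /t mulfV// gt_eqF// ltr_wpDl.
have t0 : 0 < t by rewrite invr_gt0 ltr_wpDl.
have kle : nsq k * t < e.
  have := dle _ (AB _ _ (AZ (t%:C * k) _ Az) (As n)).
  rewrite (addrC (_ *: z)) opprD addrA sqnormB nsq_sqnormZ dotZr -/k -/S.
  have -> : complex.Re ((t%:C * k)^* * k) = t * nsq k.
    by rewrite conjM conjc_real -mulrA (mulrC _ k) -nsqE cReZ.
  have -> : nsq (t%:C * k) = t ^+ 2 * nsq k by rewrite /nsq cReZ cImZ; ring.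
  have [_ ] := hs n; rewrite -/n => h3 h4.
  have := nsq_ge0 k => k0.
  have : t ^+ 2 * nsq k * S <= t * nsq k.
    have tS : t * S <= 1 by nra.
    have := mulr_ge0 (ltW t0) k0; nra.
  move: (n.+1%:R^-1) (t ^+ 2 * nsq k * S) h1 h3 h4 => a b h1 h3 h4 h5.
  rewrite mulrC; move: (t * nsq k) h4 h5 => c h4 h5; lra.
have kle' : nsq k <= (S + 1) * e.
  have -> : nsq k = (S + 1) * (nsq k * t) by rewrite mulrCA S1 mulr1.
  by rewrite ler_wpM2l// ?ltW//; lra.
rewrite add0r.
have -> : hdot (x - y) z = k - hdot (y - s n) z.
  by rewrite /k -dotBl opprB addrA subrK.
have CS := CauchySchwarz_sqnorm (y - s n) z; rewrite -/S in CS.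
have : nsq (k - hdot (y - s n) z) <= 2 * (nsq k + nsq (hdot (y - s n) z)).
  exact: nsqB_le.
nra.
Qed.

Lemma orth_projP V (A : set V) : subspace A -> closure A = A ->
  forall x, A (orth_proj A x) /\ forall z, A z -> hdot (x - orth_proj A x) z = 0.
Proof.
move=> sA cA x.
have [y Ay hy] := projection_exists sA cA x.
by apply: (@getPex _ [set y | A y /\ forall z, A z -> hdot (x - y) z = 0]); exists y.
Qed.

Lemma orth_proj_uniq V (A : set V) : subspace A ->
  forall x y, A y -> (forall z, A z -> hdot (x - y) z = 0) -> orth_proj A x = y.
Proof.
move=> [A0 sA] x y Ay hy.
have [] : [set y | A y /\ forall z, A z -> hdot (x - y) z = 0] (orth_proj A x).
  by apply: getPex; exists y.
set p := orth_proj A x => Ap hp.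
apply/eqP; rewrite -subr_eq0; apply/eqP/sqnorm_eq0; rewrite /sqnorm.
have Apy : A (p - y) by rewrite addrC -scaleN1r; exact: sA.
have -> : hdot (p - y) (p - y) = hdot (x - y) (p - y) - hdot (x - p) (p - y).
  by rewrite -dotBl; congr (hdot _ _); rewrite opprB [RHS]addrC subrKA.
by rewrite hy// hp// subrr.
Qed.

Lemma Riesz V (phi : V -> R[i]) (C : R) :
  (forall a x y, phi (a *: x + y) = a * phi x + phi y) ->
  0 <= C -> (forall x, nsq (phi x) <= C * sqnorm x) ->
  exists z, forall x, phi x = hdot x z.
Proof.
move=> lphi C0 hC.
have phi0 : phi 0 = 0 by have := lphi (-1) 0 0; rewrite scaler0 addr0 mulN1r addNr.
have phiB x y : phi (x - y) = phi x - phi y.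
  by rewrite addrC -scaleN1r lphi mulN1r addrC.
pose A := [set x | phi x = 0].
have sA : subspace A.
  by split=> // a x y; rewrite /A /= lphi => -> ->; rewrite mulr0 addr0.
have cA : closure A = A.
  apply/seteqP; split; last exact: subset_closure.
  move=> x /closure_sqnormP h; apply: nsq_eq0; apply/eqP; rewrite eq_le nsq_ge0 andbT.
  apply: (@sqnorm_le_eps _ C) => // e e0; have [a Aa /ltW ae] := h e e0.
  have := hC (x - a); rewrite phiB Aa subr0 add0r => /le_trans; apply.
  by rewrite ler_wpM2l.
have [hz|/existsNP[x0 phix0]] := pselect (forall x, phi x = 0).
  by exists 0 => x; rewrite hz dot0r.
have [y Ay hy] := projection_exists sA cA x0.
pose w := x0 - y; have phiw : phi w = phi x0 by rewrite /w phiB Ay subr0.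
have w0 : hdot w w != 0.
  apply/eqP => h; apply: phix0; rewrite -phiw.
  by rewrite (_ : w = 0)//; apply: sqnorm_eq0; rewrite /sqnorm h.
exists ((phi w / hdot w w)^* *: w) => x; rewrite dotZr conjcK.
have Ax : A ((- (phi x / phi w)) *: w + x).
  by rewrite /A /= lphi mulNr divfK ?phiw; [rewrite addNr|exact/eqP].
have := hy _ Ax; rewrite -/w dotC dotDl dotZl.
move=> /(congr1 conjc); rewrite conjcK conjc0 mulNr => /eqP; rewrite addrC subr_eq0 => /eqP ->.
by have pw : phi w != 0 by [rewrite phiw; apply/eqP]; field; rewrite w0 pw.
Qed.

Lemma adjoint_exists U V (T : U -> V) : bop T ->
  exists2 T' : V -> U, bop T' & forall x y, hdot (T x) y = hdot x (T' y).
Proof.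
move=> [lT [C C0 hC]].
have /choice[T' hT'] : forall y, exists z, forall x, hdot (T x) y = hdot x z.
  move=> y; apply: (@Riesz _ _ (C * sqnorm y)).
  - by move=> a x x'; rewrite lT dotDl dotZl.
  - by rewrite mulr_ge0// sqnorm_ge0.
  move=> x; apply: le_trans (CauchySchwarz_sqnorm _ _) _.
  by rewrite mulrAC ler_wpM2r// sqnorm_ge0.
exists T' => //; split.
  move=> a x y; apply/eqP; rewrite -subr_eq0; apply/eqP/dot_eqP => z.
  rewrite dotBl dotDl dotZl (dotC _ z) (dotC (T' x) z) (dotC (T' y) z) -!hT'.
  by rewrite dotDr dotZr conjD conjM conjcK subrr.
exists C => // y.
(* Since <T T'y, y> = |T'y|^2, this gives |T'y|^4 <= |T T'y|^2 |y|^2 <= C |T'y|^2 |y|^2, and a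
   factor |T'y|^2 cancels. *)
have := CauchySchwarz_sqnorm (T (T' y)) y; rewrite hT' sqnormE {1}/nsq /= expr0n /= addr0.
have := hC (T' y); have := sqnorm_ge0 y; have := sqnorm_ge0 (T' y).
set a := sqnorm (T' y); set b := sqnorm y; set c := sqnorm (T _) => a0 b0 hc h.
have [->|an0] := eqVneq a 0; first by rewrite mulr_ge0.
have agt0 : 0 < a by rewrite lt_def an0.
rewrite -(ler_pM2l agt0); nra.
Qed.

Lemma adjointP U (T : U -> U) : bop T ->
  forall x y, hdot (T x) y = hdot x (adjoint T y).
Proof.
move=> /adjoint_exists[T' _ hT'].
by apply: (@getPex _ [set T' : U -> U | forall x y, hdot (T x) y = hdot x (T' y)]); exists T'.
Qed.

Lemma adjoint_uniq U (T T' : U -> U) :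
  (forall x y, hdot (T x) y = hdot x (T' y)) -> adjoint T = T'.
Proof.
move=> h; have h' : forall x y, hdot (T x) y = hdot x (adjoint T y).
  by apply: (@getPex _ [set T' : U -> U | forall x y, hdot (T x) y = hdot x (T' y)]); exists T'.
apply/funext => y; apply/eqP; rewrite -subr_eq0; apply/eqP/dot_eqP => z.
by rewrite dotC dotBr -h -h' subrr conjc0.
Qed.

Lemma bop_adjoint U (T : U -> U) : bop T -> bop (adjoint T).
Proof. by move=> /adjoint_exists[T' bT' /adjoint_uniq ->]. Qed.

Lemma adjointPr U (T : U -> U) : bop T ->
  forall x y, hdot x (T y) = hdot (adjoint T x) y.
Proof. by move=> bT x y; rewrite dotC adjointP// -dotC. Qed.

Lemma total_eqP I V (f : I -> V) (x y : V) : closure (Defs.span (range f)) = setT ->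
  (forall i, hdot x (f i) = hdot y (f i)) -> x = y.
Proof.
move=> df h; apply/eqP; rewrite -subr_eq0.
have {h} : forall i, hdot (x - y) (f i) = 0 by move=> i; rewrite dotBl h subrr.
move: (x - y) => z zf; apply/eqP/sqnorm_eq0/eqP.
rewrite eq_le sqnorm_ge0 andbT; apply: (@sqnorm_le_eps _ 1) => // e e0.
have [s hs] := total_comb df z e0.
rewrite add0r mul1r; apply: le_trans (ltW hs).
rewrite sqnormB.
have -> : hdot z (comb f s) = 0.
  by rewrite /comb dot_sumr big1// => p _; rewrite dotZr zf mulr0.
by rewrite mulr0 subr0 lerDl sqnorm_ge0.
Qed.

(** [extension] loses a factor 4 in its bound, so isometry is recovered afterwards: that the adjoint
    of T composed with T is the identity can be checked on the total family. *)
Lemma isometry_total I U V (f : I -> U) (T : U -> V) : bop T ->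
  closure (Defs.span (range f)) = setT ->
  (forall i j, hdot (T (f i)) (T (f j)) = hdot (f i) (f j)) ->
  forall x y, hdot (T x) (T y) = hdot x y.
Proof.
move=> bT df hT x y; have [T' bT' h] := adjoint_exists bT.
have TT : T' \o T = idfun.
  apply: (bop_eq_total (bop_comp bT' bT) (bop_id U) df) => _ [i _ <-] /=.
  by apply: (total_eqP df) => j; rewrite dotC -h -dotC hT.
by rewrite h -[T' (T y)]/((T' \o T) y) TT.
Qed.

End Constructions.

(** * Tensor products of bounded operators *)

Section TensorOperators.
Context {R : realType}.
Variables (U V : hilbertType R) (W : tensor_product U V).

Lemma tp_total : closure (Defs.span (range (fun z : U * V => tp W z.1 z.2))) = setT.
Proof. exact: tp_dense. Qed.

Lemma tpPl a x x' y : tp W (a *: x + x') y = a *: tp W x y + tp W x' y.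
Proof.
apply: (total_eqP tp_total) => -[u v] /=.
by rewrite dotDl dotZl !tp_dot dotDl dotZl mulrDl mulrA.
Qed.

Lemma tpPr a x y y' : tp W x (a *: y + y') = a *: tp W x y + tp W x y'.
Proof.
apply: (total_eqP tp_total) => -[u v] /=.
by rewrite dotDl dotZl !tp_dot dotDl dotZl mulrDr mulrCA.
Qed.

Lemma tp_linl y : linear (tp W ^~ y). Proof. by move=> a x x'; exact: tpPl. Qed.
Lemma tp_linr x : linear (tp W x). Proof. by move=> a y y'; exact: tpPr. Qed.

Lemma sqnorm_tp x y : sqnorm (tp W x y) = sqnorm x * sqnorm y.
Proof. by rewrite {1}/sqnorm tp_dot !sqnormE -rmorphM. Qed.

Lemma sqnorm_orth_sum (Z : hilbertType R) n (v : nat -> Z) :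
  (forall i j, (i < n)%N -> (j < n)%N -> i != j -> hdot (v i) (v j) = 0) ->
  sqnorm (\sum_(i < n) v i) = \sum_(i < n) sqnorm (v i).
Proof.
elim: n => [|n ih] h; first by rewrite !big_ord0 sqnorm0.
rewrite !big_ord_recr /= sqnormD ih; last first.
  by move=> i j ni nj; apply: h; exact: ltnW.
have -> : hdot (\sum_(i < n) v i) (v n) = 0.
  by rewrite dot_suml big1// => i _; apply: h => //; [rewrite ltnS ltnW|rewrite ltn_eqF].
by rewrite mulr0 addr0.
Qed.

(* Gram-Schmidt on the second factors. *)
Lemma orthogonalize (s : seq (U * V)) :
  exists n (x : nat -> U) (e : nat -> V),
    (forall i j, (i < n)%N -> (j < n)%N -> i != j -> hdot (e i) (e j) = 0) /\
    forall T : U -> U, linear T ->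
      \sum_(p <- s) tp W (T p.1) p.2 = \sum_(i < n) tp W (T (x i)) (e i).
Proof.
elim: s => [|[x0 y0] s [n [x [e [oe h]]]]].
  by exists 0%N, (fun=> 0), (fun=> 0); split=> // T lT; rewrite big_nil big_ord0.
pose al i := hdot y0 (e i) / hdot (e i) (e i).
pose y1 := y0 - \sum_(i < n) al i *: e i.
have y1e i : (i < n)%N -> hdot y1 (e i) = 0.
  move=> ni; rewrite dotBl dot_suml (bigD1 (Ordinal ni))//= big1 ?addr0.
    rewrite dotZl /al; have [e0|e0] := eqVneq (hdot (e i) (e i)) 0.
      have -> : e i = 0 by apply: sqnorm_eq0; rewrite /sqnorm e0.
      by rewrite !dot0r mulr0 subrr.
    by rewrite divfK// subrr.
  move=> j ji; rewrite dotZl oe ?mulr0//.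
exists n.+1, (fun i => if i == n then x0 else x i + al i *: x0),
  (fun i => if i == n then y1 else e i); split.
  move=> i j; rewrite !ltnS (leq_eqVlt i) (leq_eqVlt j).
  case: eqVneq => [->|ni] /= hi; case: eqVneq => [->|nj] /= hj //; rewrite ?eqxx//.
  - by move=> _; exact: y1e.
  - by move=> _; rewrite dotC y1e ?conjc0.
  - exact: oe.
move=> T lT; rewrite big_cons h//= big_ord_recr /= eqxx.
have -> : tp W (T x0) y0 =
    tp W (T x0) y1 + \sum_(i < n) tp W (al i *: T x0) (e i).
  rewrite -[in LHS](subrK (\sum_(i < n) al i *: e i) y0) -/y1.
  rewrite (linD (tp_linr _)) (lin_sum (tp_linr _)); congr (_ + _).
  apply: eq_bigr => i _.
  by rewrite (linZ (tp_linr _)) (linZ (tp_linl _)).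
rewrite -addrA [RHS]addrC; congr (_ + _).
rewrite -big_split /=; apply: eq_bigr => i _.
by rewrite ltn_eqF// (linD lT) (linZ lT) (linD (tp_linl _)) addrC.
Qed.

(** With orthogonal second factors e_i, the square norm of the sum of the T x_i (x) e_i is the sum
    of the |T x_i|^2 |e_i|^2, which is bounded termwise. The rewriting of [orthogonalize] holds for
    all linear maps at once, so it serves both [T] and the identity. *)
Lemma tensor_left_exists (T : U -> U) : bop T ->
  exists2 Q : W -> W, bop Q & forall x y, Q (tp W x y) = tp W (T x) y.
Proof.
move=> [lT [C C0 hC]].
have [|Q bQ hQ] := @extension _ _ W W (fun z : U * V => tp W z.1 z.2)
    (fun z => tp W (T z.1) z.2) C C0 tp_total; last first.
  by exists Q => // x y; exact: (hQ (x, y)).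
move=> s; pose s' := [seq (p.1 *: p.2.1, p.2.2) | p <- s].
have combE (S : U -> U) : linear S ->
    comb (fun z => tp W (S z.1) z.2) s = \sum_(p <- s') tp W (S p.1) p.2.
  move=> lS; rewrite /comb big_map; apply: eq_bigr => p _ /=.
  by rewrite (linZ lS) (linZ (tp_linl _)).
have [n [x [e [oe h]]]] := orthogonalize s'.
rewrite (combE T)// (combE idfun)// !h//.
rewrite (@sqnorm_orth_sum _ _ (fun i => tp W (T (x i)) (e i))); last first.
  by move=> i j ni nj ij; rewrite tp_dot oe// mulr0.
rewrite (@sqnorm_orth_sum _ _ (fun i => tp W (x i) (e i))); last first.
  by move=> i j ni nj ij; rewrite tp_dot oe// mulr0.
rewrite mulr_sumr; apply: ler_sum => i _.
by rewrite !sqnorm_tp mulrA ler_wpM2r// sqnorm_ge0.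
Qed.

End TensorOperators.

Section TensorOperatorsBilateral.
Context {R : realType}.
Variables (U V : hilbertType R) (W : tensor_product U V).

Lemma tensor_swap_dot (y : V) (x : U) (y' : V) (x' : U) :
  hdot (tp W x y) (tp W x' y') = hdot y y' * hdot x x'.
Proof. by rewrite tp_dot mulrC. Qed.

Lemma tensor_swap_dense :
  closure (Defs.span [set tp W z.2 z.1 | z in [set: V * U]]) = setT.
Proof.
rewrite -(tp_total W); congr (closure (Defs.span _)).
by apply/seteqP; split=> _ [[a b] _ <-]; exists (b, a).
Qed.

(** The same space with its factors exchanged, so that the construction of T (x) 1 also yields 1 (x)
    T'; their composite is T (x) T'. *)
Definition tensor_swap : tensor_product V U :=
  @TensorProduct _ _ _ W (fun y x => tp W x y) tensor_swap_dot tensor_swap_dense.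

Lemma tensor_opP (T : U -> U) (T' : V -> V) : bop T -> bop T' ->
  bop (@tensor_op _ _ _ W T T') /\
  forall x y, @tensor_op _ _ _ W T T' (tp W x y) = tp W (T x) (T' y).
Proof.
move=> bT bT'; have [Q bQ hQ] := tensor_left_exists W bT.
have [Q' bQ' hQ'] := tensor_left_exists tensor_swap bT'.
suff : [set Q : W -> W | bounded_op Q /\ forall x y, Q (tp W x y) = tp W (T x) (T' y)]
  (@tensor_op _ _ _ W T T') by move=> [/bopP].
apply: getPex; exists (Q \o Q'); split; first by apply/bopP/bop_comp.
move=> x y /=; have /= -> := hQ' y x; exact: hQ.
Qed.

End TensorOperatorsBilateral.

(** * Commutants and generated von Neumann algebras *)

Section VonNeumann.
Context {R : realType}.
Variable V : hilbertType R.
Implicit Types (M N : set (V -> V)) (X Y T : V -> V).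

Definition bounded_set M := forall X, M X -> bop X.
Definition star_closed M := forall X, M X -> M (adjoint X).

Lemma commutant_bop M X : commutant M X -> bop X.
Proof. by move=> [/bopP]. Qed.

Lemma commutantP M X T x : commutant M T -> M X -> T (X x) = X (T x).
Proof. by move=> [_ h] /h /(congr1 (@^~ x)). Qed.

Lemma commutantI M T : bop T -> (forall X x, M X -> T (X x) = X (T x)) -> commutant M T.
Proof.
move=> bT h; split; first exact/bopP.
by move=> X MX; apply/funext => x /=; exact: h.
Qed.

Lemma commutantS M N : M `<=` N -> commutant N `<=` commutant M.
Proof. by move=> MN T [bT hT]; split=> // X /MN; exact: hT. Qed.

Lemma sub_bicommutant M : bounded_set M -> M `<=` commutant (commutant M).
Proof.
move=> bM X MX; apply: commutantI; first exact: bM.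
by move=> T x hT; rewrite (commutantP _ hT MX).
Qed.

Lemma commutant_star M : bounded_set M -> star_closed M -> star_closed (commutant M).
Proof.
move=> bM sM T hT; have bT := commutant_bop hT.
apply: commutantI => [|X x MX]; first exact: bop_adjoint.
have bX := bM _ MX.
apply/eqP; rewrite -subr_eq0; apply/eqP/dot_eqP => y; rewrite dotBl.
have -> : hdot (adjoint T (X x)) y = hdot x (adjoint X (T y)).
  by rewrite -adjointPr// adjointP.
have -> : hdot (X (adjoint T x)) y = hdot x (T (adjoint X y)).
  by rewrite adjointP// -adjointPr.
by rewrite (commutantP _ hT (sM _ MX)) subrr.
Qed.

Lemma bicommutant_vN M : bounded_set M -> star_closed M ->
  von_neumann_algebra (commutant (commutant M)).
Proof.
move=> bM sM; split.
  by apply: commutant_star; [move=> X /commutant_bop|exact: commutant_star].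
apply/seteqP; split; last by apply: sub_bicommutant => X /commutant_bop.
by apply: commutantS; apply: sub_bicommutant => X /commutant_bop.
Qed.

Lemma vN_generated_bicommutant M : bounded_set M -> star_closed M ->
  vN_generated M `<=` commutant (commutant M).
Proof.
by move=> bM sM X; apply; split; [exact: bicommutant_vN|exact: sub_bicommutant].
Qed.

Lemma vN_generated_sub M : M `<=` vN_generated M.
Proof. by move=> X MX N [_]; apply. Qed.

Lemma vN_generated_least M N : von_neumann_algebra N -> M `<=` N ->
  vN_generated M `<=` N.
Proof. by move=> vN MN X; apply. Qed.

(** For each von Neumann algebra N containing M, the generated set G lies in N, hence its
    bicommutant lies in that of N, which is N. Intersecting over N bounds the bicommutant of G by
    G. *)
Lemma vN_generated_vN M : bounded_set M -> star_closed M ->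
  von_neumann_algebra (vN_generated M).
Proof.
move=> bM sM; split.
  by move=> X hX N [vN MN]; apply: (proj1 vN); exact: hX.
have bG : bounded_set (vN_generated M).
  by move=> X /(vN_generated_bicommutant bM sM)/commutant_bop.
apply/seteqP; split; last exact: sub_bicommutant.
move=> X hX N [vN MN]; have := vN; move=> [sN cN]; rewrite -cN.
by move: X hX; do 2!apply: commutantS; exact: vN_generated_least.
Qed.

Section Closure.
Variable N : set (V -> V).
Hypothesis vN : von_neumann_algebra N.

Lemma vN_bop X : N X -> bop X.
Proof. by rewrite -(proj2 vN) => /commutant_bop. Qed.

Lemma vN_memP X : bop X ->
  (forall T x, commutant N T -> X (T x) = T (X x)) -> N X.
Proof. by move=> bX h; rewrite -(proj2 vN); exact: commutantI. Qed.

Lemma vN_id : N idfun.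
Proof. by apply: vN_memP => //; exact: bop_id. Qed.

Lemma vN_comp X Y : N X -> N Y -> N (X \o Y).
Proof.
move=> NX NY; apply: vN_memP; first by apply: bop_comp; exact: vN_bop.
by move=> T x hT /=; rewrite (commutantP _ hT NX) (commutantP _ hT NY).
Qed.

Lemma vN_lin a X Y : N X -> N Y -> N (fun x => a *: X x + Y x).
Proof.
move=> NX NY; apply: vN_memP; first by apply: bop_lin; exact: vN_bop.
move=> T x hT /=; have [lT _] := commutant_bop hT.
by rewrite lT (commutantP _ hT NX) (commutantP _ hT NY).
Qed.

Lemma vN_lim (X : nat -> V -> V) Y : (forall n, N (X n)) -> bop Y ->
  (forall x, X n x @[n --> \oo] --> Y x) -> N Y.
Proof.
move=> NX bY XY; apply: vN_memP => // T x hT.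
have := bop_cvg (commutant_bop hT) (XY x).
rewrite (_ : (fun n => T (X n x)) = (fun n => X n (T x))).
  by move=> h; exact: (cvg_unique _ (XY (T x)) h).
by apply/funext => n; rewrite (commutantP _ hT (NX n)).
Qed.

End Closure.
End VonNeumann.

(** * Square integrable functions *)

Section SquareIntegrable.
Context {R : realType}.
Implicit Types (a b h : R -> R) (f g : R -> R[i]).

Notation mu := (@lebesgue_measure R).
Notation D := (@half_line R).
Notation integ a := (mu.-integrable D (EFin \o a)).

(* [lebesgue_measure] lives on [measurableTypeR R], whose display differs from the default
   one of [R]; the measurable sets are convertible, but this is not found by unification. *)
Lemma measurable_half_line : @measurable _ (measurableTypeR R) D.
Proof. exact: measurable_itv. Qed.
Local Notation mD := measurable_half_line.

Definition RL2 a := measurable_fun D a /\ integ (fun t => a t ^+ 2).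

Lemma RL2_mul a b : RL2 a -> RL2 b -> integ (fun t => a t * b t).
Proof.
move=> [ma ia] [mb ib].
apply: (@le_integrable _ _ R mu _ mD _ (EFin \o (fun t => a t ^+ 2 + b t ^+ 2))).
- by apply/measurable_EFinP; exact: measurable_funM.
- move=> t _ /=; rewrite lee_fin (ger0_norm (addr_ge0 (sqr_ge0 _) (sqr_ge0 _))) ler_norml.
  have := sqr_ge0 (a t - b t); have := sqr_ge0 (a t + b t).
  have := sqr_ge0 (a t); have := sqr_ge0 (b t).
  rewrite sqrrD sqrrB => *; apply/andP; split; nra.
by have := integrableD mD ia ib; congr (is_true (integrable _ _ _)); apply/funext => t.
Qed.

Lemma RL2_lin (c : R) a b : RL2 a -> RL2 b -> RL2 (fun t => c * a t + b t).
Proof.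
move=> ra rb; have [ma ia] := ra; have [mb ib] := rb; split.
  by apply: measurable_funD => //; exact: measurable_funM.
have := integrableD mD (integrableD mD (integrableZl mD (c ^+ 2) ia) ib)
  (integrableZl mD (2 * c) (RL2_mul ra rb)).
congr (is_true (integrable _ _ _)); apply/funext => t /=.
rewrite -!EFinM -!EFinD; congr (_%:E); ring.
Qed.

Lemma RL20 : RL2 (fun=> 0).
Proof.
split; first exact: measurable_cst.
rewrite (_ : _ \o _ = cst 0%E); first exact: integrable0.
by apply/funext => t /=; rewrite expr0n.
Qed.

Lemma RL2Z c a : RL2 a -> RL2 (fun t => c * a t).
Proof.
by move=> ra; have := RL2_lin c ra RL20; congr RL2; apply/funext => t; rewrite addr0.
Qed.

Lemma RL2_dom a b : measurable_fun D a -> RL2 b ->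
  (forall t, D t -> a t ^+ 2 <= b t ^+ 2) -> RL2 a.
Proof.
move=> ma [mb ib] ab; split=> //.
apply: (@le_integrable _ _ R mu _ mD _ _ _ _ ib).
  by apply/measurable_EFinP; exact: measurable_funX.
by move=> t Dt /=; rewrite lee_fin !ger0_norm ?sqr_ge0//; exact: ab.
Qed.

Lemma RL2_indic B : measurable B -> B `<=` D -> (mu B < +oo)%E -> RL2 \1_B.
Proof.
move=> mB BD Bfin; split; first exact: measurable_indic.
rewrite (_ : _ \o _ = EFin \o \1_B); last first.
  apply/funext => t /=; congr (_%:E); rewrite indicE.
  by case: (t \in B); rewrite ?expr1n ?expr0n.
apply/integrableP; split; first by apply/measurable_EFinP; exact: measurable_indic.
have intB := @integral_indic _ _ R mu D mD B mB.
apply: le_lt_trans Bfin; rewrite -[X in mu X](setIidl BD) -intB.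
rewrite le_eqVlt; apply/orP; left; apply/eqP.
by apply: eq_integral => t _ /=; rewrite ger0_norm.
Qed.

Lemma L2CP f : L2C f <-> RL2 (fun t => complex.Re (f t)) /\ RL2 (fun t => complex.Im (f t)).
Proof.
split=> [[mr mi fin]|[[mr ir] [mi ii]]].
  have ifin : integ (fun t => complex.Re (f t) ^+ 2 + complex.Im (f t) ^+ 2).
    apply/integrableP; split.
      by apply/measurable_EFinP; apply: measurable_funD; exact: measurable_funX.
    apply: le_lt_trans fin; rewrite le_eqVlt; apply/orP; left; apply/eqP.
    by apply: eq_integral => t _ /=; rewrite ger0_norm// addr_ge0 ?sqr_ge0.
  split; split=> //; apply: (@le_integrable _ _ R mu _ mD _ _ _ _ ifin).
  - by apply/measurable_EFinP; exact: measurable_funX.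
  - move=> t _ /=; rewrite lee_fin !ger0_norm ?addr_ge0 ?sqr_ge0// lerDl sqr_ge0//.
  - by apply/measurable_EFinP; exact: measurable_funX.
  - move=> t _ /=; rewrite lee_fin !ger0_norm ?addr_ge0 ?sqr_ge0// lerDr sqr_ge0//.
split=> //; have /integrableP[_] := integrableD mD ir ii.
apply: le_lt_trans; rewrite le_eqVlt; apply/orP; left; apply/eqP.
by apply: eq_integral => t _ /=; rewrite ger0_norm// addr_ge0 ?sqr_ge0.
Qed.

Lemma L2C_cpxP h : L2C (cpx h) <-> RL2 h.
Proof.
split=> [/L2CP[]//|rh]; apply/L2CP; split=> //; exact: RL20.
Qed.

Lemma L2C_lin (c : R[i]) f g : L2C f -> L2C g -> L2C (fun t => c * f t + g t).
Proof.
move=> /L2CP[fr fi] /L2CP[gr gi]; apply/L2CP; split.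
  have := RL2_lin (complex.Re c) fr (RL2_lin (- complex.Im c) fi gr).
  by congr RL2; apply/funext => t; rewrite cReD cReM mulNr addrA.
have := RL2_lin (complex.Re c) fi (RL2_lin (complex.Im c) fr gi).
by congr RL2; apply/funext => t; rewrite cImD cImM addrA.
Qed.

Lemma RL2_cut A a : measurable A -> RL2 a -> RL2 (fun t => \1_A t * a t).
Proof.
move=> mA ra; apply: (RL2_dom _ ra) => [|t _].
  by apply: measurable_funM (proj1 ra); exact: measurable_indic.
rewrite exprMn ler_piMl ?sqr_ge0// indicE.
Qed.

Lemma cReMJ (x y : R[i]) :
  complex.Re (x * y^*) = complex.Re x * complex.Re y + complex.Im x * complex.Im y.
Proof. by rewrite cReM cReJ cImJ mulrN opprK. Qed.

Lemma cImMJ (x y : R[i]) :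
  complex.Im (x * y^*) = complex.Im x * complex.Re y - complex.Re x * complex.Im y.
Proof. by rewrite cImM cReJ cImJ mulrN addrC. Qed.

Lemma L2C_integ_Re f g : L2C f -> L2C g -> integ (fun t => complex.Re (f t * (g t)^*)).
Proof.
move=> /L2CP[fr fi] /L2CP[gr gi].
have := integrableD mD (RL2_mul fr gr) (RL2_mul fi gi).
by congr (is_true (integrable _ _ _)); apply/funext => t /=; rewrite cReMJ.
Qed.

Lemma L2C_integ_Im f g : L2C f -> L2C g -> integ (fun t => complex.Im (f t * (g t)^*)).
Proof.
move=> /L2CP[fr fi] /L2CP[gr gi].
have := integrableD mD (RL2_mul fi gr) (integrableZl mD (-1) (RL2_mul fr gi)).
congr (is_true (integrable _ _ _)); apply/funext => t /=.
by rewrite cImMJ -EFinM -EFinD mulN1r.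
Qed.

Definition cint f : R[i] :=
  (\int[mu]_(t in D) complex.Re (f t))%R +i* (\int[mu]_(t in D) complex.Im (f t))%R.

Definition cinteg f := integ (fun t => complex.Re (f t)) /\ integ (fun t => complex.Im (f t)).

Lemma L2C_dotE f g : L2C_dot f g = cint (fun t => f t * (g t)^*).
Proof. by []. Qed.

Lemma L2C_cinteg f g : L2C f -> L2C g -> cinteg (fun t => f t * (g t)^*).
Proof. by move=> *; split; [exact: L2C_integ_Re|exact: L2C_integ_Im]. Qed.

Lemma cinteg_lin (c : R[i]) f g : cinteg f -> cinteg g ->
  cinteg (fun t => c * f t + g t).
Proof.
move=> [fr fi] [gr gi]; split.
  have := integrableD mD (integrableZl mD (complex.Re c) fr)
    (integrableD mD (integrableZl mD (- complex.Im c) fi) gr).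
  congr (is_true (integrable _ _ _)); apply/funext => t /=.
  by rewrite cReD cReM -!EFinM -!EFinD mulNr addrA.
have := integrableD mD (integrableZl mD (complex.Re c) fi)
  (integrableD mD (integrableZl mD (complex.Im c) fr) gi).
congr (is_true (integrable _ _ _)); apply/funext => t /=.
by rewrite cImD cImM -!EFinM -!EFinD addrA.
Qed.

Lemma Rint_lin (c d : R) a b e : integ a -> integ b -> integ e ->
  (\int[mu]_(t in D) (c * a t + d * b t + e t))%R =
  c * (\int[mu]_(t in D) a t)%R + d * (\int[mu]_(t in D) b t)%R
  + (\int[mu]_(t in D) e t)%R.
Proof.
move=> ia ib ie.
have ica : integ (fun t => c * a t) := integrableZl mD c ia.
have icb : integ (fun t => d * b t) := integrableZl mD d ib.
have iab : integ (fun t => c * a t + d * b t) := integrableD mD ica icb.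
rewrite (RintegralD mD iab ie) (RintegralD mD ica icb).
by rewrite (RintegralZl c mD ia) (RintegralZl d mD ib).
Qed.

Lemma cint_lin (c : R[i]) f g : cinteg f -> cinteg g ->
  cint (fun t => c * f t + g t) = c * cint f + cint g.
Proof.
move=> [fr fi] [gr gi]; apply/eqP; rewrite eq_complex /cint cReD cImD cReM cImM /=.
apply/andP; split; apply/eqP.
  rewrite -mulNr -Rint_lin//; apply: eq_Rintegral => t _.
  by rewrite cReD cReM mulNr.
by rewrite -Rint_lin//; apply: eq_Rintegral => t _; rewrite cImD cImM.
Qed.

Lemma eq_cint f g : (forall t, D t -> f t = g t) -> cint f = cint g.
Proof.
by move=> fg; rewrite /cint; congr (_ +i* _); apply: eq_Rintegral => t; rewrite inE => /fg ->.
Qed.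

Lemma L2C_dot_linl c f f' g : L2C f -> L2C f' -> L2C g ->
  L2C_dot (fun t => c * f t + f' t) g = c * L2C_dot f g + L2C_dot f' g.
Proof.
move=> *; rewrite !L2C_dotE -cint_lin; try exact: L2C_cinteg.
by apply: eq_cint => t _; rewrite mulrDl mulrA.
Qed.

Definition L2C_sqnorm f : R := (\int[mu]_(t in D) nsq (f t))%R.

Lemma L2C_dot_self f : L2C_dot f f = (L2C_sqnorm f)%:C.
Proof.
rewrite L2C_dotE /cint /L2C_sqnorm; congr (_ +i* _).
  by apply: eq_Rintegral => t _; rewrite -nsqE.
transitivity (\int[mu]_(t in D) (0 : R))%R.
  by apply: eq_Rintegral => t _; rewrite -nsqE.
by rewrite (Rintegral_cst _ mD) mul0r.
Qed.

Lemma L2C_sqnorm_ge0 f : 0 <= L2C_sqnorm f.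
Proof. by apply: Rintegral_ge0 => t _; exact: nsq_ge0. Qed.

Lemma L2C_dot_real h (g : R -> R) : L2C (cpx h) -> L2C (cpx g) ->
  L2C_dot (cpx h) (cpx g) = L2C_dot (cpx g) (cpx h).
Proof.
move=> *; rewrite !L2C_dotE; apply: eq_cint => t _.
by rewrite !conjc_real mulrC.
Qed.

Lemma L2_dominated (h_ : nat -> R -> R) h b :
  (forall n, measurable_fun D (h_ n)) -> measurable_fun D h -> RL2 b ->
  (forall n t, D t -> `|h_ n t| <= b t) ->
  (forall t, D t -> h_ n t @[n --> \oo] --> h t) ->
  forall e : R, 0 < e -> exists N, forall n, (N <= n)%N ->
    L2C_sqnorm (cpx (fun t => h_ n t - h t)) < e.
Proof.
move=> mh_ mh [mb ib] hb hh e e0.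
have hb' t : D t -> `|h t| <= b t.
  move=> Dt; apply: (@closed_cvg _ _ _ eventually_filter (fun n => `|h_ n t|) (fun x => x <= b t)).
  - exact: closed_le.
  - by near=> n; exact: hb.
  - by apply: cvg_norm; exact: hh.
pose f_ n t := ((h_ n t - h t) ^+ 2)%:E.
have mf n : measurable_fun D (f_ n).
  by apply/measurable_EFinP; apply: measurable_funX; exact: measurable_funB.
(* The functions [h_ n] and their limit are all bounded by [b], so 4 b^2 dominates the squared
   differences. *)
have [] := @dominated_convergence _ _ _ mu D mD f_ (cst 0%E)
   (fun t => (4%:E * (b t ^+ 2)%:E)%E) mf (measurable_cst _) _ (integrableZl mD _ ib) _.
- apply/aeW => t Dt; rewrite /f_ /=; apply/fine_cvgP; split; first by near=> n.
  rewrite (_ : fine \o _ = (fun n => (h_ n t - h t) ^+ 2)) //.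
  rewrite -(mulr0 (0 : R)) -[in X in _ --> X](subrr (h t)).
  by apply: cvgM; apply: cvgB => //; [exact: hh|exact: cvg_cst|exact: hh|exact: cvg_cst].
- apply/aeW => t n Dt; rewrite /f_ /= lee_fin ger0_norm ?sqr_ge0//.
  have := hb n _ Dt; have := hb' _ Dt; rewrite !ler_norml => /andP[? ?] /andP[? ?].
  nra.
move=> _ _; rewrite integral0 => /fine_cvgP[_ /cvgrPdist_lt/(_ e e0)[N _ hN]].
exists N => n Nn; have := hN n Nn; rewrite /= sub0r normrN.
apply: le_lt_trans; rewrite (_ : L2C_sqnorm _ = fine (\int[mu]_(x in D) f_ n x)%E).
  exact: ler_norm.
by congr fine; apply: eq_integral => t _; rewrite /nsq /= expr0n /= addr0.
Unshelve. all: by end_near. Qed.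

End SquareIntegrable.

(** * The full Fock space *)

(** Keeps the constant, unlike [bop_adjoint]: the annihilation operators must be bounded by the L^2
    norm of h for S(h) to depend continuously on h. *)
Lemma adjoint_bound (R : realType) (U : hilbertType R) (T : U -> U) (C : R) :
  bop T -> 0 <= C -> (forall x, sqnorm (T x) <= C * sqnorm x) ->
  forall x, sqnorm (adjoint T x) <= C * sqnorm x.
Proof.
move=> bT C0 hC y.
have := CauchySchwarz_sqnorm (T (adjoint T y)) y.
rewrite adjointP// sqnormE {1}/nsq /= expr0n /= addr0.
have := hC (adjoint T y); have := sqnorm_ge0 y; have := sqnorm_ge0 (adjoint T y).
set a := sqnorm (adjoint T y); set b := sqnorm y; set c := sqnorm (T _) => a0 b0 hc h.
have [->|an0] := eqVneq a 0; first by rewrite mulr_ge0.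
have agt0 : 0 < a by rewrite lt_def an0.
rewrite -(ler_pM2l agt0); nra.
Qed.

Section Fock.
Context {R : realType}.
Variable H : fock_space R.
Implicit Types (f g : R -> R[i]) (h : R -> R) (gs hs : seq (R -> R[i])).

Notation tens := (fock_tens H).

Lemma L2C_seq_cons g gs : L2C_seq (g :: gs) <-> L2C g /\ L2C_seq gs.
Proof.
split=> [h|[hg hgs] x].
  by split; [apply: h; rewrite mem_head|move=> x xs; apply: h; rewrite inE xs orbT].
by rewrite inE => /orP[/eqP -> //|/hgs].
Qed.

Lemma L2C_seq_cat gs hs : L2C_seq (gs ++ hs) <-> L2C_seq gs /\ L2C_seq hs.
Proof.
split=> [h|[h1 h2] x].
  by split=> x xs; apply: h; rewrite mem_cat xs ?orbT.
by rewrite mem_cat => /orP[/h1|/h2].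
Qed.

Lemma L2C_seq_nil : L2C_seq ([::] : seq (R -> R[i])).
Proof. by []. Qed.

Lemma L2C_seq_rev gs : L2C_seq gs -> L2C_seq (rev gs).
Proof. by move=> h x; rewrite mem_rev; exact: h. Qed.

Lemma L2C_seq_rcons g gs : L2C g -> L2C_seq gs -> L2C_seq (rcons gs g).
Proof. by move=> hg hgs; rewrite -cats1; apply/L2C_seq_cat; split=> //; apply/L2C_seq_cons. Qed.

(** Packing integrability with the word turns the elementary tensors into a family indexed by a
    type, the form in which [extension] and [total_eqP] take it. *)
Definition word := {gs : seq (R -> R[i]) | L2C_seq gs}.
Definition wtens (w : word) : H := tens (sval w).

Lemma wtens_total : closure (Defs.span (range wtens)) = setT.
Proof.
rewrite -(fock_dense H); congr (closure (Defs.span _)); apply/seteqP; split.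
  by move=> _ [[gs hgs] _ <-]; exists gs.
by move=> _ [gs hgs <-]; exists (exist _ gs hgs).
Qed.

Lemma tens_eqP (x y : H) :
  (forall gs, L2C_seq gs -> hdot x (tens gs) = hdot y (tens gs)) -> x = y.
Proof. by move=> h; apply: (total_eqP wtens_total) => -[gs hgs]; exact: h. Qed.

Lemma bop_eq_tens (V : hilbertType R) (S T : H -> V) : bop S -> bop T ->
  (forall gs, L2C_seq gs -> S (tens gs) = T (tens gs)) -> S = T.
Proof.
move=> bS bT ST; apply: (bop_eq_total bS bT wtens_total) => _ [[gs hgs] _ <-].
exact: ST.
Qed.

Lemma fock_gram_cons f g gs hs :
  fock_gram (f :: gs) (g :: hs) = L2C_dot f g * fock_gram gs hs.
Proof.
rewrite /fock_gram /= eqSS; case: eqP => _; last by rewrite mulr0.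
by rewrite big_cons.
Qed.

Lemma tens_dot_cons f g gs hs : L2C f -> L2C g -> L2C_seq gs -> L2C_seq hs ->
  hdot (tens (f :: gs)) (tens (g :: hs)) = L2C_dot f g * hdot (tens gs) (tens hs).
Proof.
by move=> hf hg hgs hhs; rewrite !fock_dot ?fock_gram_cons//; apply/L2C_seq_cons.
Qed.

(** Tensors are given by their inner products only, so linearity in a letter is read off the Gram
    formula by testing against all words. *)
Lemma tens_lin_head c f g gs : L2C f -> L2C g -> L2C_seq gs ->
  tens ((fun t => c * f t + g t) :: gs) = c *: tens (f :: gs) + tens (g :: gs).
Proof.
move=> hf hg hgs; have hfg := L2C_lin c hf hg.
apply: tens_eqP => -[|k hs] hhs.
  by rewrite dotDl dotZl !fock_dot ?/fock_gram ?mulr0 ?addr0//; apply/L2C_seq_cons.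
have /L2C_seq_cons[hk hhs'] := hhs.
by rewrite dotDl dotZl !tens_dot_cons// L2C_dot_linl// mulrDl mulrA.
Qed.

Lemma comb_dot I (u v : I -> H) (a : R[i]) s :
  (forall i j, hdot (u i) (u j) = a * hdot (v i) (v j)) ->
  hdot (comb u s) (comb u s) = a * hdot (comb v s) (comb v s).
Proof.
move=> uv; rewrite !dot_suml mulr_sumr; apply: eq_bigr => p _.
rewrite !dot_sumr mulr_sumr; apply: eq_bigr => q _.
by rewrite !dotZl !dotZr uv !mulrA; congr (_ * _); rewrite mulrC !mulrA.
Qed.

Lemma comb_sqnorm I (u v : I -> H) (a : R) s :
  (forall i j, hdot (u i) (u j) = a%:C * hdot (v i) (v j)) ->
  sqnorm (comb u s) = a * sqnorm (comb v s).
Proof. by move=> h; rewrite {1}/sqnorm (comb_dot _ h) cReZ. Qed.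

(** Prefixing f multiplies every Gram entry by |f|^2, so the bound required by [extension] holds
    with equality. *)
Lemma creationP f : L2C f -> bop (creation f : H -> H) /\
  forall gs, L2C_seq gs -> creation f (tens gs) = tens (f :: gs).
Proof.
move=> hf.
suff : [set T : H -> H | bounded_op T /\
    forall gs, L2C_seq gs -> T (fock_tens H gs) = fock_tens H (f :: gs)] (creation f).
  by move=> [/bopP].
apply: getPex.
have [|T bT hT] := @extension _ _ H H wtens (fun w => tens (f :: sval w)) _
    (L2C_sqnorm_ge0 f) wtens_total.
  move=> s; rewrite le_eqVlt; apply/orP; left; apply/eqP.
  apply: comb_sqnorm => -[gs hgs] [hs hhs]; rewrite -L2C_dot_self.
  exact: tens_dot_cons.
by exists T; split; [exact/bopP|move=> gs hgs; exact: (hT (exist _ gs hgs))].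
Qed.

Notation cre f := (creation f : H -> H).
Notation ann f := (adjoint (cre f)).

Lemma bop_cre f : L2C f -> bop (cre f).
Proof. by move=> /creationP[]. Qed.

Lemma cre_tens f gs : L2C f -> L2C_seq gs -> cre f (tens gs) = tens (f :: gs).
Proof. by move=> /creationP[_]; apply. Qed.

Lemma bop_ann f : L2C f -> bop (ann f).
Proof. by move=> /bop_cre/bop_adjoint. Qed.

Lemma ann_tens_cons f g gs : L2C f -> L2C g -> L2C_seq gs ->
  ann f (tens (g :: gs)) = L2C_dot g f *: tens gs.
Proof.
move=> hf hg hgs; apply: tens_eqP => hs hhs.
rewrite -adjointPr; last exact: bop_cre.
by rewrite cre_tens// tens_dot_cons// dotZl.
Qed.

Lemma ann_tens_nil f : L2C f -> ann f (tens [::]) = 0.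
Proof.
move=> hf; apply: tens_eqP => hs hhs.
rewrite -adjointPr; last exact: bop_cre.
rewrite cre_tens// fock_dot//; last exact/L2C_seq_cons.
by rewrite dot0l.
Qed.

Lemma ann_cre f g x : L2C f -> L2C g -> ann f (cre g x) = L2C_dot g f *: x.
Proof.
move=> hf hg.
have bZ : bop (fun y : H => L2C_dot g f *: y).
  have := bop_lin (L2C_dot g f) (bop_id H) (bop_zero H H).
  by congr bop; apply/funext => y; rewrite addr0.
have := bop_eq_tens (bop_comp (bop_ann hf) (bop_cre hg)) bZ.
move=> h; apply: (congr1 (@^~ x) (h _)) => gs hgs /=.
by rewrite cre_tens// ann_tens_cons.
Qed.

Lemma sqnorm_cre f x : L2C f -> sqnorm (cre f x) = L2C_sqnorm f * sqnorm x.
Proof.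
move=> hf; rewrite {1}/sqnorm adjointP; last exact: bop_cre.
by rewrite ann_cre// dotZr L2C_dot_self conjc_real sqnormE -rmorphM.
Qed.

Lemma sqnorm_ann f x : L2C f -> sqnorm (ann f x) <= L2C_sqnorm f * sqnorm x.
Proof.
move=> hf; apply: adjoint_bound; [exact: bop_cre|exact: L2C_sqnorm_ge0|].
by move=> y; rewrite sqnorm_cre.
Qed.

Notation sc h := (semicircular h : H -> H).

Lemma bop_sc h : L2C (cpx h) -> bop (sc h).
Proof. by move=> hh; apply: bop_add; [exact: bop_cre|exact: bop_ann]. Qed.

Lemma adjoint_sc h : L2C (cpx h) -> adjoint (sc h) = sc h.
Proof.
move=> hh; have b := bop_cre hh; apply: adjoint_uniq => x y.
by rewrite /semicircular dotDl dotDr adjointP// addrC -adjointPr.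
Qed.

Lemma sc_tens_nil h : L2C (cpx h) -> sc h (tens [::]) = tens [:: cpx h].
Proof. by move=> hh; rewrite /semicircular cre_tens// ann_tens_nil// addr0. Qed.

Lemma sc_tens_cons h f gs : L2C (cpx h) -> L2C f -> L2C_seq gs ->
  sc h (tens (f :: gs)) = tens (cpx h :: f :: gs) + L2C_dot f (cpx h) *: tens gs.
Proof.
move=> hh hf hgs; rewrite /semicircular cre_tens ?ann_tens_cons//.
exact/L2C_seq_cons.
Qed.

Lemma cre_lin (c : R[i]) f g : L2C f -> L2C g ->
  cre (fun t => c * f t + g t) = (fun x => c *: cre f x + cre g x).
Proof.
move=> hf hg; have hfg := L2C_lin c hf hg.
apply: bop_eq_tens; [exact: bop_cre|apply: bop_lin; exact: bop_cre|].
by move=> gs hgs; rewrite !cre_tens// tens_lin_head.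
Qed.

Lemma cpx_lin (c : R) h (h' : R -> R) :
  cpx (fun t => c * h t + h' t) = (fun t => c%:C * cpx h t + cpx h' t).
Proof. by apply/funext => t; rewrite /cpx rmorphD rmorphM. Qed.

Lemma sc_lin (c : R) h (h' : R -> R) : L2C (cpx h) -> L2C (cpx h') ->
  sc (fun t => c * h t + h' t) = (fun x => c%:C *: sc h x + sc h' x).
Proof.
move=> hh hh'; have b := bop_cre hh; have b' := bop_cre hh'.
apply/funext => x; rewrite /semicircular cpx_lin cre_lin//.
rewrite (@adjoint_uniq _ _ _ (fun x => c%:C *: ann (cpx h) x + ann (cpx h') x)).
  by rewrite scalerDr addrACA.
by move=> y z; rewrite dotDl dotDr dotZl dotZr conjc_real !adjointP.
Qed.

Lemma sqnorm_sc h x : L2C (cpx h) ->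
  sqnorm (sc h x) <= 4 * L2C_sqnorm (cpx h) * sqnorm x.
Proof.
move=> hh; apply: le_trans (sqnormDle _ _) _.
have := sqnorm_ann x hh; rewrite sqnorm_cre//; lra.
Qed.

(** S is linear in h and its operator norm is controlled by the L^2 norm of h. Strong convergence is
    what [vN_lim] needs to keep membership. *)
Lemma sc_cvg (h_ : nat -> R -> R) h : (forall n, L2C (cpx (h_ n))) -> L2C (cpx h) ->
  (forall e : R, 0 < e -> exists N, forall n, (N <= n)%N ->
     L2C_sqnorm (cpx (fun t => h_ n t - h t)) < e) ->
  forall x, sc (h_ n) x @[n --> \oo] --> sc h x.
Proof.
move=> hh_ hh h0 x; apply/cvg_sqnormP => e e0.
pose M := 4 * sqnorm x + 1.
have M0 : 0 < M by rewrite ltr_wpDl// mulr_ge0// sqnorm_ge0.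
have [N hN] := h0 (e / M) (divr_gt0 e0 M0).
exists N => n Nn; have := hN n Nn; rewrite ltr_pdivlMr// => hn.
have E : (fun t => h_ n t - h t) = (fun t => -1 * h t + h_ n t).
  by apply/funext => t; rewrite mulN1r addrC.
have hL : L2C (cpx (fun t => h_ n t - h t)).
  by rewrite E cpx_lin; exact: L2C_lin.
rewrite sqnormBC; have -> : sc (h_ n) x - sc h x = sc (fun t => h_ n t - h t) x.
  by rewrite E sc_lin// rmorphN rmorph1 scaleN1r addrC.
apply: le_lt_trans (sqnorm_sc _ hL) _; apply: le_lt_trans hn.
have := L2C_sqnorm_ge0 (cpx (fun t => h_ n t - h t)).
have := sqnorm_ge0 x; rewrite /M; nra.
Qed.

Lemma fock_gram_rev gs hs : fock_gram (rev gs) (rev hs) = fock_gram gs hs.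
Proof.
rewrite /fock_gram !size_rev; case: eqP => // E.
by rewrite -rev_zip//; apply: perm_big; rewrite perm_rev.
Qed.

Definition flip : H -> H :=
  get [set T : H -> H | bop T /\ forall gs, L2C_seq gs -> T (tens gs) = tens (rev gs)].

Lemma flipP : bop flip /\ forall gs, L2C_seq gs -> flip (tens gs) = tens (rev gs).
Proof.
apply: (@getPex _ [set T : H -> H | bop T /\
  forall gs, L2C_seq gs -> T (tens gs) = tens (rev gs)]).
have [|T bT hT] := @extension _ _ H H wtens (fun w => tens (rev (sval w))) _
    ler01 wtens_total.
  move=> s; rewrite le_eqVlt; apply/orP; left; apply/eqP.
  apply: comb_sqnorm => -[gs hgs] [hs hhs].
  by rewrite mul1r /wtens /= !fock_dot ?fock_gram_rev//; exact: L2C_seq_rev.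
by exists T; split=> // gs hgs; exact: (hT (exist _ gs hgs)).
Qed.

Lemma bop_flip : bop flip. Proof. exact: (proj1 flipP). Qed.

Lemma flip_tens gs : L2C_seq gs -> flip (tens gs) = tens (rev gs).
Proof. exact: (proj2 flipP). Qed.

(* Conjugation by the flip turns left creation into right creation: [scr h] is the
   right semicircular operator. *)
Definition scr h : H -> H := flip \o sc h \o flip.

Lemma bop_scr h : L2C (cpx h) -> bop (scr h).
Proof.
by move=> hh; apply: bop_comp bop_flip; apply: bop_comp bop_flip _; exact: bop_sc.
Qed.

Lemma scr_tens_nil h : L2C (cpx h) -> scr h (tens [::]) = tens [:: cpx h].
Proof.
move=> hh; rewrite /scr /= flip_tens// sc_tens_nil// flip_tens//.
exact/L2C_seq_cons.
Qed.

Lemma scr_tens_rcons h f gs : L2C (cpx h) -> L2C f -> L2C_seq gs ->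
  scr h (tens (rcons gs f)) =
  tens (rcons (rcons gs f) (cpx h)) + L2C_dot f (cpx h) *: tens gs.
Proof.
move=> hh hf hgs; have hrev := L2C_seq_rev hgs.
rewrite /scr /= flip_tens ?rev_rcons; last exact: L2C_seq_rcons.
rewrite sc_tens_cons// (linD (proj1 bop_flip)) (linZ (proj1 bop_flip)).
rewrite !flip_tens//; last by apply/L2C_seq_cons; split=> //; exact/L2C_seq_cons.
by rewrite !rev_cons revK.
Qed.

(** Left operators touch the first letter and right ones the last, so they can interact only on
    words of length at most one. On one letter the two extra terms trade places; on the vacuum the
    two scalars are <h, g> and <g, h>, equal because h and g are real. *)
Lemma sc_scr h (g : R -> R) x : L2C (cpx h) -> L2C (cpx g) ->
  sc g (scr h x) = scr h (sc g x).
Proof.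
move=> hh hg; have bs := bop_sc hg; have br := bop_scr hh.
have ls := proj1 bs; have lr := proj1 br.
have := bop_eq_tens (bop_comp bs br) (bop_comp br bs).
move=> h'; apply: (congr1 (@^~ x) (h' _)) => -[|f gs] /=.
  move=> _; rewrite scr_tens_nil// sc_tens_nil// sc_tens_cons//.
  by rewrite (@scr_tens_rcons h (cpx g) [::])//= L2C_dot_real.
move=> /L2C_seq_cons[hf]; case: (lastP gs) => [_|m f'].
  rewrite (@scr_tens_rcons h f [::])//= (linD ls) (linZ ls) !sc_tens_cons//; last first.
    by apply/L2C_seq_cons; split.
  rewrite (linD lr) (linZ lr) sc_tens_nil// scr_tens_nil//.
  rewrite (@scr_tens_rcons h f [:: cpx g])//=; last by apply/L2C_seq_cons.
  by rewrite -!addrA; congr (_ + _); rewrite addrC.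
rewrite -cats1 => /L2C_seq_cat[hm /L2C_seq_cons[hf' _]]; rewrite cats1.
have hfm : L2C_seq (f :: m) by apply/L2C_seq_cons.
have hmf : L2C_seq (rcons m f') by exact: L2C_seq_rcons.
have hgfm : L2C_seq (cpx g :: f :: m) by apply/L2C_seq_cons.
rewrite -rcons_cons scr_tens_rcons// rcons_cons (linD ls) (linZ ls).
rewrite rcons_cons sc_tens_cons//; last exact: L2C_seq_rcons.
rewrite !sc_tens_cons// (linD lr) (linZ lr) scr_tens_rcons//.
rewrite -!rcons_cons scr_tens_rcons//.
rewrite !scalerDr !scalerA -!addrA; congr (_ + _).
by rewrite addrCA; congr (_ + _); rewrite addrC mulrC addrC.
Qed.

End Fock.

(** * The von Neumann algebra of the free Brownian motion *)

Section Membership.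
Context {R : realType}.
Variable H : fock_space R.
Implicit Types (h : R -> R) (A B : set R) (N : set (H -> H)).

Notation mu := (@lebesgue_measure R).
Notation D := (@half_line R).
Notation sc h := (semicircular h : H -> H).
Local Notation mD := (@measurable_half_line R).

Lemma indicT B (t : R) : B t -> \1_B t = 1 :> R.
Proof. by move=> Bt; rewrite indicE mem_set. Qed.

Lemma indicF B (t : R) : ~ B t -> \1_B t = 0 :> R.
Proof. by move=> Bt; rewrite indicE memNset. Qed.

Lemma vN_sc_linear N (c : R) h (h' : R -> R) : von_neumann_algebra N ->
  RL2 h -> RL2 h' -> N (sc h) -> N (sc h') -> N (sc (fun t => c * h t + h' t)).
Proof. by move=> vN /L2C_cpxP hh /L2C_cpxP hh' Nh Nh'; rewrite sc_lin//; exact: vN_lin. Qed.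

Lemma RL2_sum (I : Type) (r : seq I) (c : I -> R) (u : I -> R -> R) :
  (forall i, RL2 (u i)) -> RL2 (fun t => \sum_(i <- r) c i * u i t).
Proof.
move=> hu; elim: r => [|i r ih].
  by have := @RL20 R; congr RL2; apply/funext => t; rewrite big_nil.
by have := RL2_lin (c i) (hu i) ih; congr RL2; apply/funext => t; rewrite big_cons.
Qed.

Lemma vN_sc_sum N (I : Type) (r : seq I) (c : I -> R) (u : I -> R -> R) :
  von_neumann_algebra N -> N (sc (fun=> 0)) -> (forall i, RL2 (u i)) ->
  (forall i, N (sc (u i))) -> N (sc (fun t => \sum_(i <- r) c i * u i t)).
Proof.
move=> vN N0 hu Nu; elim: r => [|i r ih].
  by move: N0; congr (N (sc _)); apply/funext => t; rewrite big_nil.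
have := vN_sc_linear (c i) vN (hu i) (RL2_sum r c hu) (Nu i) ih.
by congr (N (sc _)); apply/funext => t; rewrite big_cons.
Qed.

Section FromIndicators.
Variables (N : set (H -> H)) (A : set R).
Hypothesis vN : von_neumann_algebra N.
Hypothesis mA : measurable A.
Hypothesis Nind : forall B, measurable B -> B `<=` A -> RL2 \1_B -> N (sc \1_B).

Lemma sc0_mem : N (sc (fun=> 0)).
Proof.
have e0 : \1_(set0 : set R) = (fun=> 0) :> (R -> R).
  by apply/funext => t; rewrite indicF.
rewrite -e0; apply: Nind; [exact: measurable0|exact: sub0set|].
by rewrite e0; exact: RL20.
Qed.

Lemma vN_sc_ge0 h : RL2 h -> (forall t, D t -> 0 <= h t) ->
  (forall t, D t -> ~ A t -> h t = 0) -> N (sc h).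
Proof.
move=> rh h0 hA; have mh := proj1 rh.
have mEh : @measurable_fun _ _ (measurableTypeR R) _ D (EFin \o h).
  by apply/measurable_EFinP.
have Eh0 t : D t -> (0 <= (EFin \o h) t)%E by move=> Dt; rewrite lee_fin h0.
pose s n := nnsfun_approx mD mEh n.
have s_cvg t : D t -> s n t @[n --> \oo] --> h t.
  by move=> Dt; have /fine_cvgP[_] := cvg_nnsfun_approx mD mEh Eh0 Dt.
have s_nd t : {homo (fun n => s n t) : m n / (m <= n)%N >-> m <= n}.
  by move=> m n mn; have /lefP/(_ t) := nd_nnsfun_approx mD mEh mn.
have s_le n t : D t -> s n t <= h t.
  move=> Dt; rewrite -(cvg_lim (@Rhausdorff R) (s_cvg t Dt)).
  apply: nondecreasing_cvgn_le; first exact: s_nd.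
  by apply/cvg_ex; exists (h t); exact: s_cvg.
pose g n t : R := \1_(A `&` D) t * s n t.
have mAD : measurable (A `&` D) by apply: measurableI => //; exact: mD.
have Ng n : N (sc (g n)).
  (* The level set of the value 0 may have infinite measure; it contributes nothing to the simple
     function and is replaced by the empty set. *)
  pose Bn (y : R) := (A `&` D) `&` (if y == 0 then set0 else s n @^-1` [set y]).
  have mB y : measurable (Bn y).
    apply: measurableI => //; case: ifP => _; first exact: measurable0.
    exact: (@measurable_sfunP _ _ (measurableTypeR R) R (s n)).
  (* Chebyshev: on the level set, y = s n t <= h t with y > 0, so the indicator is dominated by h /
     y. *)
  have RB y : RL2 (\1_(Bn y)).
    apply: (RL2_dom _ (RL2Z y^-1 rh)); first exact: measurable_indic.
    move=> t Dt; have [[[At _]]|nB] := pselect (Bn y t); last first.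
      by rewrite (indicF nB) expr0n sqr_ge0.
    case: eqP => // /eqP y0 /= sy; have sh := s_le n t Dt; rewrite sy in sh.
    have ygt0 : 0 < y by rewrite lt_def y0 -sy; exact: fun_ge0.
    rewrite indicT; last by rewrite /Bn (negbTE y0).
    rewrite expr1n -[X in X <= _](expr1n _ 2) ler_sqr ?nnegrE//; last first.
      by apply: mulr_ge0; [rewrite invr_ge0 ltW|exact: h0].
    by rewrite ler_pdivlMl// mulr1.
  have := @vN_sc_sum N R (finmap.enum_fset (fset_set (range (s n)))) id
    (fun y => \1_(Bn y)) vN sc0_mem RB.
  have NB y : N (sc \1_(Bn y)).
    by apply: Nind => //; move=> t [[]].
  move=> /(_ NB); congr (N (sc _)); apply/funext => t.
  rewrite /g [in RHS](fimfunE (s n) t) (fsbig_finite _ _ _) //=.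
  rewrite mulr_sumr; apply: eq_bigr => y _.
  have [->|y0] := eqVneq y 0; first by rewrite !mul0r mulr0.
  by rewrite mulrCA /Bn (negbTE y0) indicI.
apply: (@vN_lim _ _ N vN (fun n => sc (g n))) => //.
  by apply: bop_sc; apply/L2C_cpxP.
have Rg n : RL2 (g n).
  apply: (RL2_dom _ rh) => [|t Dt].
    apply: measurable_funM; first exact: measurable_indic.
    exact: (@measurable_funTS _ _ (measurableTypeR R) R _ (s n)).
  rewrite /g; have [At|nA] := pselect ((A `&` D) t).
    by rewrite indicT// mul1r ler_sqr ?nnegrE ?h0//; exact: s_le.
  by rewrite indicF// mul0r expr0n sqr_ge0.
apply: sc_cvg; [by move=> n; apply/L2C_cpxP|exact/L2C_cpxP|].
apply: (L2_dominated _ mh rh) => [n|n t Dt|t Dt].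
- exact: (proj1 (Rg n)).
- rewrite /g; have [At|nA] := pselect ((A `&` D) t).
    by rewrite indicT// mul1r ger0_norm//; exact: s_le.
  by rewrite indicF// mul0r normr0 h0.
- have [At|nA] := pselect (A t).
    rewrite (_ : (fun n => g n t) = (fun n => s n t)); first exact: s_cvg.
    by apply/funext => n; rewrite /g indicT// mul1r.
  rewrite (_ : (fun n => g n t) = cst 0); last first.
    by apply/funext => n; rewrite /g indicF ?mul0r// => -[].
  by rewrite hA//; exact: cvg_cst.
Qed.

Lemma vN_sc h : RL2 h -> (forall t, D t -> ~ A t -> h t = 0) -> N (sc h).
Proof.
move=> rh hA; have mh := proj1 rh.
have ra : RL2 (fun t => `|h t|).
  apply: (RL2_dom _ rh) => [|t _]; last by rewrite -normrX ger0_norm ?sqr_ge0.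
  by apply: measurableT_comp => //; exact: normr_measurable.
have rp := RL2Z 2^-1 (RL2_lin 1 rh ra).
have rm := RL2Z 2^-1 (RL2_lin (-1) rh ra).
have Np := vN_sc_ge0 rp; have Nm := vN_sc_ge0 rm.
have -> : h = (fun t => -1 * (2^-1 * (-1 * h t + `|h t|)) + 2^-1 * (1 * h t + `|h t|)).
  by apply/funext => t; field.
apply: vN_sc_linear => //.
- apply: Nm => t Dt; last by move=> /(hA t Dt) ->; rewrite normr0 mulr0 addr0 mulr0.
  by rewrite mulr_ge0// mulN1r addrC subr_ge0 ler_norm.
- apply: Np => t Dt; last by move=> /(hA t Dt) ->; rewrite normr0 mulr0 addr0 mulr0.
  by rewrite mulr_ge0// mul1r -lerBlDl sub0r -normrN ler_norm.
Qed.

End FromIndicators.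
End Membership.

(** * From the free Brownian motion to all S(h), and the subalgebras of sets of finite measure *)

Section FreeBrownianMotion.
Context {R : realType}.
Variable H : fock_space R.
Implicit Types (h : R -> R) (A B : set R) (N : set (H -> H)).

Notation mu := (@lebesgue_measure R).
Notation D := (@half_line R).
Notation sc h := (semicircular h : H -> H).
Local Notation mD := (@measurable_half_line R).

Lemma RL2_itv (x : R) : RL2 (\1_(`[0, x]) : R -> R).
Proof.
apply: RL2_indic; first exact: measurable_itv.
  by move=> t; rewrite /half_line /= !in_itv /= => /andP[->].
by rewrite lebesgue_measure_itv /=; case: ifP => _; rewrite -?EFinB ltry.
Qed.

Lemma indic_ge0 B (t : R) : 0 <= \1_B t :> R.
Proof. by rewrite indicE; case: (t \in B). Qed.

Lemma indic_le1 B (t : R) : \1_B t <= 1 :> R.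
Proof. by rewrite indicE; case: (t \in B). Qed.

Lemma bounded_fbm : bounded_set (@free_bm R H @` half_line).
Proof. by move=> _ [t _ <-]; apply: bop_sc; apply/L2C_cpxP; exact: RL2_itv. Qed.

Lemma star_fbm : star_closed (@free_bm R H @` half_line).
Proof.
move=> _ [t Dt <-]; rewrite adjoint_sc; first by exists t.
by apply/L2C_cpxP; exact: RL2_itv.
Qed.

Lemma SC_vN : von_neumann_algebra (@SC R H).
Proof. apply: vN_generated_vN; [exact: bounded_fbm|exact: star_fbm]. Qed.

Lemma RL2_indicI B (n : R) : measurable B -> RL2 (\1_(B `&` `[0, n]) : R -> R).
Proof.
move=> mB; have := RL2_cut mB (RL2_itv n).
by congr RL2; rewrite indicI.
Qed.

Let SCvN := SC_vN.

Lemma SC_fbm (x : R) : 0 <= x -> SC (sc \1_(`[0, x])).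
Proof.
by move=> x0; apply: vN_generated_sub; exists x => //; rewrite /half_line /= in_itv /= x0.
Qed.

Lemma SC_sc0 : SC (sc (fun=> 0)).
Proof.
have e : (fun=> 0) = (fun t => -1 * \1_(`[0, 0]) t + \1_(`[0, 0]) t) :> (R -> R).
  by apply/funext => t; rewrite mulN1r addNr.
by rewrite e; apply: (vN_sc_linear _ SCvN); try exact: RL2_itv; exact: SC_fbm.
Qed.

(** Dynkin induction from the half-lines ]x, +oo[, whose traces on [0, n] are differences of
    intervals [0, y]. Intersecting with [0, n] keeps every indicator square integrable, complements
    included. *)
Lemma SC_indic_bounded B (n : nat) : measurable B -> SC (sc \1_(B `&` `[0, n%:R])).
Proof.
move=> mB; have : (@RGenOInfty.G R).-sigma.-measurable B by rewrite -RGenOInfty.measurableE.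
apply: (@dynkin_induction _ (measurableTypeR R) (@RGenOInfty.G R)
  (fun B => SC (sc \1_(B `&` `[0, n%:R])))).
- exact: RGenOInfty.measurableE.
- move=> _ _ [x ->] [y ->]; exists (Num.max x y).
  apply/seteqP; split=> t /=; rewrite !in_itv /= !andbT gt_max.
    by move=> [-> ->].
  by move=> /andP[-> ->].
- by rewrite setTI; exact: SC_fbm.
- move=> _ [x ->]; have [x0|x0] := ltP x 0.
    rewrite (_ : _ `&` _ = `[0, n%:R]%classic); first exact: SC_fbm.
    apply/seteqP; split=> t /=; rewrite !in_itv /= ?andbT; first by case.
    by move=> /andP[t0 ->]; rewrite t0 (lt_le_trans x0).
  have -> : \1_(`]x, +oo[ `&` `[0, n%:R]) =
      (fun t => -1 * \1_(`[0, Num.min x n%:R]) t + \1_(`[0, n%:R]) t) :> (R -> R).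
    apply/funext => t; rewrite indicI /= mulN1r.
    have itvE (i : interval R) : \1_[set` i] t = (t \in i)%:R :> R.
      by rewrite indicE mem_setE.
    rewrite !itvE !in_itv /= le_min andbT (ltNge x t).
    by case: (0 <= t); case: (t <= x); case: (t <= _);
      rewrite /= ?mulr0 ?mul0r ?mulr1 ?subrr ?oppr0 ?addr0 ?add0r ?addNr.
  apply: (vN_sc_linear _ SCvN); try exact: RL2_itv; last exact: SC_fbm.
  by apply: SC_fbm; rewrite le_min x0 /=.
- move=> S mS SS.
  have -> : \1_(~` S `&` `[0, n%:R]) =
      (fun t => -1 * \1_(S `&` `[0, n%:R]) t + \1_(`[0, n%:R]) t) :> (R -> R).
    apply/funext => t; rewrite !indicI /=.
    have [St|St] := pselect (S t).
      have nS : ~ (~` S) t by move=> /(_ St).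
      by rewrite (indicT St) (indicF nS) mul0r mul1r mulN1r addNr.
    have cS : (~` S) t by [].
    by rewrite (indicF St) (indicT cS) mul0r mulr0 mul1r add0r.
  apply: (vN_sc_linear _ SCvN) => //; [exact: RL2_indicI|exact: RL2_itv|exact: SC_fbm].
- move=> F mF tF SF.
  (* Indicators of disjoint sets add up, which gives the finite unions; the countable union is a
     strong limit, dominated by the indicator of [0, n]. *)
  pose G m := \big[setU/set0]_(k < m) F k.
  have mG m : measurable (G m) by apply: bigsetU_measurable => k _; exact: mF.
  have SG m : SC (sc \1_(G m `&` `[0, n%:R])).
    elim: m => [|m ih].
      rewrite /G big_ord0 set0I; move: SC_sc0; congr (SC (sc _)).
      by apply/funext => t; rewrite indicF.
    have -> : \1_(G m.+1 `&` `[0, n%:R]) =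
      (fun t => 1 * \1_(G m `&` `[0, n%:R]) t + \1_(F m `&` `[0, n%:R]) t) :> (R -> R).
      apply/funext => t; rewrite !indicI /= mul1r -mulrDl; congr (_ * _).
      rewrite /G big_ord_recr /= -/(G m).
      have [Ft|Ft] := pselect (F m t).
        have nG : ~ G m t.
          rewrite /G -bigcup_mkord => -[k /= km Fk].
          have := tF k m I I; move/(_ (ex_intro _ t (conj Fk Ft))) => km'.
          by rewrite km' ltnn in km.
        have UGF : (G m `|` F m) t by right.
        by rewrite (indicT Ft) (indicT UGF) (indicF nG) add0r.
      rewrite (indicF Ft) addr0.
      have [Gt|Gt] := pselect (G m t).
        have UGF : (G m `|` F m) t by left.
        by rewrite (indicT UGF) (indicT Gt).
      have nUGF : ~ (G m `|` F m) t by case.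
      by rewrite (indicF nUGF) (indicF Gt).
    exact: (vN_sc_linear _ SCvN (RL2_indicI _ (mG m)) (RL2_indicI _ (mF m)) ih (SF m)).
  have mU : measurable (\bigcup_k F k) by apply: bigcup_measurable => k _; exact: mF.
  apply: (@vN_lim _ _ (@SC R H) SCvN (fun m => sc \1_(G m `&` `[0, n%:R]))) => //.
    by apply: bop_sc; apply/L2C_cpxP; exact: RL2_indicI.
  apply: sc_cvg; [move=> m; apply/L2C_cpxP; exact: (RL2_indicI _ (mG m))|
    apply/L2C_cpxP; exact: (RL2_indicI _ mU)|].
  apply: (L2_dominated _ _ (RL2_itv n%:R)) => [m||m t Dt|t Dt].
  + exact: (proj1 (RL2_indicI _ (mG m))).
  + exact: (proj1 (RL2_indicI _ mU)).
  + by rewrite ger0_norm ?indic_ge0// indicI /= ler_piMl ?indic_ge0 ?indic_le1.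
  + rewrite indicI /=; under eq_fun do rewrite indicI /=.
    apply: cvgM; last exact: cvg_cst.
    have [[k _ Fk]|Ut] := pselect ((\bigcup_k F k) t).
      apply: cvg_near_cst; exists k.+1 => // m /= km.
      have Gt : G m t by rewrite /G -bigcup_mkord; exists k.
      have Ut : (\bigcup_k F k) t by exists k.
      by rewrite (indicT Ut) (indicT Gt).
    apply: cvg_near_cst; exists 0%N => // m _.
    have Gt : ~ G m t by rewrite /G -bigcup_mkord => -[k _ Fk]; apply: Ut; exists k.
    by rewrite (indicF Ut) (indicF Gt).
Qed.

(** B has finite measure but may be unbounded: let n grow, with the indicator of B as dominating
    function. *)
Lemma SC_indic B : measurable B -> B `<=` D -> RL2 \1_B -> SC (sc \1_B).
Proof.
move=> mB BD RB.
apply: (@vN_lim _ _ (@SC R H) SCvN (fun n => sc \1_(B `&` `[0, n%:R]))).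
- by move=> n; exact: SC_indic_bounded.
- by apply: bop_sc; apply/L2C_cpxP.
apply: sc_cvg; [by move=> m; apply/L2C_cpxP; exact: RL2_indicI|by apply/L2C_cpxP|].
apply: (L2_dominated _ (proj1 RB) RB) => [m|m t Dt|t Dt].
- exact: (proj1 (RL2_indicI _ mB)).
- by rewrite ger0_norm ?indic_ge0// indicI /= ler_piMr ?indic_ge0 ?indic_le1.
- under eq_fun do rewrite indicI /=.
  have -> : \1_B t = \1_B t * 1 :> R by rewrite mulr1.
  under eq_fun do rewrite mulr1.
  apply: cvgM; first exact: cvg_cst.
  apply: cvg_near_cst; exists (Num.truncn t).+1 => // m /= tm; rewrite indicT//.
  move: Dt; rewrite /half_line /= !in_itv /= andbT => -> /=.
  by apply: ltW; apply: lt_le_trans (truncnS_gt _) _; rewrite ler_nat.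
Qed.

Lemma SC_sc h : L2C (cpx h) -> SC (sc h).
Proof.
move=> /L2C_cpxP rh; apply: (@vN_sc _ _ _ D SCvN _ _ h rh) => [||t Dt /(_ Dt)//].
- exact: measurable_half_line.
- exact: SC_indic.
Qed.

Lemma bounded_SC_gen A : (forall B, measurable B -> B `<=` A -> RL2 (\1_B : R -> R)) ->
  bounded_set [set semicircular (H := H) \1_B | B in [set B | measurable B /\ B `<=` A]].
Proof. by move=> h _ [B [mB BA] <-]; apply: bop_sc; apply/L2C_cpxP; exact: h. Qed.

Lemma star_SC_gen A : (forall B, measurable B -> B `<=` A -> RL2 (\1_B : R -> R)) ->
  star_closed [set semicircular (H := H) \1_B | B in [set B | measurable B /\ B `<=` A]].
Proof.
move=> h _ [B [mB BA] <-]; rewrite adjoint_sc; first by exists B.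
by apply/L2C_cpxP; exact: h.
Qed.

Section FiniteMeasureSet.
Variable A : set R.
Hypotheses (mA : measurable A) (AD : A `<=` D) (finA : (mu A < +oo)%E).

Lemma RL2_subset B : measurable B -> B `<=` A -> RL2 (\1_B : R -> R).
Proof.
move=> mB BA; apply: RL2_indic => //; first exact: subset_trans AD.
by apply: le_lt_trans finA; apply: le_measure; rewrite ?inE.
Qed.

Lemma SC_of_vN : von_neumann_algebra (@SC_of R H A).
Proof.
by apply: vN_generated_vN; [apply: bounded_SC_gen|apply: star_SC_gen]; exact: RL2_subset.
Qed.

Lemma SC_of_sc h : L2C (cpx h) -> (forall t, D t -> ~ A t -> h t = 0) -> SC_of A (sc h).
Proof.
move=> /L2C_cpxP rh hA; apply: (@vN_sc _ _ _ A SC_of_vN mA _ h rh hA).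
by move=> B mB BA _; apply: vN_generated_sub; exists B.
Qed.

Lemma SC_of_SC : @SC_of R H A `<=` @SC R H.
Proof.
apply: vN_generated_least; first exact: SC_vN.
by move=> _ [B [mB BA] <-]; apply: SC_sc; apply/L2C_cpxP; exact: RL2_subset.
Qed.

End FiniteMeasureSet.
End FreeBrownianMotion.

(** * Closed linear spans and projections onto them *)

Section ClosedSpans.
Context {R : realType}.
Implicit Types U V : hilbertType R.

Lemma comb_span_memE I V (f : I -> V) x :
  Defs.span (range f) x <-> exists s, x = comb f s.
Proof. exact: (span_memE (erefl _)). Qed.

Lemma subspace_span I V (f : I -> V) : subspace (Defs.span (range f)).
Proof.
split; first by apply/comb_span_memE; exists [::]; rewrite /comb big_nil.
move=> a x y /comb_span_memE[s ->] /comb_span_memE[t ->].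
by apply/comb_span_memE; exists (cscale a s ++ t); rewrite comb_cat comb_cscale.
Qed.

Lemma subspace_closure V (A : set V) : subspace A -> subspace (closure A).
Proof.
move=> [A0 sA]; split; first exact: subset_closure.
move=> a x y /closure_sqnormP cx /closure_sqnormP cy; apply/closure_sqnormP => e e0.
pose M := 2 * (nsq a + 1).
have M0 : 0 < M by rewrite mulr_gt0// ltr_wpDl// nsq_ge0.
have [u Au xu] := cx _ (divr_gt0 e0 M0); have [v Av yv] := cy _ (divr_gt0 e0 M0).
exists (a *: u + v); first exact: sA.
have -> : a *: x + y - (a *: u + v) = a *: (x - u) + (y - v).
  by rewrite scalerBr opprD addrACA.
apply: le_lt_trans (sqnormDle _ _) _; rewrite nsq_sqnormZ.
rewrite !ltr_pdivlMr// in xu yv.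
have := nsq_ge0 a; have := sqnorm_ge0 (x - u); have := sqnorm_ge0 (y - v).
rewrite /M in xu yv *; nra.
Qed.

Lemma closureK V (A : set V) : closure (closure A) = closure A.
Proof. by apply/esym/closure_id; exact: closed_closure. Qed.

Lemma dot_closure0 V (A : set V) x : (forall z, A z -> hdot x z = 0) ->
  forall z, closure A z -> hdot x z = 0.
Proof.
move=> h z /closure_sqnormP cz; apply: nsq_eq0; apply/eqP; rewrite eq_le nsq_ge0 andbT.
apply: (@sqnorm_le_eps _ _ (sqnorm x)); first exact: sqnorm_ge0.
move=> e e0; have [a Aa za] := cz _ e0.
have := CauchySchwarz_sqnorm x (z - a); rewrite dotBr (h _ Aa) subr0 add0r => /le_trans; apply.
by rewrite ler_wpM2l ?sqnorm_ge0// ltW.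
Qed.

Lemma dot_span0 I V (f : I -> V) x : (forall i, hdot x (f i) = 0) ->
  forall z, Defs.span (range f) z -> hdot x z = 0.
Proof.
move=> h z /comb_span_memE[s ->]; rewrite /comb dot_sumr big1// => p _.
by rewrite dotZr h mulr0.
Qed.

Lemma bop_orth_proj V (A : set V) : subspace A -> closure A = A -> bop (orth_proj A).
Proof.
move=> sA cA; have P := orth_projP sA cA; have [A0 lA] := sA; split.
  move=> a x y; apply: orth_proj_uniq => //.
    by apply: lA; [exact: (proj1 (P x))|exact: (proj1 (P y))].
  move=> z Az.
  have -> : a *: x + y - (a *: orth_proj A x + orth_proj A y) =
      a *: (x - orth_proj A x) + (y - orth_proj A y).
    by rewrite scalerBr opprD addrACA.
  by rewrite dotDl dotZl (proj2 (P x))// (proj2 (P y))// mulr0 addr0.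
exists 1 => // x; rewrite mul1r; have [Ap hp] := P x.
rewrite -[X in _ <= sqnorm X](subrK (orth_proj A x)) sqnormD hp// mulr0 addr0.
by rewrite lerDr sqnorm_ge0.
Qed.

Lemma closure_span_super V (A : set V) (B : set V) : closure A = setT ->
  A `<=` B -> closure B = setT.
Proof.
by move=> cA AB; apply/seteqP; split=> // x _; apply: (closureS AB); rewrite cA.
Qed.

Lemma sub_span V (A : set V) : A `<=` Defs.span A.
Proof.
move=> x Ax; exists 1%N, (fun=> 1), (fun=> x); split=> //.
by rewrite big_ord1 scale1r.
Qed.

Lemma span_comb_sub I V (f : I -> V) (A : set V) :
  (forall a, A a -> exists s, a = comb f s) -> Defs.span A `<=` Defs.span (range f).
Proof.
move=> h _ [n [c [v [Av ->]]]].
have [z0 sz] := subspace_span f.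
elim/big_ind: _ => //.
  by move=> x y hx hy; rewrite -(scale1r x); exact: sz.
move=> i _; have [s ->] := h _ (Av i).
rewrite -(addr0 (_ *: _)); apply: sz => //.
by apply/comb_span_memE; exists s.
Qed.

End ClosedSpans.

(** * Words of real functions and the Wick recursion *)

Section RealWords.
Context {R : realType}.
Variable H : fock_space R.
Notation tens := (fock_tens H).
Notation sc h := (semicircular h : H -> H).

(** Letters are real because [semicircular] and the gradient are given for real functions; complex
    words are recovered as complex combinations in [tens_real_comb]. *)
Definition rword := {gs : seq (R -> R) | L2C_seq (map cpx gs)}.
Definition rtens (w : rword) : H := tens (map cpx (sval w)).

Definition wnil : rword :=
  exist (fun gs => L2C_seq (map cpx gs)) [::] (@L2C_seq_nil R).

Lemma wcons_subproof (h : R -> R) (w : rword) : L2C (cpx h) ->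
  L2C_seq (map cpx (h :: sval w)).
Proof. by move=> hh; apply/L2C_seq_cons; split=> //; exact: (svalP w). Qed.

Definition wcons (h : R -> R) (hh : L2C (cpx h)) (w : rword) : rword :=
  exist (fun gs => L2C_seq (map cpx gs)) (h :: sval w) (@wcons_subproof h w hh).

Lemma rword_ind (P : rword -> Prop) : P wnil ->
  (forall h hh w, P w -> P (@wcons h hh w)) -> forall w, P w.
Proof.
move=> P0 PS [gs hgs]; elim: gs hgs => [|g gs ih] hgs.
  by rewrite (_ : exist _ _ _ = wnil)//; exact: eq_exist.
have [hg hgs'] := (proj1 (L2C_seq_cons _ _)) hgs.
have := PS g hg _ (ih hgs'); congr P; exact: eq_exist.
Qed.

(** The induction that fits the recursion [sc_wcons], in which the words h f w, f w and w occur
    together. *)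
Lemma rword_ind2 (P : rword -> Prop) : P wnil -> (forall h hh, P (@wcons h hh wnil)) ->
  (forall h hh f hf w, P w -> P (@wcons f hf w) -> P (@wcons h hh (@wcons f hf w))) ->
  forall w, P w.
Proof.
move=> P0 P1 P2 w; suff : P w /\ forall h hh, P (@wcons h hh w) by case.
by elim/rword_ind: w => [//|f hf w [Pw PS]]; split; [exact: PS|move=> h hh; exact: P2].
Qed.

Lemma rtens_wnil : rtens wnil = vacuum H. Proof. by []. Qed.

Lemma sc_wnil h (hh : L2C (cpx h)) : sc h (rtens wnil) = rtens (wcons hh wnil).
Proof. exact: sc_tens_nil. Qed.

Lemma sc_wcons h (hh : L2C (cpx h)) f (hf : L2C (cpx f)) w :
  sc h (rtens (wcons hf w)) =
  rtens (wcons hh (wcons hf w)) + L2C_dot (cpx f) (cpx h) *: rtens w.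
Proof. by apply: sc_tens_cons => //; exact: (svalP w). Qed.

Lemma tens_real_comb gs : L2C_seq gs -> exists s, tens gs = comb rtens s.
Proof.
elim: gs => [_|g gs ih /L2C_seq_cons[hg hgs]]; last have [s hs] := ih hgs.
  by exists [:: (1, wnil)]; rewrite /comb big_seq1 scale1r.
have [gr gi] := (proj1 (L2CP _)) hg.
have hr : L2C (cpx (fun t => complex.Re (g t))) by apply/L2C_cpxP.
have hi : L2C (cpx (fun t => complex.Im (g t))) by apply/L2C_cpxP.
have gE : g = (fun t => 'i%C * cpx (fun t => complex.Im (g t)) t +
    cpx (fun t => complex.Re (g t)) t).
  by apply/funext => t; rewrite [LHS]complexE addrC.
exists ([seq (p.1 * 'i%C, wcons hi p.2) | p <- s] ++ [seq (p.1, wcons hr p.2) | p <- s]).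
rewrite -(cre_tens H hg)// hs {1}/comb (lin_sum (proj1 (bop_cre H hg))).
rewrite comb_cat /comb !big_map -big_split /=; apply: eq_bigr => p _.
rewrite (linZ (proj1 (bop_cre H hg))) {1}/rtens cre_tens//; last exact: (svalP p.2).
rewrite {1}gE tens_lin_head//; last exact: (svalP p.2).
by rewrite scalerDr scalerA.
Qed.

Lemma rtens_total : closure (Defs.span (range rtens)) = setT.
Proof.
apply: (closure_span_super (fock_dense H)); apply: span_comb_sub.
by move=> _ [gs hgs <-]; exact: tens_real_comb.
Qed.

Lemma bop_eq_rtens (V : hilbertType R) (S T : H -> V) : bop S -> bop T ->
  (forall w, S (rtens w) = T (rtens w)) -> S = T.
Proof.
move=> bS bT ST; apply: (bop_eq_total bS bT rtens_total) => _ [w _ <-]; exact: ST.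
Qed.

(** Solving [sc_wcons] for its longest word expresses the Wick product of h f w by S(h) and the Wick
    products of f w and w, so it never leaves an algebra containing the S(g) of the letters. *)
Lemma vN_rtens (N : set (H -> H)) : von_neumann_algebra N ->
  forall w : rword, (forall g, g \in sval w -> N (sc g)) ->
  exists2 X, N X & X (vacuum H) = rtens w.
Proof.
move=> vN; elim/rword_ind2 => [_|h hh hN|h hh f hf w ih ih' hN].
- by exists idfun; first exact: vN_id.
- exists (sc h); first by apply: hN; rewrite mem_head.
  by rewrite -rtens_wnil sc_wnil.
have [|X NX hX] := ih; first by move=> g gw; apply: hN; rewrite !inE gw !orbT.
have [|Y NY hY] := ih'; first by move=> g gw; apply: hN; rewrite inE gw orbT.
have Nh : N (sc h) by apply: hN; rewrite mem_head.
exists (fun x => (- L2C_dot (cpx f) (cpx h)) *: X x + (sc h \o Y) x).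
  by apply: vN_lin => //; exact: vN_comp.
by rewrite /= hX hY (sc_wcons hh) scaleNr addrC addrK.
Qed.

Lemma SC_rtens w : exists2 X, SC X & X (vacuum H) = rtens w.
Proof.
apply: vN_rtens => [|g gw]; first exact: SC_vN.
by apply: SC_sc; apply: (svalP w); exact: map_f.
Qed.

(** T lies in the commutant of the generators, and SC in their bicommutant. This is how the right
    semicircular operators are seen to commute with all of SC. *)
Lemma SC_commutes (T : H -> H) : bop T ->
  (forall h, L2C (cpx h) -> forall x, sc h (T x) = T (sc h x)) ->
  forall X x, SC X -> X (T x) = T (X x).
Proof.
move=> bT hT X x /(vN_generated_bicommutant (@bounded_fbm R H) (@star_fbm R H)) cX.
apply: (commutantP x cX); apply: commutantI => //.
by move=> _ y [t Dt <-]; rewrite -hT//; apply/L2C_cpxP; exact: RL2_itv.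
Qed.

End RealWords.

(** * Fock space as a model of the L^2 space, and the two multiplications there *)

Section L2Space.
Context {R : realType}.
Variables (H : fock_space R) (K : L2SC H).
Notation sc h := (semicircular h : H -> H).
Notation Om := (vacuum H).
Notation emb := (L2_emb K).

Lemma SC_bop (X : H -> H) : SC X -> bop X.
Proof. exact: (vN_bop (@SC_vN R H)). Qed.

Lemma emb_dot (X Y : H -> H) : SC X -> SC Y -> hdot (emb X) (emb Y) = hdot (X Om) (Y Om).
Proof.
move=> hX hY; rewrite L2_dot// /tau /= (dotC (adjoint Y _)).
by rewrite -(adjointP (SC_bop hY)) [RHS]dotC.
Qed.

Let SCt := {X : H -> H | SC X}.
Let svac (X : SCt) : H := (sval X) Om.

Lemma svac_total : closure (Defs.span (range svac)) = setT.
Proof.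
apply: (closure_span_super (rtens_total H)); apply: span_comb_sub.
move=> _ [w _ <-]; have [X hX <-] := SC_rtens H w.
by exists [:: (1, exist _ X hX)]; rewrite /comb big_seq1 scale1r.
Qed.

Lemma emb_total : closure (Defs.span (emb @` (@SC R H))) = setT.
Proof. by apply: (closure_span_super (L2_dense K)); exact: sub_span. Qed.

(** The inverse direction of X |-> X Om, from Fock space to [K]; it is determined because the
    vectors X Om include all real words and hence are total. *)
Definition kap : H -> K :=
  get [set T : H -> K | bop T /\ forall X : H -> H, SC X -> T (X Om) = emb X].

Lemma kapP : bop kap /\ forall X : H -> H, SC X -> kap (X Om) = emb X.
Proof.
apply: (@getPex _ [set T : H -> K | bop T /\ forall X : H -> H, SC X -> T (X Om) = emb X]).
have [|T bT hT] := @extension _ _ H K svac (fun X => emb (sval X)) _ ler01 svac_total.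
  move=> s; rewrite mul1r le_eqVlt; apply/orP; left; apply/eqP.
  rewrite /sqnorm; congr complex.Re; rewrite !dot_suml; apply: eq_bigr => p _.
  rewrite !dot_sumr; apply: eq_bigr => q _.
  by rewrite !dotZl !dotZr emb_dot//; exact: svalP.
by exists T; split=> // X hX; exact: (hT (exist _ X hX)).
Qed.

Lemma bop_kap : bop kap. Proof. exact: (proj1 kapP). Qed.

Lemma kap_emb X : SC X -> kap (X Om) = emb X. Proof. exact: (proj2 kapP). Qed.

Lemma kap_dot x y : hdot (kap x) (kap y) = hdot x y.
Proof.
apply: (isometry_total bop_kap svac_total) => -[X hX] [Y hY].
by rewrite /svac /= !kap_emb// emb_dot.
Qed.

Lemma sqnorm_kap x : sqnorm (kap x) = sqnorm x.
Proof. by rewrite /sqnorm kap_dot. Qed.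

Definition kapV : K -> H :=
  get [set T : K -> H | [/\ bop T, cancel kap T & cancel T kap]].

Lemma kapVP : [/\ bop kapV, cancel kap kapV & cancel kapV kap].
Proof.
apply: (@getPex _ [set T : K -> H | [/\ bop T, cancel kap T & cancel T kap]]).
have [T bT hT] := adjoint_exists bop_kap; exists T.
have TK : cancel kap T.
  move=> x; apply/eqP; rewrite -subr_eq0; apply/eqP/dot_eqP => y.
  by rewrite dotC dotBr -hT kap_dot subrr conjc0.
split=> // x.
have := bop_eq_total (bop_comp bop_kap bT) (bop_id K) emb_total.
move=> h; apply: (congr1 (@^~ x) (h _)) => _ [X hX <-] /=.
by rewrite -(kap_emb hX) TK.
Qed.

Lemma bop_kapV : bop kapV. Proof. by case: kapVP. Qed.
Lemma kapK : cancel kap kapV. Proof. by case: kapVP. Qed.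
Lemma kapVK : cancel kapV kap. Proof. by case: kapVP. Qed.

Definition kconj (T : H -> H) : K -> K := kap \o T \o kapV.

Lemma bop_kconj T : bop T -> bop (kconj T).
Proof.
by move=> bT; apply: bop_comp bop_kapV; apply: bop_comp bop_kap _.
Qed.

Lemma kconj_kap T x : kconj T (kap x) = kap (T x).
Proof. by rewrite /kconj /= kapK. Qed.

Lemma left_multE A : SC A -> left_mult A = kconj A.
Proof.
move=> hA; have bA := SC_bop hA.
have h1 : forall X, SC X -> kconj A (emb X) = emb (A \o X).
  move=> X hX; rewrite -(kap_emb hX) kconj_kap -[A (X Om)]/((A \o X) Om) kap_emb//.
  exact: (vN_comp (@SC_vN R H) hA hX).
have : [set T : K -> K | bounded_op T /\
    forall X, SC X -> T (emb X) = emb (A \o X)] (left_mult A).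
  by apply: getPex; exists (kconj A); split=> //; apply/bopP/bop_kconj.
move=> [/bopP b h].
apply: (bop_eq_total b (bop_kconj bA) emb_total) => _ [X hX <-].
by rewrite h// h1.
Qed.

(* [B'] acts on the vacuum as [B] and commutes with SC, so that X B Om = B' X Om:
   it implements right multiplication by B. *)
Definition right_rep (B B' : H -> H) : Prop :=
  [/\ bop B', forall X x, SC X -> X (B' x) = B' (X x) & B' Om = B Om].

Lemma right_multE B B' : SC B -> right_rep B B' -> right_mult B = kconj B'.
Proof.
move=> hB [bB cB oB].
have h1 : forall X, SC X -> kconj B' (emb X) = emb (X \o B).
  move=> X hX; rewrite -(kap_emb hX) kconj_kap -cB// oB -[X (B Om)]/((X \o B) Om).
  by rewrite kap_emb//; exact: (vN_comp (@SC_vN R H) hX hB).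
have : [set T : K -> K | bounded_op T /\
    forall X, SC X -> T (emb X) = emb (X \o B)] (right_mult B).
  by apply: getPex; exists (kconj B'); split=> //; apply/bopP/bop_kconj.
move=> [/bopP b h].
apply: (bop_eq_total b (bop_kconj bB) emb_total) => _ [X hX <-].
by rewrite h// h1.
Qed.

End L2Space.

(** * Conditional expectation as cutting the letters of words *)

Section ConditionalExpectation.
Context {R : realType}.
Variables (H : fock_space R) (K : L2SC H) (A : set R).
Notation mu := (@lebesgue_measure R).
Notation D := (@half_line R).
Notation sc h := (semicircular h : H -> H).
Notation Om := (vacuum H).
Notation emb := (L2_emb K).
Notation kap := (kap K).
Notation rtens := (rtens H).
Hypotheses (mA : measurable A) (AD : A `<=` D) (finA : (mu A < +oo)%E).

Definition cut (h : R -> R) : R -> R := fun t => \1_A t * h t.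

Lemma L2C_cpx_cut h : L2C (cpx h) -> L2C (cpx (cut h)).
Proof. by move=> /L2C_cpxP rh; apply/L2C_cpxP; exact: RL2_cut. Qed.

Lemma cut_word_subproof (w : rword) : L2C_seq (map cpx (map cut (sval w))).
Proof.
elim/(@rword_ind R): w => [//|h hh w ih]; apply/L2C_seq_cons; split=> //.
exact: L2C_cpx_cut.
Qed.

Definition cutw (w : rword) : rword :=
  exist (fun gs => L2C_seq (map cpx gs)) (map cut (sval w)) (@cut_word_subproof w).

Lemma rtens_eq (w w' : rword) : sval w = sval w' -> rtens w = rtens w'.
Proof. by rewrite /rtens => ->. Qed.

Lemma L2C_dot_cut g h : L2C_dot (cpx g) (cpx (cut h)) = L2C_dot (cpx (cut g)) (cpx h).
Proof.
rewrite !L2C_dotE; apply: eq_cint => t _; rewrite !conjc_real -!rmorphM.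
by rewrite /cut mulrCA mulrA.
Qed.

Lemma cutK h : cut (cut h) = cut h.
Proof.
apply/funext => t; rewrite /cut mulrA; congr (_ * _).
by rewrite indicE; case: (t \in A); rewrite ?mulr1 ?mulr0.
Qed.

(** Multiplication by the indicator of A is idempotent and self-adjoint, hence an orthogonal
    projection in each letter; this is the orthogonality behind [PA_rtens]. *)
Lemma gram_cut gs hs : L2C_seq (map cpx gs) -> L2C_seq (map cpx hs) ->
  fock_gram (map cpx gs) (map cpx (map cut hs)) =
  fock_gram (map cpx (map cut gs)) (map cpx (map cut hs)).
Proof.
elim: gs hs => [|g gs ih] [|h hs] //=.
move=> /L2C_seq_cons[hg hgs] /L2C_seq_cons[hh hhs].
by rewrite !fock_gram_cons ih// -[in LHS]cutK L2C_dot_cut.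
Qed.

Definition FA : set H := closure (Defs.span (range (fun w => rtens (cutw w)))).
Definition PA : H -> H := orth_proj FA.

Lemma subspace_FA : subspace FA.
Proof. by apply: subspace_closure; exact: subspace_span. Qed.

Lemma closed_FA : closure FA = FA. Proof. exact: closureK. Qed.

Lemma bop_PA : bop PA. Proof. exact: bop_orth_proj subspace_FA closed_FA. Qed.

Lemma FA_cutw w : FA (rtens (cutw w)).
Proof. by apply: subset_closure; apply: sub_span; exists w. Qed.

Lemma PA_rtens w : PA (rtens w) = rtens (cutw w).
Proof.
apply: (orth_proj_uniq subspace_FA); first exact: FA_cutw.
apply: dot_closure0; apply: dot_span0 => v; rewrite dotBl.
have hw := svalP w; have hv := svalP v; have hcw := svalP (cutw w); have hcv := svalP (cutw v).
by rewrite (fock_dot _ hw hcv) (fock_dot _ hcw hcv) /= (gram_cut hw hv) subrr.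
Qed.

Lemma PA_sc h : L2C (cpx h) -> cut h = h -> forall x, sc h (PA x) = PA (sc h x).
Proof.
move=> hh ch x.
have := bop_eq_rtens (bop_comp (bop_sc H hh) bop_PA) (bop_comp bop_PA (bop_sc H hh)).
move=> E; apply: (congr1 (@^~ x) (E _)) => w /=; rewrite PA_rtens.
elim/(@rword_ind R): w => [|f hf w _].
  have -> : rtens (cutw wnil) = rtens wnil by exact: rtens_eq.
  by rewrite (sc_wnil H hh) PA_rtens; apply: rtens_eq; rewrite /= ch.
rewrite (sc_wcons H hh) (linD (proj1 bop_PA)) (linZ (proj1 bop_PA)) !PA_rtens.
have hcf := L2C_cpx_cut hf.
rewrite (rtens_eq (w := cutw (wcons hf w)) (w' := wcons hcf (cutw w)))//.
rewrite (sc_wcons H hh) -L2C_dot_cut ch; congr (_ + _).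
by apply: rtens_eq; rewrite /= ch.
Qed.

Lemma cut_indic B : B `<=` A -> cut \1_B = \1_B.
Proof.
move=> BA; apply/funext => t; rewrite /cut; have [Bt|Bt] := pselect (B t).
  by rewrite indicT ?mul1r//; exact: BA.
by rewrite (indicF Bt) mulr0.
Qed.

Lemma SC_of_PA X : SC_of A X -> forall x, X (PA x) = PA (X x).
Proof.
move=> hX x; have R2 := RL2_subset mA AD finA.
have cX := vN_generated_bicommutant (bounded_SC_gen R2) (star_SC_gen R2) hX.
apply: (commutantP x cX); apply: commutantI; first exact: bop_PA.
move=> _ y [B [mB BA] <-]; rewrite PA_sc//; first by apply/L2C_cpxP; exact: R2.
exact: cut_indic.
Qed.

Lemma SC_of_vacuum X : SC_of A X -> FA (X Om).
Proof.
move=> hX; have -> : X Om = PA (X Om).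
  rewrite -SC_of_PA// -rtens_wnil PA_rtens; congr (X _); exact: rtens_eq.
by have [] := orth_projP subspace_FA closed_FA (X Om).
Qed.

(** The letters of a cut word vanish off A, so the Wick recursion stays inside the subalgebra. *)
Lemma cutw_SC_of w : exists2 X, SC_of A X & X Om = rtens (cutw w).
Proof.
apply: vN_rtens => [|g /mapP[h hw ->]]; first exact: SC_of_vN.
apply: SC_of_sc => //; last by move=> t _ nA; rewrite /cut indicF// mul0r.
by apply: L2C_cpx_cut; apply: (svalP w); exact: map_f.
Qed.

Lemma kap_FA x : FA x -> closure (emb @` SC_of A) (kap x).
Proof.
move=> /closure_sqnormP h; apply/closure_sqnormP => e e0.
have vN := SC_of_vN H mA AD finA.
have [_ /comb_span_memE[s ->] hs] := h _ e0.
have [X hX XE] : exists2 X, SC_of A X & X Om = comb (fun w => rtens (cutw w)) s.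
  elim: s {hs} => [|[c w] s [X hX hXE]].
    (* The zero operator, obtained as the combination -1 id + id. *)
    refine (ex_intro2 _ _ _ (vN_lin vN (-1) (vN_id vN) (vN_id vN)) _).
    by rewrite scaleN1r addNr /comb big_nil.
  have [Y hY YE] := cutw_SC_of w.
  refine (ex_intro2 _ _ _ (vN_lin vN c hY hX) _).
  by rewrite hXE YE /comb big_cons.
exists (emb X); first by exists X.
have SX : SC X by exact: (SC_of_SC mA AD finA hX).
rewrite -kap_emb// XE -(linB (proj1 (bop_kap K))) sqnorm_kap//.
Qed.

Lemma subspace_emb : subspace (emb @` SC_of A).
Proof.
have vN := SC_of_vN H mA AD finA.
have sub := @SC_of_SC R H A mA AD finA.
have z := vN_lin vN (-1) (vN_id vN) (vN_id vN).
split.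
  refine (ex_intro2 _ _ _ z _).
  rewrite -(kap_emb K (sub _ z)).
  by rewrite scaleN1r addNr (lin0 (proj1 (bop_kap K))).
move=> a _ _ [X hX <-] [Y hY <-].
have XY := vN_lin vN a hX hY; refine (ex_intro2 _ _ _ XY _).
rewrite -(kap_emb K (sub _ XY)) -(kap_emb K (sub _ hX)) -(kap_emb K (sub _ hY)).
by rewrite (proj1 (bop_kap K)).
Qed.

(** The image of [FA] and the closure of the subalgebra are compared in both directions: [kap_FA]
    puts the candidate in the closure, and [SC_of_vacuum] makes the remainder orthogonal to the
    subalgebra. *)
Lemma cond_expE : cond_exp A = kconj PA :> (K -> K).
Proof.
apply/funext => x; apply: orth_proj_uniq; first exact: subspace_closure subspace_emb.
  by apply: kap_FA; have [] := orth_projP subspace_FA closed_FA (kapV x).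
apply: dot_closure0 => _ [X hX <-].
rewrite -kap_emb; last exact: (SC_of_SC mA AD finA hX).
rewrite -[in X in hdot X _](kapVK x) kconj_kap -(linB (proj1 (bop_kap K))) kap_dot.
have [_] := orth_projP subspace_FA closed_FA (kapV x); apply.
exact: SC_of_vacuum.
Qed.

Lemma bop_cond_exp : bop (cond_exp A : K -> K).
Proof. by rewrite cond_expE; apply: bop_kconj; exact: bop_PA. Qed.

Lemma cond_exp_kap w : cond_exp A (kap (rtens w)) = kap (rtens (cutw w)).
Proof. by rewrite cond_expE kconj_kap PA_rtens. Qed.

End ConditionalExpectation.

(** * The gradient on Wick products *)

Section Gradient.
Context {R : realType}.
Variables (H : fock_space R) (K : L2SC H) (K2 : tensor_product K K).
Notation sc h := (semicircular h : H -> H).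
Notation Om := (vacuum H).
Notation emb := (L2_emb K).
Notation kap := (kap K).
Notation rtens := (rtens H).
Notation tens := (fock_tens H).
Notation tp := (tp K2).
Implicit Types u v : R -> K2.

(** Carries a witness that right multiplication by B is bounded. The witness is propagated along the
    algebra operations, starting from the right semicircular operators. *)
Definition right_bounded (B : H -> H) : Prop := SC B /\ exists B', right_rep B B'.

Lemma right_rep_id : right_rep (@idfun H) idfun.
Proof. by split=> //; exact: bop_id. Qed.

Lemma right_rep_sc h : L2C (cpx h) -> right_rep (sc h) (scr h).
Proof.
move=> hh; split; first exact: bop_scr.
  move=> X x hX; apply: (SC_commutes (bop_scr H hh)) => // g hg y.
  exact: sc_scr.
by rewrite scr_tens_nil// -sc_tens_nil.
Qed.

(** Right multiplications compose in reverse order: A B Om = A B' Om = B' A Om = B' A' Om, where A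
    commutes with B' because A is in SC. *)
Lemma right_rep_comp (A B A' B' : H -> H) : SC A ->
  right_rep A A' -> right_rep B B' -> right_rep (A \o B) (B' \o A').
Proof.
move=> hA [bA cA oA] [bB cB oB]; split; first exact: bop_comp.
  by move=> X x hX /=; rewrite cB// cA.
by rewrite /= oA -cB// oB.
Qed.

Lemma right_rep_lin a (A B A' B' : H -> H) : right_rep A A' -> right_rep B B' ->
  right_rep (fun x => a *: A x + B x) (fun x => a *: A' x + B' x).
Proof.
move=> [bA cA oA] [bB cB oB]; split; first exact: bop_lin.
  move=> X x hX; have [lX _] := SC_bop hX.
  by rewrite lX cA// cB.
by rewrite oA oB.
Qed.

Lemma right_bounded_id : right_bounded idfun.
Proof. by split; [exact: (vN_id (@SC_vN R H))|exists idfun; exact: right_rep_id]. Qed.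

Lemma right_bounded_sc h : L2C (cpx h) -> right_bounded (sc h).
Proof. by move=> hh; split; [exact: SC_sc|exists (scr h); exact: right_rep_sc]. Qed.

Lemma right_bounded_comp A B : right_bounded A -> right_bounded B -> right_bounded (A \o B).
Proof.
move=> [hA [A' rA]] [hB [B' rB]]; split; first exact: (vN_comp (@SC_vN R H)).
by exists (B' \o A'); exact: right_rep_comp.
Qed.

Lemma right_bounded_lin a A B : right_bounded A -> right_bounded B ->
  right_bounded (fun x => a *: A x + B x).
Proof.
move=> [hA [A' rA]] [hB [B' rB]]; split; first exact: (vN_lin (@SC_vN R H)).
by exists (fun x => a *: A' x + B' x); exact: right_rep_lin.
Qed.

Lemma kconj_id : kconj (@idfun H) = idfun :> (K -> K).
Proof. by apply/funext => x; rewrite /kconj /= kapVK. Qed.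

Lemma kconj_lin a A B : kconj (fun x : H => a *: A x + B x) =
  (fun x => a *: kconj A x + kconj B x) :> (K -> K).
Proof. by apply/funext => x; rewrite /kconj /= (proj1 (bop_kap K)). Qed.

Lemma kconj_comp (A B : H -> H) : kconj (A \o B) = kconj A \o kconj B :> (K -> K).
Proof. by apply/funext => x; rewrite /kconj /= kapK. Qed.

Lemma left_mult_id : left_mult idfun = idfun :> (K -> K).
Proof. by rewrite left_multE ?kconj_id//; exact: (vN_id (@SC_vN R H)). Qed.

Lemma right_mult_id : right_mult idfun = idfun :> (K -> K).
Proof.
by rewrite (right_multE K (vN_id (@SC_vN R H)) right_rep_id) kconj_id.
Qed.

Notation Lop A := (bimod A idfun : K2 -> K2).
Notation Rop B := (bimod idfun B : K2 -> K2).

Lemma LopP A : SC A -> bop (Lop A) /\ forall x y, Lop A (tp x y) = tp (kconj A x) y.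
Proof.
move=> hA; rewrite /bimod left_multE// right_mult_id.
by apply: tensor_opP; [apply: bop_kconj; exact: SC_bop|exact: bop_id].
Qed.

Lemma RopP B B' : SC B -> right_rep B B' ->
  bop (Rop B) /\ forall x y, Rop B (tp x y) = tp x (kconj B' y).
Proof.
move=> hB rB; rewrite /bimod left_mult_id (right_multE K hB rB).
by apply: tensor_opP; [exact: bop_id|apply: bop_kconj; case: rB].
Qed.

Lemma bop_Lop A : right_bounded A -> bop (Lop A).
Proof. by move=> [/LopP[]]. Qed.

Lemma bop_Rop B : right_bounded B -> bop (Rop B).
Proof. by move=> [hB [B' /(RopP hB)[]]]. Qed.

Lemma Lop_tp A x y : SC A -> Lop A (tp (kap x) y) = tp (kap (A x)) y.
Proof. by move=> /LopP[_ ->]; rewrite kconj_kap. Qed.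

Lemma bop_eq_tp (V : hilbertType R) (S T : K2 -> V) : bop S -> bop T ->
  (forall x y, S (tp x y) = T (tp x y)) -> S = T.
Proof.
by move=> bS bT h; apply: (bop_eq_total bS bT (tp_total K2)) => _ [[x y] _ <-]; exact: h.
Qed.

Lemma bimod_id : bimod (@idfun H) (@idfun H) = idfun :> (K2 -> K2).
Proof.
have [b h] := LopP (vN_id (@SC_vN R H)).
apply: (bop_eq_tp b (bop_id _)) => x y.
by rewrite h kconj_id.
Qed.

Lemma Lop_comp A B x : right_bounded A -> right_bounded B ->
  Lop (A \o B) x = Lop A (Lop B x).
Proof.
move=> rA rB; have [hA _] := rA; have [hB _] := rB.
have [b h] := LopP (proj1 (right_bounded_comp rA rB)).
have [bA eA] := LopP hA; have [bB eB] := LopP hB.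
apply: (congr1 (@^~ x) (bop_eq_tp b (bop_comp bA bB) _)) => u v /=.
by rewrite h eB eA kconj_comp.
Qed.

Lemma Rop_comp A B x : right_bounded A -> right_bounded B ->
  Rop (A \o B) x = Rop B (Rop A x).
Proof.
move=> [hA [A' rA]] [hB [B' rB]].
have [b h] := RopP (vN_comp (@SC_vN R H) hA hB) (right_rep_comp hA rA rB).
have [bA eA] := RopP hA rA; have [bB eB] := RopP hB rB.
apply: (congr1 (@^~ x) (bop_eq_tp b (bop_comp bB bA) _)) => u v /=.
by rewrite h eA eB kconj_comp.
Qed.

Lemma Lop_Rop A B x : right_bounded A -> right_bounded B ->
  Lop A (Rop B x) = Rop B (Lop A x).
Proof.
move=> [hA _] [hB [B' rB]]; have [bA eA] := LopP hA; have [bB eB] := RopP hB rB.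
apply: (congr1 (@^~ x) (bop_eq_tp (bop_comp bA bB) (bop_comp bB bA) _)) => u v /=.
by rewrite eB eA eA eB.
Qed.

Lemma Lop_lin a A B x : right_bounded A -> right_bounded B ->
  Lop (fun x => a *: A x + B x) x = a *: Lop A x + Lop B x.
Proof.
move=> rA rB; have [hA _] := rA; have [hB _] := rB.
have [b h] := LopP (proj1 (right_bounded_lin a rA rB)).
have [bA eA] := LopP hA; have [bB eB] := LopP hB.
apply: (congr1 (@^~ x) (bop_eq_tp b (bop_lin a bA bB) _)) => u v /=.
by rewrite h eA eB kconj_lin tpPl.
Qed.

Lemma malliavin_right_bounded A u : malliavin_alg A u -> right_bounded A.
Proof.
elim=> *; [exact: right_bounded_id|exact: right_bounded_sc|exact: right_bounded_lin|].
exact: right_bounded_comp.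
Qed.

Definition kw (gs : seq (R -> R)) : K := kap (tens (map cpx gs)).

(* The gradient of the Wick product W(g_1 .. g_n):
   sum over k of g_k(t) W(g_1 .. g_(k-1)) (x) W(g_(k+1) .. g_n). *)
Definition wick_grad (gs : seq (R -> R)) (t : R) : K2 :=
  \sum_(i < size gs) (nth (fun=> 0) gs i t)%:C *:
     tp (kw (take i gs)) (kw (drop i.+1 gs)).

Lemma wick_grad_nil t : wick_grad [::] t = 0.
Proof. by rewrite /wick_grad big_ord0. Qed.

Lemma wick_grad_cons g gs t : wick_grad (g :: gs) t =
  (g t)%:C *: tp (kw [::]) (kw gs) +
  \sum_(i < size gs) (nth (fun=> 0) gs i t)%:C *:
     tp (kw (g :: take i gs)) (kw (drop i.+1 gs)).
Proof. by rewrite /wick_grad /= big_ord_recl /= drop0. Qed.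

Lemma L2C_seq_take n (gs : seq (R -> R)) : L2C_seq (map cpx gs) -> L2C_seq (map cpx (take n gs)).
Proof. by move=> h x; rewrite map_take => /mem_take; exact: h. Qed.

Lemma L2C_seq_drop n (gs : seq (R -> R)) : L2C_seq (map cpx gs) -> L2C_seq (map cpx (drop n gs)).
Proof. by move=> h x; rewrite map_drop => /mem_drop; exact: h. Qed.

Lemma emb_id : emb idfun = kw [::].
Proof. by rewrite -kap_emb//; exact: (vN_id (@SC_vN R H)). Qed.

Lemma Lop_wick_nil h t : L2C (cpx h) ->
  Lop (sc h) (wick_grad [::] t) + (h t)%:C *: tp (kw [::]) (kw [::]) = wick_grad [:: h] t.
Proof.
move=> hh; rewrite wick_grad_nil (lin0 (proj1 (bop_Lop (right_bounded_sc hh)))).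
by rewrite wick_grad_cons /= big_ord0 add0r addr0.
Qed.

(** The recursion [sc_wcons] at the level of gradients. The term at f has an empty left factor, on
    which S(h) only creates; in the other terms the left factor begins with f, which S(h) may also
    annihilate, and these contributions add up to <f, h> times the gradient for gs. *)
Lemma Lop_wick_cons h f gs t : L2C (cpx h) -> L2C_seq (map cpx (f :: gs)) ->
  Lop (sc h) (wick_grad (f :: gs) t) + (h t)%:C *: tp (kw [::]) (kw (f :: gs)) =
  wick_grad (h :: f :: gs) t + L2C_dot (cpx f) (cpx h) *: wick_grad gs t.
Proof.
move=> hh /L2C_seq_cons[hf hgs].
have lL := proj1 (bop_Lop (right_bounded_sc hh)); have Sh : SC (sc h) by exact: SC_sc.
rewrite 2!wick_grad_cons (linD lL) (linZ lL) Lop_tp//.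
rewrite [sc h _]sc_tens_nil// -[kap (tens [:: cpx h])]/(kw [:: h]).
rewrite addrC -!addrA; congr (_ + _); rewrite /= big_ord_recl /= drop0.
rewrite -addrA; congr (_ + _).
rewrite (lin_sum lL) /wick_grad scaler_sumr -big_split /=; apply: eq_bigr => i _.
rewrite (linZ lL) Lop_tp// sc_tens_cons//; last exact: L2C_seq_take.
rewrite (linD (proj1 (bop_kap K))) (linZ (proj1 (bop_kap K))).
rewrite (linD (tp_linl K2 _)) (linZ (tp_linl K2 _)) scalerDr; congr (_ + _).
by rewrite !scalerA mulrC.
Qed.

Definition gradW (s : seq (R[i] * rword)) (t : R) : K2 :=
  comb (fun w : rword => wick_grad (sval w) t) s.

Lemma comb_cons I (V : hilbertType R) (f : I -> V) c w s :
  comb f ((c, w) :: s) = c *: f w + comb f s.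
Proof. by rewrite /comb big_cons. Qed.

(** One list [s] must expand the product and its gradient simultaneously. The left side of the
    second equation is the product rule for S(h) W(w), since 1 (x) 1 acted on from the right by W(w)
    is 1 (x) W(w). *)
Lemma sc_wick_step h (hh : L2C (cpx h)) (w : rword) :
  exists s, sc h (rtens w) = comb rtens s /\
    forall t, Lop (sc h) (wick_grad (sval w) t) + (h t)%:C *: tp (kw [::]) (kap (rtens w))
      = gradW s t.
Proof.
elim/(@rword_ind R): w => [|f hf w _].
  exists [:: (1, wcons hh (@wnil R))]; split.
    by rewrite /comb big_seq1 scale1r (sc_wnil H hh).
  by move=> t; rewrite /gradW /comb big_seq1 scale1r -Lop_wick_nil.
exists [:: (1, wcons hh (wcons hf w)); (L2C_dot (cpx f) (cpx h), w)]; split.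
  by rewrite /comb big_cons big_seq1 scale1r (sc_wcons H hh).
move=> t; rewrite /gradW /comb big_cons big_seq1 scale1r -Lop_wick_cons//.
exact: (svalP (wcons hf w)).
Qed.

Lemma sc_wick_steps h (hh : L2C (cpx h)) s :
  exists s', sc h (comb rtens s) = comb rtens s' /\
    forall t, Lop (sc h) (gradW s t) + (h t)%:C *: tp (kw [::]) (kap (comb rtens s))
      = gradW s' t.
Proof.
have ls := proj1 (bop_sc H hh); have lk := proj1 (bop_kap K).
have lL := proj1 (bop_Lop (right_bounded_sc hh)).
elim: s => [|[c w] s [s' [e' g']]].
  exists [::]; split; first by rewrite /comb !big_nil (lin0 ls).
  move=> t; rewrite /gradW /comb !big_nil (lin0 lL) (lin0 lk) (lin0 (tp_linr K2 _)).
  by rewrite scaler0 addr0.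
have [sw [ew gw]] := sc_wick_step hh w.
exists (cscale c sw ++ s'); split.
  by rewrite comb_cons (linD ls) (linZ ls) comb_cat comb_cscale ew e'.
move=> t; rewrite /gradW comb_cat comb_cscale -/(gradW sw t) -/(gradW s' t) -gw -g'.
rewrite /gradW !comb_cons (linD lL) (linZ lL).
rewrite (linD lk) (linZ lk) (linD (tp_linr K2 _)) (linZ (tp_linr K2 _)).
rewrite !scalerDr !scalerA (mulrC (h t)%:C) -!addrA; congr (_ + _).
by rewrite addrCA.
Qed.

Definition wick_pair (A : H -> H) (u : R -> K2) : Prop :=
  malliavin_alg A u /\
  exists s, A Om = comb rtens s /\ forall t, u t = gradW s t.

(* Quantifying over right factors B that are already in Wick form reduces the product
   rule to the associativity of the bimodule action. *)
Lemma malliavin_wick_mul A u : malliavin_alg A u -> forall B v, wick_pair B v ->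
  wick_pair (A \o B) (fun t => Lop A (v t) + Rop B (u t)).
Proof.
move=> hAu; elim: hAu => {A u} [|h hh|a A A' u u' hA ihA hA' ihA'|A A' u u' hA ihA hA' ihA']
    B v [hB [s [sB gB]]]; (split; first by apply: malliavin_mul hB; constructor).
- exists s; split=> // t; rewrite bimod_id gB.
  by rewrite (lin0 (proj1 (bop_Rop (malliavin_right_bounded hB)))) addr0.
- have [s' [e' g']] := sc_wick_steps hh s.
  exists s'; split; first by rewrite /= sB e'.
  move=> t; rewrite -g' -gB; congr (_ + _).
  have [hB0 [B' rB]] := malliavin_right_bounded hB; have [bR eR] := RopP hB0 rB.
  rewrite (linZ (proj1 bR)) eR emb_id kconj_kap; congr (_ *: tp _ (kap _)).
  by have [_ _ ->] := rB.
- have [_ [s1 [e1 g1]]] := ihA _ _ (conj hB (ex_intro _ s (conj sB gB))).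
  have [_ [s2 [e2 g2]]] := ihA' _ _ (conj hB (ex_intro _ s (conj sB gB))).
  exists (cscale a s1 ++ s2); split.
    by rewrite comb_cat comb_cscale -e1 -e2.
  move=> t; rewrite /gradW comb_cat comb_cscale -/(gradW s1 t) -/(gradW s2 t) -g1 -g2.
  have lR := proj1 (bop_Rop (malliavin_right_bounded hB)).
  rewrite (linD lR) (linZ lR).
  rewrite (Lop_lin _ _ (malliavin_right_bounded hA) (malliavin_right_bounded hA')).
  by rewrite scalerDr addrACA.
have [hAB [s1 [e1 g1]]] := ihA _ _ (ihA' _ _ (conj hB (ex_intro _ s (conj sB gB)))).
exists s1; split=> // t; rewrite -g1.
have rA := malliavin_right_bounded hA; have rA' := malliavin_right_bounded hA'.
have rB := malliavin_right_bounded hB.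
have lR := proj1 (bop_Rop rB); have lL := proj1 (bop_Lop rA).
by rewrite (linD lL) (linD lR) Lop_comp// Rop_comp// Lop_Rop// addrA.
Qed.

(** The unit serves as right factor in [malliavin_wick_mul], its gradient being 0. From here on a
    derivation of a gradient matters only through its Wick expansion. *)
Lemma malliavin_wick A u : malliavin_alg A u ->
  exists s, A Om = comb rtens s /\ forall t, u t = gradW s t.
Proof.
move=> hA; have [] := @malliavin_wick_mul A u hA idfun (fun=> 0).
  split; first exact: malliavin_one.
  exists [:: (1, @wnil R)]; split; first by rewrite /comb big_seq1 scale1r.
  by move=> t; rewrite /gradW /comb big_seq1 scale1r wick_grad_nil.
move=> _ [s [e g]]; exists s; split=> // t; rewrite -g bimod_id.
by rewrite (lin0 (proj1 (bop_Lop (malliavin_right_bounded hA)))) add0r.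
Qed.

(** Subtracting the annihilation term from S(h) W(f w) leaves W(h f w); by [Lop_wick_cons] the same
    subtraction leaves its gradient. *)
Lemma wick_word (w : rword) : exists2 B, malliavin_alg B (wick_grad (sval w)) &
  B Om = rtens w.
Proof.
elim/(@rword_ind2 R): w => [|h hh|h hh f hf w [B mB oB] [C mC oC]].
- exists idfun => //; have := malliavin_one K2.
  by congr malliavin_alg; apply/funext => t; rewrite wick_grad_nil.
- exists (sc h); last by rewrite -rtens_wnil (sc_wnil H hh).
  have := malliavin_S K2 hh; congr malliavin_alg; apply/funext => t.
  by rewrite /= wick_grad_cons big_ord0 addr0 emb_id.
exists (fun x => - L2C_dot (cpx f) (cpx h) *: B x + (sc h \o C) x); last first.
  by rewrite /= oB oC (sc_wcons H hh) scaleNr addrC addrK.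
have := malliavin_lin (- L2C_dot (cpx f) (cpx h)) mB (malliavin_mul (malliavin_S K2 hh) mC).
congr malliavin_alg; apply/funext => t.
have [hC [C' rC]] := malliavin_right_bounded mC; have [bR eR] := RopP hC rC.
rewrite (linZ (proj1 bR)) eR emb_id kconj_kap.
have -> : C' (tens (map cpx [::])) = tens (map cpx (f :: sval w)).
  by have [_ _ E] := rC; rewrite [LHS]E oC.
rewrite -/(kw _) Lop_wick_cons//; last exact: (svalP (wcons hf w)).
by rewrite scaleNr addrC addrK.
Qed.

Lemma wick_comb s : exists2 B, malliavin_alg B (gradW s) & B Om = comb rtens s.
Proof.
elim: s => [|[c w] s [B mB oB]].
  exists (fun x => -1 *: idfun x + idfun x); last first.
    by rewrite scaleN1r addNr /comb big_nil.
  have := malliavin_lin (-1) (malliavin_one K2) (malliavin_one K2).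
  congr malliavin_alg; apply/funext => t.
  by rewrite scaler0 addr0 /gradW /comb big_nil.
have [C mC oC] := wick_word w.
exists (fun x => c *: C x + B x); last by rewrite oB oC /comb big_cons.
have := malliavin_lin c mC mB; congr malliavin_alg; apply/funext => t.
by rewrite /gradW /comb big_cons.
Qed.

Lemma malliavin_SC A u : malliavin_alg A u -> SC A.
Proof. by case/malliavin_right_bounded. Qed.

Section ConditionalExpectationGradient.
Variable A : set R.
Hypotheses (mA : measurable A) (AD : A `<=` @half_line R)
  (finA : (lebesgue_measure A < +oo)%E).

Notation E2 := (cond_exp2 A : K2 -> K2).

Lemma cond_exp2P : bop E2 /\ forall x y, E2 (tp x y) = tp (cond_exp A x) (cond_exp A y).
Proof. by apply: tensor_opP; exact: bop_cond_exp. Qed.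

Lemma cond_exp_kw gs : L2C_seq (map cpx gs) ->
  cond_exp A (kw gs) = kw (map (cut A) gs).
Proof.
by move=> hgs; have := cond_exp_kap K mA AD finA (exist (fun gs => L2C_seq (map cpx gs)) gs hgs).
Qed.

(** In the k-th term, cutting the letter evaluated at t produces the indicator of A at t, while
    cutting the letters before and after it is the conditional expectation on the two tensor
    factors. *)
Lemma wick_grad_cut gs t : L2C_seq (map cpx gs) ->
  wick_grad (map (cut A) gs) t = (\1_A t : R)%:C *: E2 (wick_grad gs t).
Proof.
move=> hgs; have [[lE _] eE] := cond_exp2P.
rewrite /wick_grad size_map (lin_sum lE) scaler_sumr; apply: eq_bigr => i _.
rewrite (linZ lE) eE !cond_exp_kw; [|exact: L2C_seq_drop|exact: L2C_seq_take].
by rewrite map_take map_drop (nth_map (fun=> 0))// scalerA -rmorphM.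
Qed.

(** Cutting every word in the Wick expansion of B gives an element of the algebra again, so
    conditional expectation can be applied to approximating sequences without leaving it. *)
Lemma malliavin_cond_exp B u : malliavin_alg B u ->
  exists2 C, malliavin_alg C (fun t => (\1_A t : R)%:C *: E2 (u t)) &
    emb C = cond_exp A (emb B).
Proof.
move=> mB; have [s [e g]] := malliavin_wick mB.
have [C mC oC] := wick_comb [seq (p.1, cutw mA p.2) | p <- s].
have [[lE _] eE] := cond_exp2P.
exists C.
  move: mC; congr malliavin_alg; apply/funext => t.
  rewrite g /gradW /comb big_map (lin_sum lE) scaler_sumr; apply: eq_bigr => p _ /=.
  rewrite wick_grad_cut ?(linZ lE) ?scalerA 1?mulrC//; exact: (svalP p.2).
have lk := proj1 (bop_kap K); have lc := proj1 (bop_cond_exp K mA AD finA).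
rewrite -(kap_emb K (malliavin_SC mC)) -(kap_emb K (malliavin_SC mB)) oC e.
rewrite /comb big_map (lin_sum lk) (lin_sum lk) (lin_sum lc).
by apply: eq_bigr => p _; rewrite /= !(linZ lk) (linZ lc) cond_exp_kap.
Qed.

End ConditionalExpectationGradient.
End Gradient.

(** * Bochner square integrable functions *)

Section Bochner.
Context {R : realType}.
Implicit Types (V : hilbertType R).

Notation mu := (@lebesgue_measure R).
Notation D := (@half_line R).
Local Notation mD := (@measurable_half_line R).

(** Lists in place of finite families, for induction and concatenation. *)
Definition seq_step V (l : seq (set R * V)) (t : R) : V :=
  \sum_(p <- l) (\1_(p.1) t : R)%:C *: p.2.

Lemma step_funP V (s : R -> V) : step_fun s <->
  exists2 l : seq (set R * V), (forall p, List.In p l -> measurable p.1) & s = seq_step l.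
Proof.
split=> [[n [B [v [mB ->]]]]|[l ml ->]].
  exists [seq (B i, v i) | i <- enum 'I_n].
    by move=> p /List.in_map_iff[i [<- _]] /=.
  by apply/funext => t; rewrite /seq_step big_map big_enum.
exists (size l), (fun i => (tnth (in_tuple l) i).1), (fun i => (tnth (in_tuple l) i).2).
split; last by apply/funext => t; rewrite /seq_step big_tnth.
move=> i; apply: ml; rewrite (tnth_nth (set0, 0)) /=.
case: i => i /=; elim: l i => [//|p l ih].
by case=> [|i] /= il; [left|right; exact: ih].
Qed.

Lemma seq_step_cons V p (l : seq (set R * V)) t :
  seq_step (p :: l) t = (\1_(p.1) t : R)%:C *: p.2 + seq_step l t.
Proof. by rewrite /seq_step big_cons. Qed.

Lemma seq_step_cat V (l l' : seq (set R * V)) t :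
  seq_step (l ++ l') t = seq_step l t + seq_step l' t.
Proof. by rewrite /seq_step big_cat. Qed.

Lemma strongly_measurableD V (u v : R -> V) :
  strongly_measurable u -> strongly_measurable v ->
  strongly_measurable (fun t => u t + v t).
Proof.
move=> [s [ss su]] [s' [ss' sv]]; exists (fun n t => s n t + s' n t); split.
  move=> n; have /step_funP[l ml ->] := ss n; have /step_funP[l' ml' ->] := ss' n.
  apply/step_funP; exists (l ++ l').
    by move=> p /List.in_app_iff[]; [exact: ml|exact: ml'].
  by apply/funext => t; rewrite seq_step_cat.
by move=> t Dt; apply: cvgD; [exact: su|exact: sv].
Qed.

Lemma strongly_measurable_bop V (W : hilbertType R) (T : V -> W) (u : R -> V) : bop T ->
  strongly_measurable u -> strongly_measurable (T \o u).
Proof.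
move=> bT [s [ss su]]; have lT := proj1 bT; exists (fun n => T \o s n); split.
  move=> n; have /step_funP[l ml ->] := ss n; apply/step_funP.
  exists [seq (p.1, T p.2) | p <- l].
    by move=> p /List.in_map_iff[q [<- ql]]; exact: (ml q).
  apply/funext => t; rewrite /seq_step /= big_map (lin_sum lT).
  by apply: eq_bigr => p _; rewrite (linZ lT).
by move=> t Dt; apply: bop_cvg => //; exact: su.
Qed.

Lemma bop_scale V (a : R[i]) : bop (fun x : V => a *: x).
Proof.
have := bop_lin a (bop_id V) (bop_zero V V).
by congr bop; apply/funext => x; rewrite addr0.
Qed.

Lemma strongly_measurable_cut V A (u : R -> V) : measurable A ->
  strongly_measurable u -> strongly_measurable (fun t => (\1_A t : R)%:C *: u t).
Proof.
move=> mA [s [ss su]]; exists (fun n t => (\1_A t : R)%:C *: s n t); split.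
  move=> n; have /step_funP[l ml ->] := ss n; apply/step_funP.
  exists [seq (A `&` p.1, p.2) | p <- l].
    by move=> p /List.in_map_iff[q [<- /ml mq]] /=; exact: measurableI.
  apply/funext => t; rewrite /seq_step /= big_map scaler_sumr.
  by apply: eq_bigr => p _; rewrite scalerA -rmorphM indicI.
by move=> t Dt; apply: (bop_cvg (bop_scale V _)); exact: su.
Qed.

Lemma strongly_measurable_ge0 V (h : R -> R) (x : V) : measurable_fun D h ->
  (forall t, D t -> 0 <= h t) -> strongly_measurable (fun t => (h t)%:C *: x).
Proof.
move=> mh h0.
have mEh : @measurable_fun _ _ (measurableTypeR R) _ D (EFin \o h).
  by apply/measurable_EFinP.
have Eh0 t : D t -> (0 <= (EFin \o h) t)%E by move=> Dt; rewrite lee_fin h0.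
pose s n := nnsfun_approx mD mEh n.
have s_cvg t : D t -> s n t @[n --> \oo] --> h t.
  by move=> Dt; have /fine_cvgP[_] := cvg_nnsfun_approx mD mEh Eh0 Dt.
exists (fun n t => (s n t)%:C *: x); split.
  move=> n; apply/step_funP.
  exists [seq (s n @^-1` [set y], y%:C *: x) | y <- finmap.enum_fset (fset_set (range (s n)))].
    move=> p /List.in_map_iff[y [<- _]] /=.
    exact: (@measurable_sfunP _ _ (measurableTypeR R) R (s n)).
  apply/funext => t; rewrite /seq_step big_map [in LHS](fimfunE (s n) t) (fsbig_finite _ _ _) //=.
  rewrite rmorph_sum scaler_suml; apply: eq_bigr => y _.
  by rewrite scalerA -rmorphM mulrC.
move=> t Dt; apply/cvg_sqnormP => e e0.
have M0 : 0 < sqnorm x + 1 by rewrite ltr_wpDl ?sqnorm_ge0.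
pose d := Num.sqrt (e / (sqnorm x + 1)).
have d0 : 0 < d by rewrite sqrtr_gt0 divr_gt0.
have /cvgrPdist_lt/(_ d d0)[N _ hN] := s_cvg t Dt.
exists N => n Nn; rewrite -scalerBl -rmorphB nsq_sqnormZ /nsq /= expr0n /= addr0.
have : (h t - s n t) ^+ 2 < e / (sqnorm x + 1).
  rewrite -real_normK ?num_real// -[X in _ < X](@sqr_sqrtr _ (e / (sqnorm x + 1))).
    by rewrite ltr_sqr ?nnegrE ?sqrtr_ge0//; exact: (hN n Nn).
  by rewrite divr_ge0// ltW.
rewrite ltr_pdivlMr//; apply: le_lt_trans.
by rewrite ler_wpM2l ?sqr_ge0//; lra.
Qed.

Lemma strongly_measurable_scale V (h : R -> R) (x : V) : measurable_fun D h ->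
  strongly_measurable (fun t => (h t)%:C *: x).
Proof.
move=> mh.
have mp : measurable_fun D (fun t => Num.max (h t) 0).
  by apply: measurable_maxr => //; exact: measurable_cst.
have mm : measurable_fun D (fun t => Num.max (- h t) 0).
  by apply: measurable_maxr; [exact: measurable_funN|exact: measurable_cst].
have p := @strongly_measurable_ge0 _ _ x mp (fun t _ => ltac:(by rewrite le_max lexx orbT)).
have m := @strongly_measurable_ge0 _ _ x mm (fun t _ => ltac:(by rewrite le_max lexx orbT)).
have := strongly_measurableD p (strongly_measurable_bop (bop_scale V (-1)) m).
congr strongly_measurable; apply/funext => t /=.
rewrite scaleN1r -scalerBl -rmorphB; congr (_%:C *: _).
by rewrite /Num.max; case: (ltP (h t) 0) => h1; case: (ltP (- h t) 0) => h2; lra.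
Qed.

Lemma strongly_measurable0 V : strongly_measurable (fun _ : R => 0 : V).
Proof.
have := @strongly_measurable_scale V (fun=> 0) 0 (measurable_cst _).
by congr strongly_measurable; apply/funext => t; rewrite scaler0.
Qed.

Lemma strongly_measurable_sum V I (r : seq I) (u : I -> R -> V) :
  (forall i, strongly_measurable (u i)) ->
  strongly_measurable (fun t => \sum_(i <- r) u i t).
Proof.
move=> hu; elim: r => [|i r ih].
  have := strongly_measurable0 V; congr strongly_measurable.
  by apply/funext => t; rewrite big_nil.
have := strongly_measurableD (hu i) ih; congr strongly_measurable.
by apply/funext => t; rewrite big_cons.
Qed.

Lemma nsq_dot_cvg V (u : nat -> V) l x : u n @[n --> \oo] --> l ->
  complex.Re (hdot (u n) x) @[n --> \oo] --> complex.Re (hdot l x) /\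
  complex.Im (hdot (u n) x) @[n --> \oo] --> complex.Im (hdot l x).
Proof.
move=> /cvg_sqnormP ul.
have aux (e : R) : 0 < e -> exists N, forall n, (N <= n)%N ->
    nsq (hdot l x - hdot (u n) x) < e ^+ 2.
  move=> e0; have M0 : 0 < sqnorm x + 1 by rewrite ltr_wpDl ?sqnorm_ge0.
  have [N hN] := ul (e ^+ 2 / (sqnorm x + 1)) (divr_gt0 (exprn_gt0 2 e0) M0).
  exists N => n /hN; rewrite ltr_pdivlMr// -dotBl; apply: le_lt_trans.
  apply: le_trans (CauchySchwarz_sqnorm _ _) _.
  by rewrite ler_wpM2l ?sqnorm_ge0//; lra.
split; apply/cvgrPdist_lt => e e0; have [N hN] := aux e e0; exists N => // n /= /hN.
  rewrite /nsq !(cReD, cReN, cImD, cImN) => h.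
  rewrite -ltr_sqr ?nnegrE ?(ltW e0)// real_normK ?num_real//.
  by apply: le_lt_trans h; rewrite lerDl sqr_ge0.
rewrite /nsq !(cReD, cReN, cImD, cImN) => h.
rewrite -ltr_sqr ?nnegrE ?(ltW e0)// real_normK ?num_real//.
by apply: le_lt_trans h; rewrite lerDr sqr_ge0.
Qed.

Lemma sqnorm_cvg V (u : nat -> V) l : u n @[n --> \oo] --> l ->
  sqnorm (u n) @[n --> \oo] --> sqnorm l.
Proof.
move=> ul; have [h _] := nsq_dot_cvg l ul.
have h0 : sqnorm (u n - l) @[n --> \oo] --> (0 : R).
  apply/cvgrPdist_lt => e e0; have /cvg_sqnormP/(_ e e0)[N hN] := ul.
  exists N => // n /= /hN; rewrite sub0r normrN ger0_norm ?sqnorm_ge0//.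
  by rewrite sqnormBC.
have -> : (fun n => sqnorm (u n)) =
    (fun n => sqnorm (u n - l) - sqnorm l + 2 * complex.Re (hdot (u n) l)).
  by apply/funext => n; rewrite sqnormB; ring.
have c1 : (fun=> sqnorm l) n @[n --> \oo] --> sqnorm l by exact: cvg_cst.
have c2 : (fun=> 2 : R) n @[n --> \oo] --> (2 : R) by exact: cvg_cst.
have L := cvgD (cvgB h0 c1) (cvgM c2 h); rewrite -/(sqnorm l) in L.
have E : 0 - sqnorm l + 2 * sqnorm l = sqnorm l by ring.
rewrite E in L; exact: L.
Qed.

Lemma seq_step_dot_measurable V (l : seq (set R * V)) x :
  (forall p, List.In p l -> measurable p.1) ->
  measurable_fun D (fun t => complex.Re (hdot (seq_step l t) x)) /\
  measurable_fun D (fun t => complex.Im (hdot (seq_step l t) x)).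
Proof.
elim: l => [|p l ih] ml.
  split; rewrite (_ : (fun _ => _) = cst 0); try exact: measurable_cst;
  by apply/funext => t; rewrite /seq_step big_nil dot0l.
have [ir ii] : measurable_fun D (fun t => complex.Re (hdot (seq_step l t) x)) /\
  measurable_fun D (fun t => complex.Im (hdot (seq_step l t) x)).
  by apply: ih => q ql; apply: ml; right.
have mp : measurable p.1 by apply: ml; left.
split.
  rewrite (_ : (fun _ => _) = (fun t => \1_(p.1) t * complex.Re (hdot p.2 x) +
      complex.Re (hdot (seq_step l t) x))).
    apply: measurable_funD => //; apply: measurable_funM; last exact: measurable_cst.
    exact: measurable_indic.
  by apply/funext => t; rewrite seq_step_cons dotDl dotZl cReD cReZ.
rewrite (_ : (fun _ => _) = (fun t => \1_(p.1) t * complex.Im (hdot p.2 x) +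
    complex.Im (hdot (seq_step l t) x))).
  apply: measurable_funD => //; apply: measurable_funM; last exact: measurable_cst.
  exact: measurable_indic.
by apply/funext => t; rewrite seq_step_cons dotDl dotZl cImD cImZ.
Qed.

Lemma seq_step_sqnorm_measurable V (l : seq (set R * V)) :
  (forall p, List.In p l -> measurable p.1) ->
  measurable_fun D (fun t => sqnorm (seq_step l t)).
Proof.
elim: l => [|p l ih] ml.
  rewrite (_ : (fun _ => _) = cst 0); first exact: measurable_cst.
  by apply/funext => t; rewrite /seq_step big_nil sqnorm0.
have ml' q : List.In q l -> measurable q.1 by move=> ql; apply: ml; right.
have mp : measurable_fun D (\1_(p.1) : R -> R).
  by apply: measurable_indic; apply: ml; left.
have [mr _] := seq_step_dot_measurable p.2 ml'.
rewrite (_ : (fun _ => _) = (fun t => \1_(p.1) t * \1_(p.1) t * sqnorm p.2 +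
    sqnorm (seq_step l t) + 2 * (\1_(p.1) t * complex.Re (hdot (seq_step l t) p.2)))).
  apply: measurable_funD; last by apply: measurable_funM => //; exact: measurable_funM.
  apply: measurable_funD; last exact: ih.
  by apply: measurable_funM => //; exact: measurable_funM.
apply/funext => t; rewrite seq_step_cons sqnormD nsq_sqnormZ dotZl cReZ.
by rewrite (dotC p.2) cReJ /nsq /= expr0n /= addr0 expr2.
Qed.

Lemma dot_measurable V (u : R -> V) x : strongly_measurable u ->
  measurable_fun D (fun t => complex.Re (hdot (u t) x)) /\
  measurable_fun D (fun t => complex.Im (hdot (u t) x)).
Proof.
move=> [s [ss su]].
split; [apply: (@measurable_fun_cvg _ _ _ D (fun n t => complex.Re (hdot (s n t) x)))|
        apply: (@measurable_fun_cvg _ _ _ D (fun n t => complex.Im (hdot (s n t) x)))].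
- by move=> n; have /step_funP[l ml ->] := ss n; have [] := seq_step_dot_measurable x ml.
- by move=> t Dt; have [] := nsq_dot_cvg x (su t Dt).
- by move=> n; have /step_funP[l ml ->] := ss n; have [] := seq_step_dot_measurable x ml.
- by move=> t Dt; have [] := nsq_dot_cvg x (su t Dt).
Qed.

Lemma sqnorm_measurable V (u : R -> V) : strongly_measurable u ->
  measurable_fun D (fun t => sqnorm (u t)).
Proof.
move=> [s [ss su]]; apply: (@measurable_fun_cvg _ _ _ D (fun n t => sqnorm (s n t))).
  by move=> n; have /step_funP[l ml ->] := ss n; exact: seq_step_sqnorm_measurable.
by move=> t Dt; exact: (sqnorm_cvg (su t Dt)).
Qed.

Lemma bochner_le V (W : hilbertType R) (u : R -> V) (v : R -> W) (C : R) : 0 <= C ->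
  strongly_measurable u -> strongly_measurable v ->
  (forall t, D t -> sqnorm (v t) <= C * sqnorm (u t)) ->
  (bochner_sqnorm v <= C%:E * bochner_sqnorm u)%E.
Proof.
move=> C0 mu_ mv h.
have mEu : @measurable_fun _ _ (measurableTypeR R) _ D (fun t => (sqnorm (u t))%:E).
  by apply/measurable_EFinP; exact: sqnorm_measurable.
have mEv : @measurable_fun _ _ (measurableTypeR R) _ D (fun t => (sqnorm (v t))%:E).
  by apply/measurable_EFinP; exact: sqnorm_measurable.
rewrite /bochner_sqnorm -(ge0_integralZl mu mD mEu); last 2 first.
- by move=> t _; rewrite lee_fin sqnorm_ge0.
- by rewrite lee_fin.
apply: (@ge0_le_integral _ _ R mu _ mD).
- by move=> t _; rewrite lee_fin sqnorm_ge0.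
- exact: mEv.
- by apply: emeasurable_funM => //; exact: measurable_cst.
- by move=> t Dt; rewrite -EFinM lee_fin; exact: h.
Qed.

Lemma bochner_ge0 V (u : R -> V) : (0 <= bochner_sqnorm u)%E.
Proof. by apply: integral_ge0 => t _; rewrite lee_fin sqnorm_ge0. Qed.

Lemma bochner_integrable V (u : R -> V) : strongly_measurable u ->
  (bochner_sqnorm u < +oo)%E -> mu.-integrable D (EFin \o (fun t => sqnorm (u t))).
Proof.
move=> mu_ fin; apply/integrableP; split.
  by apply/measurable_EFinP; exact: sqnorm_measurable.
apply: le_lt_trans fin; rewrite le_eqVlt; apply/orP; left; apply/eqP.
by apply: eq_integral => t _ /=; rewrite ger0_norm ?sqnorm_ge0.
Qed.

(** The integrals are extended reals; the real bound on the right also says that they are finite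
    from some rank on. *)
Lemma ecvg0P (b : nat -> \bar R) : (forall n, 0 <= b n)%E ->
  (b n @[n --> \oo] --> 0%E) <->
  forall e : R, 0 < e -> exists N, forall n, (N <= n)%N -> (b n <= e%:E)%E.
Proof.
move=> b0; split=> [bl e e0|h].
  move/fine_cvgP : bl => [[N1 _ h1] /cvgrPdist_lt/(_ e e0)[N2 _ h2]].
  exists (maxn N1 N2) => n; rewrite geq_max => /andP[n1 n2].
  rewrite -(fineK (h1 n n1)) lee_fin; apply: ltW; apply: le_lt_trans (h2 n n2).
  by rewrite /= sub0r normrN ler_norm.
apply/fine_cvgP; split.
  have [N hN] := h 1 ltr01; exists N => // n /= Nn.
  by rewrite ge0_fin_numE//; apply: le_lt_trans (hN n Nn) _; rewrite ltry.
apply/cvgrPdist_lt => e e0; have e2 : 0 < e / 2 by rewrite divr_gt0.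
have [N hN] := h _ e2; exists N => // n /= Nn.
have bfin : b n \is a fin_num.
  by rewrite ge0_fin_numE//; apply: le_lt_trans (hN n Nn) _; rewrite ltry.
rewrite sub0r normrN ger0_norm ?fine_ge0//.
have := hN n Nn; rewrite -{1}(fineK bfin) lee_fin => /le_lt_trans; apply; lra.
Qed.

End Bochner.

(** * Closability of the gradient *)

Section Closability.
Context {R : realType}.
Variables (H : fock_space R) (K : L2SC H) (K2 : tensor_product K K).
Notation sc h := (semicircular h : H -> H).
Notation Om := (vacuum H).
Notation emb := (L2_emb K).
Notation kap := (kap K).
Notation rtens := (rtens H).
Notation tens := (fock_tens H).
Notation tp := (tp K2).
Notation kw := (@kw R H K).
Notation wick_grad := (@wick_grad R H K K2).
Notation gradW := (@gradW R H K K2).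
Notation mu := (@lebesgue_measure R).
Notation D := (@half_line R).
Local Notation mD := (@measurable_half_line R).
Implicit Types (u v w : R -> K2).

Lemma cinteg0 : cinteg (fun=> 0 : R[i]).
Proof.
have h : mu.-integrable D (EFin \o (fun=> 0 : R)) by exact: integrable0.
by split.
Qed.

Lemma cint0 : cint (fun=> 0 : R[i]) = 0.
Proof.
have h : (\int[mu]_(t in D) (0 : R))%R = 0 by rewrite (Rintegral_cst _ mD) mul0r.
by rewrite /cint /= !h.
Qed.

Lemma cintegZ c (f : R -> R[i]) : cinteg f -> cinteg (fun t => c * f t).
Proof.
move=> hf; have := cinteg_lin c hf cinteg0.
by congr cinteg; apply/funext => t; rewrite addr0.
Qed.

Lemma cintZ c (f : R -> R[i]) : cinteg f -> cint (fun t => c * f t) = c * cint f.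
Proof.
move=> hf; have := cint_lin c hf cinteg0; rewrite cint0 addr0 => <-.
by congr cint; apply/funext => t; rewrite addr0.
Qed.

Lemma kw_dot gs hs : hdot (kw gs) (kw hs) = hdot (tens (map cpx gs)) (tens (map cpx hs)).
Proof. exact: kap_dot. Qed.

Lemma tens_nil_cons g gs : L2C_seq (g :: gs) -> hdot (tens [::]) (tens (g :: gs)) = 0.
Proof. by move=> h; rewrite fock_dot. Qed.

Lemma tens_cons_nil g gs : L2C_seq (g :: gs) -> hdot (tens (g :: gs)) (tens [::]) = 0.
Proof. by move=> h; rewrite fock_dot. Qed.

(** Every term after the first has a nonempty left factor, orthogonal to the vacuum. *)
Lemma wick_grad_dot_nil f gs b t : L2C_seq (map cpx (f :: gs)) ->
  hdot (wick_grad (f :: gs) t) (tp (kw [::]) (kw b)) =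
  hdot (kw gs) (kw b) * cpx f t.
Proof.
move=> /L2C_seq_cons[hf hgs].
rewrite wick_grad_cons dotDl dotZl tp_dot dot_suml big1 => [|i _]; last first.
  rewrite dotZl tp_dot kw_dot tens_cons_nil ?mul0r ?mulr0//.
  by apply/L2C_seq_cons; split=> //; exact: L2C_seq_take.
rewrite addr0 [hdot (kw [::]) _]kw_dot fock_dot// /fock_gram /= big_nil mul1r.
by rewrite mulrC.
Qed.

(** The first term has the vacuum as left factor and is orthogonal to a1 :: a; in the others the
    letters f and a1 pair off, which drives the induction on words in [wick_grad_test]. *)
Lemma wick_grad_dot_cons f gs a1 a b t : L2C_seq (map cpx (f :: gs)) ->
  L2C_seq (map cpx (a1 :: a)) ->
  hdot (wick_grad (f :: gs) t) (tp (kw (a1 :: a)) (kw b)) =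
  L2C_dot (cpx f) (cpx a1) * hdot (wick_grad gs t) (tp (kw a) (kw b)).
Proof.
move=> /L2C_seq_cons[hf hgs] ha; have /L2C_seq_cons[ha1 ha'] := ha.
rewrite wick_grad_cons dotDl dotZl tp_dot kw_dot tens_nil_cons// mul0r mulr0 add0r.
rewrite !dot_suml mulr_sumr; apply: eq_bigr => i _.
rewrite !dotZl !tp_dot !kw_dot tens_dot_cons//; last exact: L2C_seq_take.
by rewrite !mulrA; congr (_ * _ * _); rewrite mulrC.
Qed.

(* Integration by parts: the divergence of g W(a) (x) W(b) is a (x) g (x) b. *)
Lemma wick_grad_test gs a b (g : R -> R[i]) : L2C_seq (map cpx gs) ->
  L2C_seq (map cpx a) -> L2C_seq (map cpx b) -> L2C g ->
  cinteg (fun t => hdot (wick_grad gs t) (tp (kw a) (kw b)) * (g t)^*) /\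
  cint (fun t => hdot (wick_grad gs t) (tp (kw a) (kw b)) * (g t)^*) =
  hdot (tens (map cpx gs)) (tens (map cpx a ++ g :: map cpx b)).
Proof.
move=> + + hb hg; elim: gs a => [|f gs ih] a hgs ha.
  rewrite (_ : (fun _ => _) = (fun=> 0)); last first.
    by apply/funext => t; rewrite wick_grad_nil dot0l mul0r.
  split; first exact: cinteg0.
  have hall : L2C_seq (map cpx a ++ g :: map cpx b).
    by apply/L2C_seq_cat; split=> //; apply/L2C_seq_cons.
  rewrite cint0; case: a hall {ha} => [|a1 a] hall; by rewrite tens_nil_cons.
have /L2C_seq_cons[hf hgs'] := hgs.
case: a ha => [|a1 a] ha.
  rewrite (_ : (fun _ => _) = (fun t => hdot (kw gs) (kw b) * (cpx f t * (g t)^*))); last first.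
    by apply/funext => t; rewrite wick_grad_dot_nil// mulrA.
  have hfg := L2C_cinteg hf hg; split; first exact: cintegZ.
  by rewrite cintZ// -L2C_dotE kw_dot /= tens_dot_cons// mulrC.
have /L2C_seq_cons[ha1 ha'] := ha; have [i1 e1] := ih a hgs' ha'.
rewrite (_ : (fun _ => _) = (fun t => L2C_dot (cpx f) (cpx a1) *
   (hdot (wick_grad gs t) (tp (kw a) (kw b)) * (g t)^*))); last first.
  by apply/funext => t; rewrite wick_grad_dot_cons// mulrA.
split; first exact: cintegZ.
rewrite cintZ// e1 /= tens_dot_cons//.
by apply/L2C_seq_cat; split=> //; apply/L2C_seq_cons.
Qed.

Lemma gradW_test s (a b : rword) (g : R -> R[i]) : L2C g ->
  cinteg (fun t => hdot (gradW s t) (tp (kap (rtens a)) (kap (rtens b))) * (g t)^*) /\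
  cint (fun t => hdot (gradW s t) (tp (kap (rtens a)) (kap (rtens b))) * (g t)^*) =
  hdot (comb rtens s) (tens (map cpx (sval a) ++ g :: map cpx (sval b))).
Proof.
move=> hg; elim: s => [|[c w] s [ih1 ih2]].
  rewrite (_ : (fun _ => _) = (fun=> 0)); last first.
    by apply/funext => t; rewrite /gradW /comb big_nil dot0l mul0r.
  by split; [exact: cinteg0|rewrite cint0 /comb big_nil dot0l].
have [h1 h2] := wick_grad_test (svalP w) (svalP a) (svalP b) hg.
rewrite (_ : (fun _ => _) = (fun t =>
   c * (hdot (wick_grad (sval w) t) (tp (kw (sval a)) (kw (sval b))) * (g t)^*) +
   hdot (gradW s t) (tp (kap (rtens a)) (kap (rtens b))) * (g t)^*)); last first.
  by apply/funext => t; rewrite /gradW comb_cons dotDl dotZl mulrDl mulrA.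
split; first exact: cinteg_lin.
by rewrite cint_lin// h2 ih2 comb_cons dotDl dotZl.
Qed.

Lemma strongly_measurable_wick_grad gs : L2C_seq (map cpx gs) ->
  strongly_measurable (wick_grad gs).
Proof.
move=> hgs; apply: strongly_measurable_sum => i.
apply: strongly_measurable_scale.
have /L2C_cpxP[] // : L2C (cpx (nth (fun=> 0) gs i)).
by apply: hgs; apply: map_f; exact: mem_nth.
Qed.

Lemma strongly_measurable_gradW s : strongly_measurable (gradW s).
Proof.
apply: strongly_measurable_sum => p.
have := strongly_measurable_bop (bop_scale _ p.1) (strongly_measurable_wick_grad (svalP p.2)).
by [].
Qed.

Lemma malliavin_strongly_measurable A u : malliavin_alg A u -> strongly_measurable u.
Proof.
move=> /malliavin_wick[s [_ g]]; have := strongly_measurable_gradW s.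
by congr strongly_measurable; apply/funext => t; rewrite g.
Qed.

Lemma strongly_measurableB u v : strongly_measurable u -> strongly_measurable v ->
  strongly_measurable (fun t => u t - v t).
Proof.
move=> hu hv; have := strongly_measurableD hu (strongly_measurable_bop (bop_scale _ (-1)) hv).
by congr strongly_measurable; apply/funext => t /=; rewrite scaleN1r.
Qed.

Lemma dot_L2C w x : strongly_measurable w -> (bochner_sqnorm w < +oo)%E ->
  L2C (fun t => hdot (w t) x).
Proof.
move=> mw fin; have [mr mi] := dot_measurable x mw.
have iw := bochner_integrable mw fin.
have ib : mu.-integrable D (EFin \o (fun t => sqnorm x * sqnorm (w t))).
  exact: (integrableZl mD (sqnorm x) iw).
have bound t : nsq (hdot (w t) x) <= sqnorm x * sqnorm (w t).
  by rewrite mulrC CauchySchwarz_sqnorm.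
apply/L2CP; split; split=> //; apply: (@le_integrable _ _ R mu _ mD _ _ _ _ ib).
- by apply/measurable_EFinP; exact: measurable_funX.
- move=> t _ /=; rewrite lee_fin !ger0_norm ?sqr_ge0 ?mulr_ge0 ?sqnorm_ge0//.
  by apply: le_trans (bound t); rewrite /nsq lerDl sqr_ge0.
- by apply/measurable_EFinP; exact: measurable_funX.
- move=> t _ /=; rewrite lee_fin !ger0_norm ?sqr_ge0 ?mulr_ge0 ?sqnorm_ge0//.
  by apply: le_trans (bound t); rewrite /nsq lerDr sqr_ge0.
Qed.

(* The limit w is tested against its own component g = <w, W(a) (x) W(b)>: the integral
   of |g|^2 is the limit of <A_n Om, a (x) g (x) b>, which is 0. *)
Lemma closable_test w (A_ : nat -> H -> H) (v_ : nat -> R -> K2) (a b : rword) :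
  strongly_measurable w -> (bochner_sqnorm w < +oo)%E ->
  (forall n, malliavin_alg (A_ n) (v_ n)) ->
  emb (A_ n) @[n --> \oo] --> (0 : K) ->
  bochner_sqnorm (fun t => v_ n t - w t) @[n --> \oo] --> 0%E ->
  {ae mu, forall t, D t -> hdot (w t) (tp (kap (rtens a)) (kap (rtens b))) = 0}.
Proof.
move=> mw fin mA A0 v0; set x := tp _ _; pose g t := hdot (w t) x.
have hg : L2C g by exact: dot_L2C.
pose X := tens (map cpx (sval a) ++ g :: map cpx (sval b)).
have ig := L2C_cinteg hg hg.
have gg t : complex.Re (g t * (g t)^*) = nsq (g t) by rewrite -nsqE.
(* With z = <v_n - w, x>, the integrand <v_n, x> conj(g) is |g|^2 + z conj(g). Its real part is at
   least (|g|^2 - |z|^2) / 2, because |z + g|^2 >= 0, and |z|^2 <= |x|^2 |v_n - w|^2 by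
   Cauchy-Schwarz. This pointwise bound is then integrated. *)
have bd n : (bochner_sqnorm (fun t => (v_ n t - w t)%R) < +oo)%E ->
    2^-1 * L2C_sqnorm g <= complex.Re (hdot (A_ n Om) X) +
      2^-1 * sqnorm x * fine (bochner_sqnorm (fun t => v_ n t - w t)).
  move=> finb; have mvw := strongly_measurableB (malliavin_strongly_measurable (mA n)) mw.
  have ib := bochner_integrable mvw finb.
  have [s [sE sg]] := malliavin_wick (mA n).
  have [i1 e1] := gradW_test s a b hg.
  have iv : mu.-integrable D (EFin \o (fun t => complex.Re (hdot (v_ n t) x * (g t)^*))).
    have := proj1 i1; congr (is_true (integrable _ _ _)); apply/funext => t /=.
    by rewrite sg.
  have -> : complex.Re (hdot (A_ n Om) X) =
      (\int[mu]_(t in D) complex.Re (hdot (v_ n t) x * (g t)^*))%R.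
    rewrite sE -e1 /cint /=; apply: eq_Rintegral => t _; by rewrite sg.
  rewrite [fine _](_ : _ = (\int[mu]_(t in D) sqnorm (v_ n t - w t))%R)//.
  have inq : mu.-integrable D (EFin \o (fun t => nsq (g t))).
    have := proj1 ig; congr (is_true (integrable _ _ _)); apply/funext => t /=.
    by rewrite gg.
  rewrite /L2C_sqnorm -(RintegralZl _ mD inq) -(RintegralZl _ mD ib).
  have ib2 := integrableZl mD (2^-1 * sqnorm x) ib.
  rewrite -(RintegralD mD iv ib2).
  apply: (le_Rintegral mD).
  - exact: (integrableZl mD 2^-1 inq).
  - exact: (integrableD mD iv ib2).
  move=> t _.
  have E : complex.Re (hdot (v_ n t) x * (g t)^*) =
      nsq (g t) + complex.Re (hdot (v_ n t - w t) x * (g t)^*).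
    by rewrite -gg -cReD -mulrDl -/(g t) dotBl addrC subrK.
  have CS := CauchySchwarz_sqnorm (v_ n t - w t) x.
  have := nsq_ge0 (hdot (v_ n t - w t) x + g t).
  rewrite E cReMJ; move: CS; set z := hdot (v_ n t - w t) x.
  rewrite /nsq !(cReD, cImD) => CS; nra.
have I0 : L2C_sqnorm g = 0.
  apply/eqP; rewrite eq_le L2C_sqnorm_ge0 andbT.
  (* Twice the right side of [bd], once both of its error terms are controlled by [e]. *)
  apply: (@sqnorm_le_eps _ _ (2 + sqnorm x)); first by rewrite addr_ge0// sqnorm_ge0.
  move=> e e0; rewrite add0r.
  have M0 : 0 < sqnorm X + 1 by rewrite ltr_wpDl ?sqnorm_ge0.
  have /cvg_sqnormP/(_ (e ^+ 2 / (sqnorm X + 1)))[|N1 h1] := A0.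
    by rewrite divr_gt0// exprn_gt0.
  have [N2 h2] := (proj1 (ecvg0P (fun n => bochner_ge0 (fun t => v_ n t - w t)))) v0 e e0.
  pose n := maxn N1 N2.
  have := h1 n (leq_maxl _ _); have := h2 n (leq_maxr _ _) => {h1 h2} h2.
  rewrite sub0r sqnormN -(kap_emb K (malliavin_SC (mA n))) sqnorm_kap => h1.
  have fb : (bochner_sqnorm (fun t => (v_ n t - w t)%R) < +oo)%E.
    by apply: le_lt_trans h2 _; rewrite ltry.
  have := bd n fb.
  have : fine (bochner_sqnorm (fun t => v_ n t - w t)) <= e.
    by rewrite -lee_fin fineK// ge0_fin_numE// bochner_ge0.
  have : complex.Re (hdot (A_ n Om) X) <= e.
    apply: le_trans (ler_norm _) _.
    rewrite -ler_sqr ?nnegrE ?(ltW e0)// real_normK ?num_real//.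
    have CS := CauchySchwarz_sqnorm (A_ n Om) X.
    rewrite ltr_pdivlMr// in h1.
    have := sqr_ge0 (complex.Im (hdot (A_ n Om) X)).
    have := sqnorm_ge0 (A_ n Om); have := sqnorm_ge0 X.
    move: CS; rewrite /nsq; nra.
  have := sqnorm_ge0 x; nra.
have mnsq : @measurable_fun _ _ (measurableTypeR R) _ D (fun t => (nsq (g t))%:E).
  have [mr mi] := dot_measurable x mw; apply/measurable_EFinP.
  by apply: measurable_funD; exact: measurable_funX.
have : (\int[mu]_(t in D) `|(nsq (g t))%:E|)%E = 0%E.
  have inq : mu.-integrable D (EFin \o (fun t => nsq (g t))).
    have := proj1 ig; congr (is_true (integrable _ _ _)); apply/funext => t /=.
    by rewrite gg.
  have := integrable_fin_num mD inq => /fineK E.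
  rewrite (_ : (\int[mu]_(t in D) `|(nsq (g t))%:E|)%E =
    (\int[mu]_(t in D) (EFin \o (fun t => nsq (g t))) t)%E); last first.
    by apply: eq_integral => t _ /=; rewrite ger0_norm// nsq_ge0.
  by rewrite -E; move: I0; rewrite /L2C_sqnorm /Rintegral => ->.
move/(ae_eq_integral_abs mu mD mnsq); apply: filterS => t h Dt.
by have [] := h Dt; exact: nsq_eq0.
Qed.

End Closability.

(** * Almost everywhere uniqueness of the gradient, and the passage to the closure *)

Section Uniqueness.
Context {R : realType}.
Variables (H : fock_space R) (K : L2SC H) (K2 : tensor_product K K).
Notation emb := (L2_emb K).
Notation rtens := (rtens H).
Notation tp := (tp K2).
Notation mu := (@lebesgue_measure R).
Notation D := (@half_line R).
Local Notation mD := (@measurable_half_line R).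
Implicit Types (u v w : R -> K2).

Lemma filter_ae_lebesgue : Filter (nbhs (almost_everywhere mu)).
Proof. exact: (@ae_filter_ringOfSetsType _ (measurableTypeR R) R mu). Qed.

Lemma aeS (P Q : R -> Prop) : (forall t, P t -> Q t) ->
  {ae mu, forall t, P t} -> {ae mu, forall t, Q t}.
Proof. by move=> PQ; apply: (@filterS _ _ filter_ae_lebesgue). Qed.

Lemma aeI (P Q : R -> Prop) : {ae mu, forall t, P t} -> {ae mu, forall t, Q t} ->
  {ae mu, forall t, P t /\ Q t}.
Proof. exact: (@filterI _ _ filter_ae_lebesgue). Qed.

Lemma ae_alln (P : nat -> R -> Prop) : (forall n, {ae mu, forall t, P n t}) ->
  {ae mu, forall t, forall n, P n t}.
Proof. exact: (@ae_foralln _ (measurableTypeR R) R mu). Qed.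

Lemma closed_subspace_total I (V : hilbertType R) (f : I -> V) (E : set V) :
  subspace E -> closure E `<=` E -> closure (Defs.span (range f)) = setT ->
  (forall i, E (f i)) -> forall x, E x.
Proof.
move=> [E0 lE] cE df Ef x; apply: cE; have : closure (Defs.span (range f)) x by rewrite df.
apply: closureS => _ /comb_span_memE[s ->]; elim: s => [|[c i] s ih].
  by rewrite /comb big_nil.
by rewrite comb_cons; exact: lE.
Qed.

Lemma closure_preimage_bop (U V : hilbertType R) (T : U -> V) (E : set V) : bop T ->
  closure E `<=` E -> closure (T @^-1` E) `<=` T @^-1` E.
Proof.
move=> [lT [C C0 hC]] cE x /closure_sqnormP cx; apply: cE; apply/closure_sqnormP => e e0.
have C1 : 0 < C + 1 by rewrite ltr_wpDl.
have [y Ty xy] := cx _ (divr_gt0 e0 C1); exists (T y) => //.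
rewrite ltr_pdivlMr// in xy; rewrite -(linB lT); apply: le_lt_trans (hC _) _.
by apply: le_lt_trans xy; rewrite mulrC ler_wpM2l ?sqnorm_ge0//; lra.
Qed.

Lemma subspace_preimage (U V : hilbertType R) (T : U -> V) (E : set V) : linear T ->
  subspace E -> subspace (T @^-1` E).
Proof.
move=> lT [E0 lE]; split; first by rewrite /preimage /= (lin0 lT).
by move=> a x y hx hy; rewrite /preimage /= lT; exact: lE.
Qed.

Lemma ae_orthogonal_subspace w :
  subspace [set e | {ae mu, forall t, D t -> hdot (w t) e = 0}].
Proof.
split; first by apply: (@aeW _ (measurableTypeR R) R mu) => t _; rewrite dot0r.
move=> a x y hx hy /=; apply: (aeS _ (aeI hx hy)) => t [{}hx {}hy] Dt.
by rewrite dotDr dotZr hx// hy// mulr0 addr0.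
Qed.

(** The exceptional null set depends on the vector, but a limit is reached along a sequence, and
    countably many null sets have a null union. *)
Lemma ae_orthogonal_closed w :
  closure [set e | {ae mu, forall t, D t -> hdot (w t) e = 0}] `<=`
  [set e | {ae mu, forall t, D t -> hdot (w t) e = 0}].
Proof.
move=> x /closure_sqnormP cx.
have /choice[s hs] : forall n : nat, exists y,
    {ae mu, forall t, D t -> hdot (w t) y = 0} /\ sqnorm (x - y) < n.+1%:R^-1.
  by move=> n; have [|y hy xy] := cx n.+1%:R^-1; [rewrite invr_gt0|exists y].
have : {ae mu, forall t, forall n, D t -> hdot (w t) (s n) = 0}.
  by apply: ae_alln => n; have [] := hs n.
apply: aeS => t h Dt; apply: nsq_eq0; apply/eqP; rewrite eq_le nsq_ge0 andbT.
apply: (@sqnorm_le_eps _ _ (sqnorm (w t))); first exact: sqnorm_ge0.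
move=> e e0; have [N hN] := invSn_lt e0.
have [_ xs] := hs N; have CS := CauchySchwarz_sqnorm (w t) (x - s N).
rewrite dotBr (h N Dt) subr0 in CS; rewrite add0r; apply: le_trans CS _.
by rewrite ler_wpM2l ?sqnorm_ge0//; apply: ltW; apply: lt_trans xs (hN N (leqnn N)).
Qed.

(** The vectors almost everywhere orthogonal to [w] form a closed subspace, so totality of words can
    be applied to one tensor factor at a time, and then totality of the elementary tensors. *)
Lemma ae_orthogonal_all w :
  (forall a b : rword, {ae mu, forall t, D t ->
     hdot (w t) (tp (kap K (rtens a)) (kap K (rtens b))) = 0}) ->
  forall x, {ae mu, forall t, D t -> hdot (w t) x = 0}.
Proof.
move=> h; set E := [set e | {ae mu, forall t, D t -> hdot (w t) e = 0}].
have sE : subspace E by exact: ae_orthogonal_subspace.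
have cE : closure E `<=` E by exact: ae_orthogonal_closed.
have bl y : bop (fun x => tp x y).
  split; first exact: tp_linl.
  by exists (sqnorm y); rewrite ?sqnorm_ge0// => x; rewrite sqnorm_tp mulrC.
have br x : bop (tp x).
  split; first exact: tp_linr.
  by exists (sqnorm x); rewrite ?sqnorm_ge0// => y; rewrite sqnorm_tp.
have hall (S : H -> K2) : bop S -> (forall a, E (S (rtens a))) -> forall x, E (S x).
  move=> bS; apply: (closed_subspace_total (subspace_preimage (proj1 bS) sE)
    (closure_preimage_bop bS cE) (rtens_total H)).
have h1 b x : E (tp (kap K x) (kap K (rtens b))).
  apply: (hall (fun x => tp (kap K x) (kap K (rtens b)))) => [|a]; last exact: h.
  exact: (bop_comp (bl _) (bop_kap K)).
have h2 x y : E (tp (kap K x) (kap K y)).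
  apply: (hall (fun y => tp (kap K x) (kap K y))) => [|b]; last exact: h1.
  exact: (bop_comp (br _) (bop_kap K)).
apply: (closed_subspace_total sE cE (tp_total K2)) => -[x y] /=.
by rewrite -(kapVK x) -(kapVK y).
Qed.

(* A strongly measurable function takes its values in a separable subspace. *)
Lemma ae_orthogonal_eq0 w : strongly_measurable w ->
  (forall x, {ae mu, forall t, D t -> hdot (w t) x = 0}) ->
  {ae mu, forall t, D t -> w t = 0}.
Proof.
move=> [s [ss sw]] h.
have /choice[l hl] : forall n, exists l : seq (set R * K2), s n = seq_step l.
  by move=> n; have /step_funP[l _ ->] := ss n; exists l.
have : {ae mu, forall t, forall n i, D t -> hdot (w t) (nth (set0, 0) (l n) i).2 = 0}.
  by apply: ae_alln => n; apply: ae_alln => i; exact: h.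
apply: aeS => t ht Dt; apply: sqnorm_eq0; apply/eqP; rewrite eq_le sqnorm_ge0 andbT.
apply: (@sqnorm_le_eps _ _ 1) => // e e0; rewrite add0r mul1r.
have /cvg_sqnormP/(_ e e0)[N hN] := sw t Dt.
have ws : hdot (w t) (s N t) = 0.
  rewrite hl /seq_step dot_sumr (big_nth (set0, 0)) big_mkord big1// => i _.
  by rewrite dotZr ht// mulr0.
(* [w t] is orthogonal to [s N t] and close to it, so Pythagoras bounds [sqnorm (w t)] by [e]. *)
apply: le_trans (ltW (hN N (leqnn _))).
by rewrite sqnormB ws mulr0 subr0 lerDl sqnorm_ge0.
Qed.

Lemma bochner_sub_le u v : strongly_measurable u -> strongly_measurable v ->
  (bochner_sqnorm (fun t => (u t - v t)%R) <=
   2%:E * bochner_sqnorm u + 2%:E * bochner_sqnorm v)%E.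
Proof.
move=> hu hv.
have mEu : @measurable_fun _ _ (measurableTypeR R) _ D (fun t => (sqnorm (u t))%:E).
  by apply/measurable_EFinP; exact: sqnorm_measurable.
have mEv : @measurable_fun _ _ (measurableTypeR R) _ D (fun t => (sqnorm (v t))%:E).
  by apply/measurable_EFinP; exact: sqnorm_measurable.
have mEw : @measurable_fun _ _ (measurableTypeR R) _ D (fun t => (sqnorm (u t - v t))%:E).
  by apply/measurable_EFinP; apply: sqnorm_measurable; exact: strongly_measurableB.
have c2 := @measurable_cst _ _ (measurableTypeR R) (\bar R) D (2%:E : \bar R).
have nn (z : R -> K2) t : D t -> (0 <= (sqnorm (z t))%:E)%E.
  by move=> _; rewrite lee_fin sqnorm_ge0.
rewrite /bochner_sqnorm -(ge0_integralZl mu mD mEu (nn u)) ?lee_fin//.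
rewrite -(ge0_integralZl mu mD mEv (nn v)) ?lee_fin//.
rewrite -(ge0_integralD mu mD); first last.
- by apply: emeasurable_funM.
- by move=> t Dt; rewrite mule_ge0// nn.
- by apply: emeasurable_funM.
- by move=> t Dt; rewrite mule_ge0// nn.
apply: (@ge0_le_integral _ _ R mu _ mD).
- by move=> t _; rewrite lee_fin sqnorm_ge0.
- exact: mEw.
- by apply: emeasurable_funD; apply: emeasurable_funM.
- by move=> t Dt; rewrite -!EFinM -EFinD lee_fin -mulrDr sqnormBle.
Qed.

(** The difference of the two approximating sequences is again in the algebra; it tends to 0 while
    its gradients tend to u - u', which is the situation of [closable_test]. *)
Lemma malliavin_graph_unique (F : K) u u' :
  malliavin_graph F u -> malliavin_graph F u' -> {ae mu, forall t, D t -> u t = u' t}.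
Proof.
move=> [[mu_ fu] [A [v [mA AF vu]]]] [[mu' fu'] [A' [v' [mA' AF' vu']]]].
pose w t := u t - u' t.
have mw : strongly_measurable w by exact: strongly_measurableB.
have fw : (bochner_sqnorm w < +oo)%E.
  apply: le_lt_trans (bochner_sub_le mu_ mu') _.
  by rewrite lte_add_pinfty// lte_mul_pinfty// lee_fin.
pose B n (x : H) := -1 *: A' n x + A n x.
pose z n t := -1 *: v' n t + v n t.
have mB n : malliavin_alg (B n) (z n) by exact: malliavin_lin.
have B0 : emb (B n) @[n --> \oo] --> (0 : K).
  have embB n : emb (B n) = emb (A n) - emb (A' n).
    rewrite -(kap_emb K (malliavin_SC (mB n))) -(kap_emb K (malliavin_SC (mA n))).
    rewrite -(kap_emb K (malliavin_SC (mA' n))) /B (proj1 (bop_kap K)).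
    by rewrite scaleN1r addrC.
  under eq_fun do rewrite embB.
  by rewrite -(subrr F); apply: cvgB.
have z0 : bochner_sqnorm (fun t => z n t - w t) @[n --> \oo] --> 0%E.
  apply/ecvg0P => [n|e e0]; first exact: bochner_ge0.
  (* [bochner_sub_le] doubles each of the two errors. *)
  have e4 : 0 < e / 4 by rewrite divr_gt0.
  have [N1 h1] := (proj1 (ecvg0P (fun n => bochner_ge0 (fun t => v n t - u t)))) vu _ e4.
  have [N2 h2] := (proj1 (ecvg0P (fun n => bochner_ge0 (fun t => v' n t - u' t)))) vu' _ e4.
  exists (maxn N1 N2) => n; rewrite geq_max => /andP[/h1 n1 /h2 n2].
  rewrite (_ : (fun t => z n t - w t) = (fun t => (v n t - u t) - (v' n t - u' t))); last first.
    apply/funext => t; rewrite /z /w scaleN1r !opprB.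
    by rewrite [- _ + _]addrC addrACA [RHS]addrACA; congr (_ + _); rewrite addrC.
  have m1 := strongly_measurableB (malliavin_strongly_measurable (mA n)) mu_.
  have m2 := strongly_measurableB (malliavin_strongly_measurable (mA' n)) mu'.
  apply: le_trans (bochner_sub_le m1 m2) _.
  apply: (@le_trans _ _ (2%:E * (e / 4)%:E + 2%:E * (e / 4)%:E)%E).
    by apply: leeD; apply: lee_wpmul2l; rewrite ?lee_fin.
  by rewrite -!EFinM -EFinD lee_fin; lra.
have : {ae mu, forall t, D t -> w t = 0}.
  apply: (ae_orthogonal_eq0 mw); apply: ae_orthogonal_all => a b.
  exact: (closable_test a b mw fw mB B0 z0).
by apply: aeS => t h Dt; apply/eqP; rewrite -subr_eq0; apply/eqP; exact: h.
Qed.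

Lemma nablaP (F : K) : D12 K2 F -> malliavin_graph F (nabla K2 F).
Proof. by move=> [u hu]; apply: (@getPex _ [set u | malliavin_graph F u]); exists u. Qed.

(** The approximating sequence is replaced, term by term, by its conditional expectations. One
    constant [C] bounds the new gradients pointwise in t, for the limit and for the errors alike. *)
Lemma cond_exp_graph (F : K) u (A : set R) : measurable A -> A `<=` D ->
  (mu A < +oo)%E -> malliavin_graph F u ->
  malliavin_graph (cond_exp A F) (fun t => (\1_A t : R)%:C *: cond_exp2 A (u t)).
Proof.
move=> mA AD finA [[mu_ fu] [B [v [mB BF vu]]]].
have [bE _] := cond_exp2P K2 mA AD finA; have [lE [C C0 hC]] := bE.
have cutE z : strongly_measurable z ->
    strongly_measurable (fun t => (\1_A t : R)%:C *: cond_exp2 A (z t) : K2).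
  by move=> mz; apply: strongly_measurable_cut => //; exact: (strongly_measurable_bop bE mz).
have bd (z : R -> K2) t :
    sqnorm ((\1_A t : R)%:C *: cond_exp2 A (z t) : K2) <= C * sqnorm (z t).
  apply: le_trans (hC _); rewrite nsq_sqnormZ ler_piMl ?sqnorm_ge0//.
  by rewrite /nsq /= expr0n addr0 indicE; case: (t \in A); rewrite ?expr1n ?expr0n.
split.
  split; first exact: cutE.
  apply: le_lt_trans (bochner_le C0 mu_ (cutE _ mu_) (fun t _ => bd u t)) _.
  by rewrite lte_mul_pinfty// lee_fin.
have /choice[G hG] : forall n, exists G : H -> H,
    malliavin_alg G (fun t => (\1_A t : R)%:C *: cond_exp2 A (v n t) : K2) /\
    emb G = cond_exp A (emb (B n)).
  by move=> n; have [G mG eG] := malliavin_cond_exp mA AD finA (mB n); exists G.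
exists G, (fun n t => (\1_A t : R)%:C *: cond_exp2 A (v n t)); split.
- by move=> n; have [] := hG n.
- rewrite (_ : (fun n => emb (G n)) = (fun n => cond_exp A (emb (B n)))); last first.
    by apply/funext => n; have [] := hG n.
  exact: (bop_cvg (bop_cond_exp K mA AD finA) BF).
apply/ecvg0P => [n|e e0]; first exact: bochner_ge0.
have C1 : 0 < C + 1 by rewrite ltr_wpDl.
have [N hN] := (proj1 (ecvg0P (fun n => bochner_ge0 (fun t => v n t - u t)))) vu _ (divr_gt0 e0 C1).
exists N => n Nn.
have mvu := strongly_measurableB (malliavin_strongly_measurable (mB n)) mu_.
rewrite (_ : (fun t => _ - _) =
    (fun t => (\1_A t : R)%:C *: cond_exp2 A (v n t - u t))); last first.
  by apply/funext => t; rewrite (linB lE) scalerBr.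
apply: le_trans (bochner_le C0 mvu (cutE _ mvu) (fun t _ => bd (fun t => v n t - u t) t)) _.
apply: (@le_trans _ _ (C%:E * (e / (C + 1))%:E)%E).
  by rewrite lee_wpmul2l ?lee_fin//; exact: hN.
by rewrite -EFinM lee_fin mulrA ler_pdivrMr// mulrC ler_wpM2l ?ltW//; lra.
Qed.

End Uniqueness.

Theorem lemma5 (R : realType) (H : fock_space R) (K : L2SC H)
    (K2 : tensor_product K K) (F : K) (A : set R)
    (hF : D12 K2 F)
    (mA : measurable A) (A_half_line : A `<=` half_line)
    (A_finite : (lebesgue_measure A < +oo)%E) :
  D12 K2 (cond_exp A F) /\
  {ae lebesgue_measure, forall t : R, half_line t ->
     nabla K2 (cond_exp A F) t
     = (\1_A t : R)%:C *: cond_exp2 A (nabla K2 F t)}.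
Proof.
have G := cond_exp_graph mA A_half_line A_finite (nablaP hF).
have hD : D12 K2 (cond_exp A F) by exists (fun t => (\1_A t : R)%:C *: cond_exp2 A (nabla K2 F t)).
(* [nabla] is an arbitrary choice among the representatives; uniqueness compares it with the
   explicit one of [G]. *)
by split=> //; exact: malliavin_graph_unique (nablaP hD) G.
Qed.
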